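(* Let $\Omega\subset\mathbb{R}^N$ ($N\ge 2$) be a smooth bounded domain and let $c(x)$ be a smooth vector field on $\overline{\Omega}$ that is incompressible, i.e. $\operatorname{div} c(x)=0$ in $\Omega$. For $A>0$ let $\psi_A$ be the solution of $-\Delta\psi_A+A\,c(x)\cdot\nabla\psi_A=1$ in $\Omega$, $\psi_A=0$ on $\partial\Omega$, and let $\psi_{A,\Omega}=\sup_{x\in\Omega}\psi_A(x)$. Then $\psi_{A,\Omega}\to 0$ as $A\to\infty$ if and only if $c(x)$ has no non-zero first integrals in $H^1_0(\Omega)$.
   Context: A function $\Psi\in H^1(\Omega)$ is called a first integral of the flow $c$ if $c\cdot\nabla\Psi=0$ a.e. in $\Omega$. The boundary value problem defining $\psi_A$ has a unique nonnegative smooth solution. *)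

(* Defs.v *)
From HB Require Import structures.
From mathcomp Require Import all_boot all_order all_algebra.
From mathcomp Require Import all_classical all_reals all_analysis.

Set Implicit Arguments.
Unset Strict Implicit.
Unset Printing Implicit Defensive.

Import Order.TTheory GRing.Theory Num.Theory.
Import numFieldNormedType.Exports.

Local Open Scope classical_set_scope.
Local Open Scope ring_scope.

(* R^n is 'rV[R]_n. It carries the sigma-algebra generated by the coordinates
   (its Borel sigma-algebra), and Lebesgue measure is the n-fold product of
   the one-dimensional one. *)

Definition measure_rV_display : measure_display -> measure_display.
Proof. exact. Qed.

Section measurable_rV.
Context {R : realType} (n : nat).

Definition rV_coord (i : 'I_n) (x : 'rV[R]_n) : measurableTypeR R := x ord0 i.

Let rV_set0 : g_sigma_preimage rV_coord set0.
Proof. exact: sigma_algebra0. Qed.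

Let rV_setC A : g_sigma_preimage rV_coord A -> g_sigma_preimage rV_coord (~` A).
Proof. exact: sigma_algebraC. Qed.

Let rV_bigcup (F : _^nat) : (forall i, g_sigma_preimage rV_coord (F i)) ->
  g_sigma_preimage rV_coord (\bigcup_i (F i)).
Proof. exact: sigma_algebra_bigcup. Qed.

HB.instance Definition _ :=
  @isMeasurable.Build (measure_rV_display default_measure_display)
  'rV[R]_n (g_sigma_preimage rV_coord) rV_set0 rV_setC rV_bigcup.

Lemma measurable_rV_coord (i : 'I_n) :
  measurable_fun [set: 'rV[R]_n] (rV_coord i).
Proof.
move=> _ Y mY; rewrite setTI; apply: sub_sigma_algebra => /=.
rewrite -bigcup_seq/=; exists i => /=; first by rewrite mem_index_enum.
by exists Y => //; rewrite setTI.
Qed.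

Lemma measurable_fun_rVP d (T : measurableType d) (f : T -> 'rV[R]_n) :
  measurable_fun [set: T] f <->
  forall i, measurable_fun [set: T] (rV_coord i \o f).
Proof.
split=> [mf i|mf].
  exact: (measurableT_comp (measurable_rV_coord i) mf).
suff : g_sigma_preimage (fun i => rV_coord i \o f) `<=` measurable.
  rewrite g_sigma_preimage_comp => sub _ A mA.
  by apply: sub; exists A.
apply: smallest_sub; first exact: sigma_algebra_measurable.
rewrite -bigcup_seq; apply: bigcup_sub => i _ A [B mB <-].
exact: mf.
Qed.

End measurable_rV.

Section lebesgue_rV.
Context {R : realType}.

Definition cons_rV n (p : measurableTypeR R * 'rV[R]_n) : 'rV[R]_n.+1 :=
  row_mx (const_mx p.1 : 'rV[R]_1) p.2.

Lemma measurable_cons_rV n : measurable_fun setT (@cons_rV n).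
Proof.
apply/measurable_fun_rVP => i.
have [j ->|j ->] := split_ordP (i : 'I_(1 + n)).
  have -> : rV_coord (lshift n j) \o @cons_rV n = fst.
    by apply/funext => p /=; rewrite /rV_coord/cons_rV row_mxEl mxE.
  exact: measurable_fst.
have -> : rV_coord (rshift 1 j) \o @cons_rV n = rV_coord j \o snd.
  by apply/funext => p /=; rewrite /rV_coord/cons_rV row_mxEr.
exact: (measurableT_comp (measurable_rV_coord j) measurable_snd).
Qed.

Definition uncons_rV n (x : 'rV[R]_n.+1) : measurableTypeR R * 'rV[R]_n :=
  (x ord0 ord0, rsubmx (x : 'rV[R]_(1 + n))).

Lemma cons_rVK n : cancel (@cons_rV n) (@uncons_rV n).
Proof.
move=> [a x]; congr pair; last by rewrite /= row_mxKr.
have -> : @ord0 n = lshift n (@ord0 0) by exact/val_inj.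
by apply: (etrans (row_mxEl (const_mx a : 'rV[R]_1) x _ _)); rewrite mxE.
Qed.

Lemma measurable_uncons_rV n : measurable_fun setT (@uncons_rV n).
Proof.
apply/measurable_fun_pairP; split.
  exact: (@measurable_rV_coord R n.+1 ord0).
apply/measurable_fun_rVP => i.
have -> : rV_coord i \o (snd \o @uncons_rV n) =
    @rV_coord R n.+1 (rshift 1 i).
  by apply/funext => x; rewrite /rV_coord /= mxE.
exact: measurable_rV_coord.
Qed.

HB.instance Definition _ n := isMeasurableFun.Build _ _ _ _ (@cons_rV n)
  (@measurable_cons_rV n).

Section lebesgue_rV_step.
Variables (n : nat) (m : {sigma_finite_measure set 'rV[R]_n -> \bar R}).

Definition lebesgue_rV_step : set 'rV[R]_n.+1 -> \bar R :=
  pushforward (@lebesgue_measure R \x m)%E (@cons_rV n).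

Let step0 : lebesgue_rV_step set0 = 0%E.
Proof. exact: measure0. Qed.

Let step_ge0 A : (0 <= lebesgue_rV_step A)%E.
Proof. exact: measure_ge0. Qed.

Let step_sigma_additive : semi_sigma_additive lebesgue_rV_step.
Proof. exact: measure_semi_sigma_additive. Qed.

HB.instance Definition _ := isMeasure.Build _ _ _ lebesgue_rV_step
  step0 step_ge0 step_sigma_additive.

Let step_sigma_finite : sigma_finite setT lebesgue_rV_step.
Proof.
have /sigma_finiteP[F [TF ndF Foo]] := sigma_finiteT (@lebesgue_measure R).
have /sigma_finiteP[G [TG ndG Goo]] := sigma_finiteT m.
exists (fun k => @uncons_rV n @^-1` (F k `*` G k)).
  rewrite -preimage_bigcup -(_ : [set: _ * _] = \bigcup_k (F k `*` G k)).
    by rewrite preimage_setT.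
  rewrite -setXTT TF TG predeqE => -[x y]; split.
    move=> [/= [i _ Fix_] [k _ Gky]]; exists (maxn i k) => //; split.
    - by move: x Fix_; exact/subsetPset/ndF/leq_maxl.
    - by move: y Gky; exact/subsetPset/ndG/leq_maxr.
  by move=> [k _ []/= ? ?]; split; exists k.
move=> k; have [? ?] := Foo k; have [? ?] := Goo k; split.
  rewrite -[X in measurable X]setTI; apply: measurable_uncons_rV => //.
  exact: measurableX.
rewrite /lebesgue_rV_step /pushforward -comp_preimage.
have -> : @uncons_rV n \o @cons_rV n = id.
  by apply/funext => p /=; rewrite cons_rVK.
by rewrite preimage_id product_measure1E// lte_mul_pinfty// ge0_fin_numE.
Qed.

HB.instance Definition _ := Measure_isSigmaFinite.Build _ _ _ lebesgue_rV_step
  step_sigma_finite.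

End lebesgue_rV_step.

Fixpoint lebesgue_rV n : {sigma_finite_measure set 'rV[R]_n -> \bar R} :=
  if n is k.+1 then lebesgue_rV_step (lebesgue_rV k) else \d_(0 : 'rV[R]_0).

Lemma lebesgue_rV_box n (A : 'I_n -> set (measurableTypeR R)) :
  (forall i, measurable (A i)) ->
  lebesgue_rV n [set x | forall i, A i (x ord0 i)] =
  (\prod_(i < n) @lebesgue_measure R (A i))%E.
Proof.
elim: n A => [|n IHn] A mA.
  by rewrite big_ord0 /= diracE mem_set// => -[].
rewrite big_ord_recl -(IHn (fun i => A (lift ord0 i)))//.
rewrite /= /lebesgue_rV_step /pushforward -product_measure1E//; last first.
  rewrite [X in measurable X](_ : _ =
    \bigcap_(i in [set: 'I_n]) (rV_coord i @^-1` A (lift ord0 i))); last first.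
    by apply/seteqP; split=> x /= h i; [move=> _; exact: h|exact: h].
  apply: fin_bigcap_measurable => // i _.
  by rewrite -[X in measurable X]setTI; exact: measurable_rV_coord.
have cons0 a x : @cons_rV n (a, x) ord0 ord0 = a.
  exact: (congr1 fst (@cons_rVK n (a, x))).
have consS a x i : @cons_rV n (a, x) ord0 (lift ord0 i) = x ord0 i.
  have -> : lift ord0 i = rshift 1 i by exact/val_inj.
  exact: (row_mxEr (const_mx a : 'rV[R]_1) x _ _).
congr (_ _); apply/seteqP; split=> -[a x] /=.
  move=> Aax; split=> [|i]; first by rewrite -(cons0 a x).
  by rewrite -(consS a x).
move=> [Aa Ax] i; case: (unliftP ord0 i) => [j ->|->].
  by rewrite consS.
by rewrite cons0.
Qed.

End lebesgue_rV.

Section calculus.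
Context {R : realType} {n : nat}.
Implicit Types (f : 'rV[R]_n -> R) (U : set 'rV[R]_n).

Definition dotr (u v : 'rV[R]_n) : R := \sum_i u ord0 i * v ord0 i.

Definition partial (i : 'I_n) f (x : 'rV[R]_n) : R :=
  'D_(delta_mx ord0 i) f x.

Definition partials (s : seq 'I_n) f : 'rV[R]_n -> R := foldr partial f s.

Definition gradient f (x : 'rV[R]_n) : 'rV[R]_n := \row_i partial i f x.

Definition laplacian f (x : 'rV[R]_n) : R := \sum_i partials [:: i; i] f x.

Definition divergence (v : 'rV[R]_n -> 'rV[R]_n) (x : 'rV[R]_n) : R :=
  \sum_i partial i (fun y => v y ord0 i) x.

(* C^oo(U), for U open *)
Definition smooth_on U f := forall (s : seq 'I_n) x, U x ->
  {for x, continuous (partials s f)} /\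
  forall i, derivable (partials s f) x (delta_mx ord0 i).

(* C^oo(closure U), for U open: all the derivatives extend continuously
   up to the boundary *)
Definition smooth_on_closure U f :=
  [/\ smooth_on U f,
      {within closure U, continuous f} &
      forall s : seq 'I_n, exists2 g : 'rV[R]_n -> R,
        {within closure U, continuous g} &
        forall x, U x -> g x = partials s f x].

Definition boundary U := closure U `\` interior U.

End calculus.

Section domain.
Context {R : realType} {N : nat}.
Implicit Type Omega : set 'rV[R]_N.

(* Near each of its boundary points, Omega is, up to relabelling and
   reorienting the axes, the region strictly above the graph of a smooth
   function of the other N - 1 coordinates. *)
Definition smooth_boundary Omega := forall x0, boundary Omega x0 ->
  exists (i : 'I_N) (b : bool) (gamma : 'rV[R]_N.-1 -> R),
    smooth_on setT gamma /\
    \forall x \near x0,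
      Omega x <-> 0 < (-1) ^+ b * (x ord0 i - gamma (col' i x)).

Definition smooth_bounded_domain Omega :=
  [/\ open Omega, connected Omega, Omega !=set0, bounded_set Omega &
      smooth_boundary Omega].

Definition smooth_vector_field Omega (c : 'rV[R]_N -> 'rV[R]_N) :=
  forall i, smooth_on_closure Omega (fun x => c x ord0 i).

Definition incompressible Omega (c : 'rV[R]_N -> 'rV[R]_N) :=
  forall x, Omega x -> divergence c x = 0.

(* - Delta psi + A c . grad psi = 1 in Omega, psi = 0 on the boundary *)
Definition solves_bvp Omega (c : 'rV[R]_N -> 'rV[R]_N) (A : R)
    (psi : 'rV[R]_N -> R) :=
  [/\ smooth_on_closure Omega psi,
      forall x, Omega x ->
        - laplacian psi x + A * dotr (c x) (gradient psi x) = 1 &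
      forall x, boundary Omega x -> psi x = 0].

End domain.

(* Elements of L^2 and H^1 are represented by functions on R^N of which only
   the values on Omega matter, up to null sets; the weak gradient is
   likewise unique only up to null sets. *)
Section sobolev.
Context {R : realType} {N : nat}.
Local Notation mu := (lebesgue_rV N).
Implicit Types (Omega : set 'rV[R]_N) (u : 'rV[R]_N -> R).
Implicit Type G : 'rV[R]_N -> 'rV[R]_N.

Definition sqnormL2 Omega u : \bar R := (\int[mu]_(x in Omega) (u x ^+ 2)%:E)%E.

Definition L2 Omega u := measurable_fun Omega u /\ (sqnormL2 Omega u < +oo)%E.

Definition test_function Omega (phi : 'rV[R]_N -> R) :=
  [/\ smooth_on setT phi,
      compact (closure [set x | phi x != 0]) &
      closure [set x | phi x != 0] `<=` Omega].

Definition weak_gradient Omega u G :=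
  forall (i : 'I_N) phi, test_function Omega phi ->
    \int[mu]_(x in Omega) (u x * partial i phi x) =
    - \int[mu]_(x in Omega) (G x ord0 i * phi x).

(* u is in H^1(Omega), with weak gradient G *)
Definition H1_gradient Omega u G :=
  [/\ L2 Omega u, forall i, L2 Omega (fun x => G x ord0 i) &
      weak_gradient Omega u G].

Definition sqnormH1 Omega u G : \bar R :=
  (sqnormL2 Omega u + \sum_i sqnormL2 Omega (fun x => G x ord0 i))%E.

(* H^1_0(Omega): the closure of C_c^oo(Omega) in H^1(Omega) *)
Definition H10 Omega u := exists2 G, H1_gradient Omega u G &
  forall eps : R, 0 < eps -> exists2 phi, test_function Omega phi &
    (sqnormH1 Omega (fun x => u x - phi x)%R
       (fun x => G x - gradient phi x)%R < eps%:E)%E.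

Definition first_integral Omega (c : 'rV[R]_N -> 'rV[R]_N) u :=
  exists2 G, H1_gradient Omega u G &
    {ae mu, forall x, Omega x -> dotr (c x) (G x) = 0}.

Definition ae_zero Omega u := {ae mu, forall x, Omega x -> u x = 0}.

End sobolev.

(* Main.v *)
Require Import Defs.
From mathcomp Require Import all_boot all_order all_algebra.
From mathcomp Require Import all_classical all_reals all_analysis.
From mathcomp Require Import measurable_realfun ring lra.

Set Implicit Arguments.
Unset Strict Implicit.
Unset Printing Implicit Defensive.

Import Order.TTheory GRing.Theory Num.Theory.
Import numFieldNormedType.Exports.

Local Open Scope classical_set_scope.
Local Open Scope ring_scope.

(** The two halves rest on integral estimates whose constants do not involve A.
    Since div c = 0, the drift A c . grad psi disappears when the equation is
    tested against a function of psi alone ([bvp_truncated_energy]): the energy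
    estimates are those of the Laplacian.

    A nonzero first integral is an obstruction. Let Psi in H^1_0 satisfy
    c . grad Psi = 0, and let M bound psi_A. Testing the equation against
    Psi^2 / (psi_A + M) turns the drift into an integral of
    Psi ln (psi_A + M) c . grad Psi, which is zero. What remains gives
    |Psi|^2 <= 2 M |grad Psi|^2 in L^2 norms ([test_inequality],
    [obstruction_bound]). So sup psi_A cannot tend to 0 unless Psi = 0.

    Conversely, suppose that the integral of psi_A does not tend to 0. Smooth
    truncations of psi_A are test functions bounded in H^1, uniformly in A, and
    the equation divided by A shows that their limits are constant along c
    ([psi_pairing], [approx_pairing]). A strong limit is extracted by convexity:
    the truncations lie in nested convex sets, in which elements of nearly
    minimal H^1 norm form a Cauchy sequence ([nested_convex_cauchy],
    [persistent_cauchy]). Its limit is a first integral, nonzero because its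
    integral is positive ([first_integral_of_cauchy]). Thus, if there is no
    nonzero first integral, the integral of psi_A tends to 0. The De Giorgi
    iteration, based on a Faber-Krahn inequality ([faber_krahn]) and on the
    energy identities, then makes the supremum of psi_A small as soon as its
    integral is, uniformly in A ([de_giorgi_iteration],
    [sup_bound_of_integral]).

    The right-hand side 1 makes psi_A positive, and the boundary condition makes
    its superlevel sets compact subsets of Omega ([superlevel_compact]).
    Consequently all integrations by parts concern fields of class C^1 with
    compact support in Omega ([Int_divergence]). *)

(** * Borel sets and Lebesgue measure of R^n *)

Section borel_rV.
Context {R : realType} {n : nat}.
Implicit Types (U : set 'rV[R]_n) (x : 'rV[R]_n).

Lemma ball_rVP x e y :
  ball x e y <-> 0 < e /\ forall i, `|x ord0 i - y ord0 i| < e.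
Proof.
split=> [[e0 h]|[e0 h]]; split => //.
- by move=> i; exact: h.
- by move=> i j; rewrite (ord1 i); exact: h.
Qed.

Lemma rV_coord_le_norm x i : `|x ord0 i| <= `|x|.
Proof.
apply/ler_addgt0Pr => e e0; apply/ltW.
have : ball (0 : 'rV[R]_n) (`|x| + e) x.
  by rewrite -ball_normE /ball_/= sub0r normrN ltrDl.
by move=> /ball_rVP[_ /(_ i)]; rewrite mxE sub0r normrN.
Qed.

(** The sigma-algebra is generated by the coordinates, so an open set has to be
    written as a countable union of boxes: those with rational centre and
    radius 1 / (m + 1) that it contains. *)
Lemma open_measurable_rV U : open U -> measurable U.
Proof.
move=> oU.
pose B (p : 'rV[rat]_n * nat) : set 'rV[R]_n :=
  [set x | forall i, `|x ord0 i - ratr (p.1 ord0 i)| < p.2.+1%:R^-1].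
have mB p : measurable (B p).
  rewrite (_ : B p = \bigcap_(i in [set: 'I_n])
    (rV_coord i @^-1` ball (ratr (p.1 ord0 i) : R) (p.2.+1%:R^-1))); last first.
    apply/seteqP; split=> x /= h i.
      by move=> _; rewrite /rV_coord/= -ball_normE /ball_/= distrC; exact: h.
    by have := h i Logic.I; rewrite /rV_coord/= -ball_normE /ball_/= distrC.
  apply: fin_bigcap_measurable => // i _.
  rewrite -[X in measurable X]setTI; apply: measurable_rV_coord => //.
  by apply: open_measurable; exact: ball_open.
rewrite (_ : U = \bigcup_(p in [set p | B p `<=` U]) B p).
  rewrite bigcup_mkcond; apply: countable_bigcupT_measurable => // p.
  by case: ifPn.
apply/seteqP; split=> [x Ux|x [p Bp Bx]]; last exact: Bp.
have := open_nbhs_nbhs (conj oU Ux) => /nbhs_ballP[e /= e0 xeU].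
pose k := Num.Def.truncn (2 / e).
have ke : k.+1%:R^-1 < e / 2.
  rewrite -[ltRHS]invrK invf_div ltf_pV2 ?posrE ?divr_gt0//.
  by rewrite truncnS_gt.
have k0 : 0 < k.+1%:R^-1 :> R by rewrite invr_gt0.
have /choice[q qP] (i : 'I_n) :
    exists q : rat, `|x ord0 i - ratr q| < k.+1%:R^-1.
  have /rat_in_itvoo[q] : x ord0 i - k.+1%:R^-1 < x ord0 i + k.+1%:R^-1.
    by rewrite ltrD2l gtrN.
  rewrite in_itv/= => /andP[h1 h2]; exists q.
  by rewrite ltr_distlC h1.
exists (\row_i q i, k); last by move=> i /=; rewrite mxE.
move=> y /= By; apply: xeU; apply/ball_rVP; split=> // i.
have := By i; have := qP i; rewrite /= mxE => h1 h2.
rewrite -(subrK (ratr (q i)) (x ord0 i)) -addrA (le_lt_trans (ler_normD _ _))//.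
by rewrite (splitr e) ltrD// ?(lt_trans h1)// distrC (lt_trans h2).
Qed.

Lemma open_continuous_measurable_fun_rV U (f : 'rV[R]_n -> R) : open U ->
  (forall x, U x -> {for x, continuous f}) -> measurable_fun U f.
Proof.
move=> oU cf; apply: (measurability _ (RGenOpens.measurableE R)).
move=> _ [_ [a [b ->] <-]]; apply: open_measurable_rV.
rewrite openE => x [Ux abx]; apply: filterI.
  exact: open_nbhs_nbhs.
by apply: (cf x Ux); apply: open_nbhs_nbhs; split=> //; exact: interval_open.
Qed.

Lemma continuous_measurable_fun_rV (f : 'rV[R]_n -> R) :
  continuous f -> measurable_fun setT f.
Proof.
by move=> cf; apply: open_continuous_measurable_fun_rV => [|x _]; [exact: openT|exact: cf].
Qed.

End borel_rV.

Section lebesgue_rV_bounded.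
Context {R : realType} {n : nat}.
Local Notation mu := (@lebesgue_rV R n).
Local Open Scope ereal_scope.

Lemma bounded_lebesgue_rV_lty (A : set 'rV[R]_n) :
  measurable A -> bounded_set A -> mu A < +oo.
Proof.
move=> mA [M [Mreal AM]].
pose I : set (measurableTypeR R) := `[- (M + 1), M + 1]%classic%R.
have AI : A `<=` [set x | forall i, I (x ord0 i)].
  move=> x Ax i; have xM : (`|x| <= M + 1)%R by apply: AM Ax; rewrite ltrDl.
   rewrite /I/= in_itv/= -ler_norml.
  by rewrite (le_trans (rV_coord_le_norm _ _)).
have mI : measurable I by exact: measurable_itv.
apply: (@le_lt_trans _ _ (mu [set x | forall i, I (x ord0 i)])).
  apply: le_measure; rewrite ?inE//.
  rewrite [X in measurable X](_ : _ =
    \bigcap_(i in [set: 'I_n]) (rV_coord i @^-1` I)); last first.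
    by apply/seteqP; split=> x /= h i; [move=> _; exact: h|exact: h].
  apply: fin_bigcap_measurable => // i _.
  by rewrite -[X in measurable X]setTI; exact: measurable_rV_coord.
rewrite (@lebesgue_rV_box R n (fun=> I))// ltey_eq; apply/orP; left.
apply: (big_ind (fun x : \bar R => x \is a fin_num)) => //;
  [by move=> *; exact: fin_numM|move=> i _].
rewrite ge0_fin_numE// lebesgue_measure_itv/=; case: ifPn => // _.
by rewrite -EFinB ltry.
Qed.

Lemma open_lebesgue_rV_gt0 (A : set 'rV[R]_n) : open A -> A !=set0 -> 0 < mu A.
Proof.
move=> oA [x Ax].
have := open_nbhs_nbhs (conj oA Ax) => /nbhs_ballP[e /= e0 xeA].
pose I i : set (measurableTypeR R) := `]x ord0 i - e, x ord0 i + e[%classic%R.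
have mI i : measurable (I i) by exact: measurable_itv.
apply: (@lt_le_trans _ _ (mu [set y | forall i, I i (y ord0 i)])).
  rewrite (@lebesgue_rV_box R n I)//; apply: (big_ind (fun x : \bar R => 0 < x)) => //.
    by move=> *; exact: mule_gt0.
  move=> i _; rewrite /I lebesgue_measure_itv/= lte_fin.
  by rewrite ltrD2l gtrN// -EFinB lte_fin subr_gt0 ltrD2l gtrN.
apply: le_measure; rewrite ?inE//.
- rewrite [X in measurable X](_ : _ =
    \bigcap_(i in [set: 'I_n]) (rV_coord i @^-1` I i)); last first.
    by apply/seteqP; split=> y /= h i; [move=> _; exact: h|exact: h].
  apply: fin_bigcap_measurable => // i _.
  by rewrite -[X in measurable X]setTI; exact: measurable_rV_coord.
- exact: open_measurable_rV.
move=> y Iy; apply: xeA; apply/ball_rVP; split=> // i.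
by have := Iy i; rewrite /I/= in_itv/= ltr_distlC.
Qed.

End lebesgue_rV_bounded.

(** * Fubini and translation invariance *)

Section cons_rV_facts.
Context {R : realType}.

Lemma cons_rV0 n (a : R) (x : 'rV[R]_n) : cons_rV (a, x) ord0 ord0 = a.
Proof. exact: (congr1 fst (@cons_rVK R n (a, x))). Qed.

Lemma cons_rV_lift n (a : R) (x : 'rV[R]_n) i :
  cons_rV (a, x) ord0 (lift ord0 i) = x ord0 i.
Proof.
have -> : lift ord0 i = rshift 1 i by exact/val_inj.
exact: (row_mxEr (const_mx a : 'rV[R]_1) x _ _).
Qed.

Lemma continuous_coord n (i : 'I_n) :
  continuous (fun x : 'rV[R]_n => x ord0 i).
Proof. exact: coord_continuous. Qed.

Lemma continuous_rV (T : topologicalType) n (f : T -> 'rV[R]_n) :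
  (forall i, continuous (fun t => f t ord0 i)) -> continuous f.
Proof.
move=> cf t; apply/cvg_ballP => e e0.
have : \forall s \near t, forall i, ball (f t ord0 i) e (f s ord0 i).
  by apply: filter_forall => i; have /cvg_ballP := cf i t; exact.
apply: filterS => s h; apply/ball_rVP; split=> // i; exact: h.
Qed.

Lemma continuous_cons_rVl n (x : 'rV[R]_n) :
  continuous (fun a : R => cons_rV (a, x)).
Proof.
apply: continuous_rV => i; case: (unliftP ord0 i) => [j ->|->].
  by under eq_fun do rewrite cons_rV_lift; exact: cst_continuous.
by under eq_fun do rewrite cons_rV0; move=> ?; exact: cvg_id.
Qed.

Lemma continuous_cons_rVr n (a : R) :
  continuous (fun x : 'rV[R]_n => cons_rV (a, x)).
Proof.
apply: continuous_rV => i; case: (unliftP ord0 i) => [j ->|->].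
  by under eq_fun do rewrite cons_rV_lift; exact: continuous_coord.
by under eq_fun do rewrite cons_rV0; exact: cst_continuous.
Qed.

Lemma shift_rVE n (k : 'I_n) (h : R) (y : 'rV[R]_n) i :
  (h *: delta_mx ord0 k + y) ord0 i = h * (i == k)%:R + y ord0 i.
Proof. by rewrite !mxE eqxx. Qed.

Lemma cons_rV_shift0 n (a h : R) (x : 'rV[R]_n) :
  h *: delta_mx ord0 ord0 + cons_rV (a, x) = cons_rV (h + a, x).
Proof.
apply/rowP => i; rewrite shift_rVE; case: (unliftP ord0 i) => [j ->|->].
  by rewrite !cons_rV_lift lift_eqF mulr0 add0r.
by rewrite !cons_rV0 eqxx mulr1.
Qed.

Lemma cons_rV_shift_lift n (a h : R) (x : 'rV[R]_n) (j : 'I_n) :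
  h *: delta_mx ord0 (lift ord0 j) + cons_rV (a, x) =
  cons_rV (a, h *: delta_mx ord0 j + x).
Proof.
apply/rowP => i; rewrite shift_rVE; case: (unliftP ord0 i) => [k ->|->].
  by rewrite !cons_rV_lift shift_rVE (inj_eq lift_inj).
by rewrite !cons_rV0 mulr0 add0r.
Qed.

End cons_rV_facts.

Section integral_rV.
Context {R : realType}.
Local Open Scope ereal_scope.

Lemma ge0_integral_rVS n (f : 'rV[R]_n.+1 -> \bar R) :
  measurable_fun setT f -> (forall x, 0 <= f x) ->
  \int[lebesgue_rV n.+1]_x f x =
  \int[lebesgue_measure]_a \int[lebesgue_rV n]_x f (cons_rV (a, x)).
Proof.
move=> mf f0; have := @ge0_integral_pushforward _ _ _ _ R _ (@measurable_cons_rV R n)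
  (@lebesgue_measure R \x lebesgue_rV n)%E setT f measurableT mf.
move=> /(_ (fun x _ => f0 x)) /= ->.
rewrite preimage_setT fubini_tonelli1//=.
exact: (measurableT_comp mf (@measurable_cons_rV R n)).
Qed.

Lemma integrable_rVS n (f : 'rV[R]_n.+1 -> \bar R) :
  (lebesgue_rV n.+1).-integrable setT f ->
  (lebesgue_measure \x lebesgue_rV n).-integrable setT (f \o @cons_rV R n).
Proof.
move=> /integrableP[mf fi]; apply/integrableP; split.
  exact: (measurableT_comp mf (@measurable_cons_rV R n)).
have := @ge0_integral_pushforward _ _ _ _ R _ (@measurable_cons_rV R n)
  (@lebesgue_measure R \x lebesgue_rV n)%E setT (abse \o f) measurableT.
rewrite preimage_setT => /(_ (measurableT_comp (@abse_measurable _ setT) mf)).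
by move=> /(_ (fun _ _ => abse_ge0 _)) /= <-.
Qed.

Let integral_push n (f : 'rV[R]_n.+1 -> \bar R) :
  (lebesgue_rV n.+1).-integrable setT f ->
  \int[lebesgue_rV n.+1]_x f x =
  \int[lebesgue_measure \x lebesgue_rV n]_x f (cons_rV x).
Proof.
move=> fi; have := @integral_pushforward _ _ _ _ R _ (@measurable_cons_rV R n)
  (@lebesgue_measure R \x lebesgue_rV n)%E setT f (measurable_int _ fi).
by rewrite preimage_setT; apply => //; exact: integrable_rVS.
Qed.

Lemma integral_rVS n (f : 'rV[R]_n.+1 -> \bar R) :
  (lebesgue_rV n.+1).-integrable setT f ->
  \int[lebesgue_rV n.+1]_x f x =
  \int[lebesgue_measure]_a \int[lebesgue_rV n]_x f (cons_rV (a, x)).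
Proof.
by move=> fi; rewrite integral_push// -integral12_prod_meas1//;
   exact: integrable_rVS.
Qed.

(** The first coordinate innermost: the form in which the fundamental theorem
    of calculus applies to the partial derivative along that coordinate. *)
Lemma integral_rVS' n (f : 'rV[R]_n.+1 -> \bar R) :
  (lebesgue_rV n.+1).-integrable setT f ->
  \int[lebesgue_rV n.+1]_x f x =
  \int[lebesgue_rV n]_x \int[lebesgue_measure]_a f (cons_rV (a, x)).
Proof.
by move=> fi; rewrite integral_push// -integral21_prod_meas1//;
   exact: integrable_rVS.
Qed.

End integral_rV.

Section translation.
Context {R : realType}.
Local Open Scope ereal_scope.

Lemma ge0_integral_translation (t : R) (f : measurableTypeR R -> \bar R) :
  measurable_fun setT f -> (forall x, 0 <= f x) ->
  \int[@lebesgue_measure R]_x f (x + t)%R = \int[@lebesgue_measure R]_x f x.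
Proof.
move=> mf f0.
pose shift (x : measurableTypeR R) : measurableTypeR R := (x + t)%R.
have mt : measurable_fun setT shift.
  apply: (@continuous_measurable_fun R (fun x => x + t)%R) => x.
  by apply: cvgD; [exact: cvg_id|exact: cvg_cst].
pose m := measure_function_pushforward__canonical__measure_function_Measure (@lebesgue_measure R) mt.
have mE A : measurable A -> @lebesgue_measure R A = m A.
  apply: (@lebesgue_measure_unique R m) => _ [[a b] _ <-].
  rewrite /m/= /pushforward (_ : _ @^-1` _ = `](a - t)%R, (b - t)%R]%classic); last first.
    by apply/seteqP; split => x/=; rewrite /shift !in_itv/= ltrBlDr lerBrDr.
  by rewrite !lebesgue_measure_itv/= !lte_fin ltrD2r -!EFinB; congr (if _ then (_)%:E else _); ring.
have -> : \int[lebesgue_measure]_x f x = \int[m]_x f x.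
  by apply: eq_measure_integral => A mA _; exact: mE.
have := @ge0_integral_pushforward _ _ _ _ R _ mt (@lebesgue_measure R) setT f measurableT mf.
by rewrite preimage_setT => -> //.
Qed.

Lemma ge0_integral_translation_rV n (t : 'rV[R]_n) (f : 'rV[R]_n -> \bar R) :
  measurable_fun setT f -> (forall x, 0 <= f x) ->
  \int[lebesgue_rV n]_x f (x + t)%R = \int[lebesgue_rV n]_x f x.
Proof.
elim: n t f => [|n IH] t f mf f0.
  by apply: eq_integral => x _; congr f; apply/rowP => -[].
have mt : measurable_fun setT (fun x : 'rV[R]_n.+1 => (x + t)%R).
  apply/measurable_fun_rVP => i.
  rewrite (_ : _ \o _ = (fun a => a + t ord0 i)%R \o rV_coord i); last first.
    by apply/funext => x; rewrite /rV_coord/= mxE.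
  apply: (@measurableT_comp _ _ _ _ _ _
    (fun a : measurableTypeR R => (a + t ord0 i)%R : measurableTypeR R));
    last exact: measurable_rV_coord.
  apply: (@continuous_measurable_fun R (fun x => x + t ord0 i)%R) => x.
  by apply: cvgD; [exact: cvg_id|exact: cvg_cst].
rewrite (@ge0_integral_rVS _ _ (fun x => f (x + t)%R) (measurableT_comp mf mt) (fun=> f0 _)).
rewrite (ge0_integral_rVS mf f0).
pose t' : 'rV[R]_n := \row_i t ord0 (lift ord0 i).
have consD a (x : 'rV[R]_n) :
    (cons_rV (a, x) + t)%R = cons_rV ((a + t ord0 ord0)%R, (x + t')%R).
  apply/rowP => i; rewrite mxE; case: (unliftP ord0 i) => [j ->|->].
    by rewrite !cons_rV_lift !mxE.
  by rewrite !cons_rV0.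
pose F a := \int[lebesgue_rV n]_x f (cons_rV (a, x)).
have mfc : measurable_fun setT (f \o @cons_rV R n).
  exact: (measurableT_comp mf (@measurable_cons_rV R n)).
rewrite -[RHS](@ge0_integral_translation (t ord0 ord0) F); last 2 first.
- apply: (measurable_fun_fubini_tonelli_F (m2 := lebesgue_rV n)
    (f \o @cons_rV R n)) => // z; exact: f0.
- by move=> a; apply: integral_ge0 => x _; exact: f0.
apply: eq_integral => a _; rewrite /F -[RHS](IH t')//.
- by apply: eq_integral => x _; rewrite consD.
- exact: (measurableT_comp mfc (pair1_measurable _)).
Qed.

End translation.

(** * Integration along the coordinate axes *)

Section lines.
Context {R : realType} {n : nat}.
Implicit Types (f : 'rV[R]_n -> R).

Lemma rV_norm_le (x : 'rV[R]_n) (M : R) :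
  0 <= M -> (forall i, `|x ord0 i| <= M) -> `|x| <= M.
Proof.
move=> M0 xM; apply/ler_addgt0Pr => e e0.
have : ball (0 : 'rV[R]_n) (M + e) x.
  apply/ball_rVP; split=> [|i]; first exact: ltr_wpDl.
  by rewrite mxE sub0r normrN (le_lt_trans (xM i))// ltrDl.
by rewrite -ball_normE /ball_/= sub0r normrN => /ltW.
Qed.

Lemma is_derive_line f x v (h : R) : derivable f (h *: v + x) v ->
  is_derive h (1 : R) (fun s : R => f (s *: v + x)) ('D_v f (h *: v + x)).
Proof.
move=> df; have e : (fun k : R => k^-1 *: ((fun s : R => f (s *: v + x)) (k *: 1 + h) -
    f (h *: v + x))) =
    (fun k => k^-1 *: (f (k *: v + (h *: v + x)) - f (h *: v + x))).
  by apply/funext => k; rewrite [_%:A]mulr1 scalerDl addrA.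
by apply: DeriveDef; rewrite /derivable/derive /= e.
Qed.

Lemma continuous_line (x v : 'rV[R]_n) : continuous (fun s : R => s *: v + x).
Proof.
move=> s; apply: cvgD; last exact: cvg_cst.
by apply: cvgZl; exact: cvg_id.
Qed.

Lemma continuous_bounded_csupp (g : 'rV[R]_n -> R) M : continuous g ->
  (forall x, M < `|x| -> g x = 0) -> exists2 B, 0 <= B & forall x, `|g x| <= B.
Proof.
move=> cg g0; have cK :
      compact [set x : 'rV[R]_n | `|x| <= M].
  apply: bounded_closed_compact.
    by exists M; split=> [|N MN x /= xM]; [exact: num_real|exact: le_trans xM (ltW MN)].
  rewrite (_ : [set x | _] = (fun x : 'rV[R]_n => `|x|) @^-1` [set r | r <= M])//.
  by apply: preimage_closed => [x _|]; [exact: norm_continuous|exact: closed_le].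
have : compact (g @` [set x : 'rV[R]_n | `|x| <= M]).
  by apply: continuous_compact => //; exact: continuous_subspaceT.
move=> /compact_bounded[B [_ gB]].
exists (`|B| + 1) => [|x]; first by rewrite addr_ge0.
have [xM|/g0 ->] := leP `|x| M; last by rewrite normr0 addr_ge0.
by apply: gB; [rewrite (le_lt_trans (ler_norm _))// ltrDl|exists x].
Qed.

Lemma integrable_csupp (g : 'rV[R]_n -> R) M : continuous g ->
  (forall x, M < `|x| -> g x = 0) ->
  (lebesgue_rV n).-integrable setT (EFin \o g).
Proof.
move=> cg g0; have [B B0 gB] := continuous_bounded_csupp cg g0.
pose D := [set x : 'rV[R]_n | `|x| < M + 1].
have oD : open D.
  apply: (open_comp (f := fun x : 'rV[R]_n => `|x|) (D := [set r | r < M + 1])).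
    by move=> x _; exact: norm_continuous.
  exact: open_lt.
have mD : measurable D by exact: open_measurable_rV.
have -> : EFin \o g = (EFin \o g) \_ D.
  apply/funext => x; rewrite patchE; case: ifPn => //.
  rewrite notin_setE /D/= => /negP; rewrite -leNgt => Mx.
  by rewrite g0// (lt_le_trans _ Mx)// ltrDl.
apply/(integrable_mkcond _ mD); apply: measurable_bounded_integrable => //.
- apply: bounded_lebesgue_rV_lty => //; exists (M + 1); split=> [|N MN x /= xM].
    exact: num_real.
  by rewrite (le_trans (ltW xM))// ltW.
- by apply: measurable_funTS; exact: continuous_measurable_fun_rV.
- by exists B; split=> [|N BN x _]; [exact: num_real|exact: le_trans (gB x) (ltW BN)].
Qed.

End lines.

Section ftc.
Context {R : realType}.
Local Notation mu := (@lebesgue_measure R).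

Lemma continuous_FTC2_line (g g' : R -> R) a b : a <= b ->
  (forall x, is_derive x (1 : R) g (g' x)) -> continuous g' ->
  (\int[mu]_(x in `[a, b]) (g' x)%:E = (g b - g a)%:E)%E.
Proof.
rewrite le_eqVlt => /predU1P[->|ab] dg cg'.
  by rewrite set_itv1 integral_set1 subrr.
have cg : continuous g.
  move=> x; apply: differentiable_continuous; apply/derivable1_diffP.
  by have [] := dg x.
rewrite (continuous_FTC2 (F := g) ab) ?EFinB//.
- exact: continuous_subspaceT.
- split; [by move=> x _; have [] := dg x|apply: cvg_at_right_filter; exact: cg|
    apply: cvg_at_left_filter; exact: cg].
- by move=> x _; rewrite derive1E; have [_ ->] := dg x.
Qed.

Lemma integral_derive_csupp (g g' : R -> R) M :
  (forall x, is_derive x (1 : R) g (g' x)) -> continuous g' ->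
  (forall x, M < `|x| -> g x = 0) ->
  (\int[mu]_x (g' x)%:E = 0)%E.
Proof.
move=> dg cg' g0.
have g'0 x : M < `|x| -> g' x = 0.
  move=> Mx; have [_ <-] := dg x; rewrite -(derive_cst (0 : R) x 1).
  apply: near_eq_derive; near=> y; apply: g0.
  near: y; apply: (cvgr_gt `|x|) => //; exact: norm_continuous.
pose N := `|M| + 1.
have N0 : 0 <= N by rewrite addr_ge0.
have MN : M < N by rewrite (le_lt_trans (ler_norm _))// ltrDl.
rewrite (_ : (fun x => _) = (EFin \o g') \_ `[- N, N]); last first.
  apply/funext => x; rewrite patchE; case: ifPn => //.
  rewrite notin_setE/= in_itv/= -ler_norml => /negP; rewrite -ltNge => Nx.
  by rewrite g'0// (lt_trans MN).
rewrite -integral_mkcond continuous_FTC2_line//; last by rewrite (le_trans _ N0)// oppr_le0.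
by rewrite !g0 ?subrr// ?normrN ger0_norm.
Unshelve. all: by end_near. Qed.

End ftc.

Section divergence_axis.
Context {R : realType}.
Local Open Scope ereal_scope.

Lemma partial_csupp n (f : 'rV[R]_n -> R) i M :
  (forall x, (M < `|x|)%R -> f x = 0%R) ->
  forall x, (M < `|x|)%R -> partial i f x = 0%R.
Proof.
move=> f0 x Mx; rewrite /partial -(derive_cst (0%R : R) x (delta_mx ord0 i)).
apply: near_eq_derive; near=> y; apply: f0.
near: y; apply: (cvgr_gt `|x|%R) => //; exact: norm_continuous.
Unshelve. all: by end_near. Qed.

(** By induction on the dimension: the derivative along the first axis is
    integrated along that axis first, where the fundamental theorem of calculus
    gives 0; any other axis lives in the slices orthogonal to the first. *)
Lemma integral_partial0 n (f : 'rV[R]_n -> R) i M :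
  (forall x, derivable f x (delta_mx ord0 i)) -> continuous (partial i f) ->
  (forall x, (M < `|x|)%R -> f x = 0%R) ->
  \int[lebesgue_rV n]_x (partial i f x)%:E = 0.
Proof.
elim: n f i => [f []//|n IH f i df cf f0].
have Nx a (x : 'rV[R]_n) : (`|x| <= `|cons_rV (a, x)|)%R.
  by apply: rV_norm_le => // j; rewrite -(cons_rV_lift a x); exact: rV_coord_le_norm.
have Na a (x : 'rV[R]_n) : (`|a| <= `|cons_rV (a, x)|)%R.
  by rewrite -{1}(cons_rV0 a x); exact: rV_coord_le_norm.
have pi := integrable_csupp cf (partial_csupp i f0).
case: (unliftP ord0 i) => [j ij|i0]; last first.
  rewrite integral_rVS'//; apply: integral0_eq => x _ /=.
  rewrite i0 in df cf *.
  apply: (@integral_derive_csupp R (fun a => f (cons_rV (a, x))) _ M).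
  - move=> a; have := @is_derive_line R _ f (cons_rV (0%R, x)) (delta_mx ord0 ord0) a (df _).
    rewrite cons_rV_shift0 addr0.
    by under eq_fun do rewrite cons_rV_shift0 addr0.
  - move=> a; exact: (continuous_comp (@continuous_cons_rVl _ _ x a) (cf _)).
  - by move=> a Ma; rewrite f0// (lt_le_trans Ma)//.
rewrite integral_rVS//; apply: integral0_eq => a _ /=.
have gE x : (fun h : R => h^-1 *: (f (h *: delta_mx ord0 (lift ord0 j) +
      cons_rV (a, x)) - f (cons_rV (a, x))))%R =
    (fun h => h^-1 *: (f (cons_rV (a, h *: delta_mx ord0 j + x)%R) -
      f (cons_rV (a, x))))%R.
  by apply/funext => h; rewrite cons_rV_shift_lift.
have pE x : partial i f (cons_rV (a, x)) = partial j (fun x => f (cons_rV (a, x))) x.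
  by rewrite /partial ij /derive /= gE.
under eq_integral do rewrite pE.
apply: IH.
- move=> x; have := df (cons_rV (a, x)); by rewrite /derivable /= ij gE.
- rewrite (_ : partial _ _ = (partial i f) \o (fun x => cons_rV (a, x))); last first.
    by apply/funext => x; rewrite /= pE.
  by move=> x; exact: (continuous_comp (@continuous_cons_rVr _ _ a x) (cf _)).
- by move=> x Mx; rewrite f0// (lt_le_trans Mx).
Qed.

End divergence_axis.

(** * The Faber-Krahn inequality *)

Section measurable_rV_ops.
Context {R : realType} {n : nat} d (T : measurableType d).

Lemma measurable_addrV (f g : T -> 'rV[R]_n) :
  measurable_fun setT f -> measurable_fun setT g ->
  measurable_fun setT (fun x => f x + g x).
Proof.
move=> /measurable_fun_rVP mf /measurable_fun_rVP mg; apply/measurable_fun_rVP.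
move=> i; rewrite (_ : _ \o _ = (rV_coord i \o f : T -> R) \+ (rV_coord i \o g)).
  exact: (@measurable_funD _ _ R setT _ _ (mf i) (mg i)).
by apply/funext => x; rewrite /rV_coord/= mxE.
Qed.

Lemma measurable_scalerV (f : T -> R) (v : 'rV[R]_n) :
  measurable_fun setT f -> measurable_fun setT (fun x => f x *: v).
Proof.
move=> mf; apply/measurable_fun_rVP => i.
rewrite (_ : _ \o _ = (fun x => f x * v ord0 i)).
  exact: (@measurable_funM _ _ R setT _ _ mf (measurable_cst _)).
by apply/funext => x; rewrite /rV_coord/= mxE.
Qed.

End measurable_rV_ops.

Section shift_axis.
Context {R : realType} {n : nat}.
Local Notation mu := (@lebesgue_rV R n).
Local Notation leb := (@lebesgue_measure R).

(** The Cauchy-Schwarz inequality for g' against 1, obtained by integrating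
    2 m g' - m^2 <= g'^2 with m the mean slope of g on [0, t]. *)
Lemma le_sqr_increment (g g' : R -> R) t : 0 <= t ->
  (forall x, is_derive x (1 : R) g (g' x)) -> continuous g' ->
  (((g t - g 0) ^+ 2)%:E <= t%:E * \int[leb]_(x in `[0%R, t]) (g' x ^+ 2)%:E)%E.
Proof.
rewrite le_eqVlt => /predU1P[<-|t0] dg cg'.
  by rewrite subrr expr0n/= mul0e.
pose m := (g t - g 0) / t.
pose G x := m *+ 2 * g x - m ^+ 2 * x.
have dG (x : R) : is_derive x (1 : R) G (m *+ 2 * g' x - m ^+ 2).
  rewrite [X in is_derive _ _ _ X](_ : _ = m *+ 2 *: g' x - m ^+ 2 *: 1).
    have ? := dg x; exact: is_deriveB.
  by rewrite [_%:A]mulr1.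
have cG : continuous (fun x => m *+ 2 * g' x - m ^+ 2).
  move=> x; apply: cvgB; last exact: cvg_cst.
  by apply: cvgM; [exact: cvg_cst|exact: cg'].
have := continuous_FTC2_line (ltW t0) dG cG.
rewrite (_ : G t - G 0 = m ^+ 2 * t); last first.
  by rewrite /G /m; field; rewrite gt_eqF.
move=> GE; have -> : (((g t - g 0) ^+ 2)%:E = t%:E * (m ^+ 2 * t)%:E)%E.
  by rewrite -EFinM; congr EFin; rewrite /m; field; rewrite gt_eqF.
rewrite lee_pmul2l//= -GE; apply: le_integral => //.
- apply: continuous_compact_integrable; first exact: segment_compact.
  exact: continuous_subspaceT.
- apply: continuous_compact_integrable; first exact: segment_compact.
  by apply: continuous_subspaceT => x; apply: cvgM; exact: cg'.
- move=> x _; rewrite lee_fin -subr_ge0.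
  rewrite (_ : _ - _ = (g' x - m) ^+ 2) ?sqr_ge0//; ring.
Qed.

(** The one-variable bound on every line parallel to the axis, integrated over
    all lines; by translation invariance each s in [0, t] contributes the same
    amount. *)
Lemma shift_axis_estimate (u : 'rV[R]_n -> R) i t : 0 <= t ->
  (forall x, derivable u x (delta_mx ord0 i)) -> continuous (partial i u) ->
  continuous u ->
  (\int[mu]_x ((u (x + t *: delta_mx ord0 i) - u x) ^+ 2)%:E <=
   (t ^+ 2)%:E * \int[mu]_x (partial i u x ^+ 2)%:E)%E.
Proof.
move=> t0 du cdu cu; set e := delta_mx ord0 i.
pose k (s : measurableTypeR R) : R := \1_(`[0%R, t]%classic : set R) s.
pose F (p : 'rV[R]_n * measurableTypeR R) : \bar R :=
  ((partial i u (p.1 + p.2 *: e)) ^+ 2 * k p.2)%:E.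
have mk : measurable_fun setT k by exact: measurable_indic.
have mF : measurable_fun setT F.
  apply/measurable_EFinP; apply: measurable_funM; last first.
    exact: (measurableT_comp mk measurable_snd).
  apply: measurable_funX.
  apply: (measurableT_comp (continuous_measurable_fun_rV cdu)).
  apply: measurable_addrV; first exact: measurable_fst.
  apply: measurable_scalerV; exact: measurable_snd.
have F0 p : (0 <= F p)%E by rewrite lee_fin mulr_ge0// sqr_ge0.
have mdu : measurable_fun setT (fun x => (partial i u x ^+ 2)%:E).
  by apply/measurable_EFinP/measurable_funX; exact: continuous_measurable_fun_rV.
have mu_ : measurable_fun setT u by exact: continuous_measurable_fun_rV.
have mux : measurable_fun setT (fun x : 'rV[R]_n => u (x + t *: e)).
  apply: (measurableT_comp mu_); apply: measurable_addrV => //.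
apply: (@le_trans _ _ (\int[mu]_x (t%:E * \int[leb]_s F (x, s)))%E).
  apply: ge0_le_integral => //.
  - by move=> x _; rewrite lee_fin sqr_ge0.
  - by apply/measurable_EFinP/measurable_funX; exact: measurable_funB.
  - apply: measurable_funeM; exact: (measurable_fun_fubini_tonelli_F (m2 := leb) F).
  move=> x _.
  pose g (s : R) := u (s *: e + x).
  have dg s : is_derive s (1 : R) g (partial i u (s *: e + x)).
    exact: is_derive_line.
  have cg : continuous (fun s : R => partial i u (s *: e + x)).
    by move=> s; apply: (continuous_comp (@continuous_line _ _ x e s)) (cdu _).
  rewrite (_ : \int[leb]_s F (x, s) =
      \int[leb]_(s in `[0%R, t]) (partial i u (s *: e + x) ^+ 2)%:E)%E.
    have := le_sqr_increment t0 dg cg.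
    by rewrite /g scale0r add0r [t *: e + x]addrC.
  rewrite [RHS]integral_mkcond; apply: eq_integral => s _.
  rewrite patchE /F/= /k indicE; case: ifPn => _; last by rewrite mulr0.
  by rewrite mulr1 addrC.
have -> : (\int[mu]_x (t%:E * \int[leb]_s F (x, s)) =
    t%:E * \int[mu]_x \int[leb]_s F (x, s))%E.
  rewrite ge0_integralZl//.
  - exact: (measurable_fun_fubini_tonelli_F (m2 := leb) F).
  - by move=> x _; exact: integral_ge0.
rewrite (fubini_tonelli (m1 := mu) (m2 := leb) F)//.
pose C := (\int[mu]_x (partial i u x ^+ 2)%:E)%E.
have -> : (\int[leb]_s \int[mu]_x F (x, s) = \int[leb]_(s in `[0%R, t]) C)%E.
  rewrite [RHS]integral_mkcond; apply: eq_integral => s _.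
  rewrite patchE /F/= /k indicE; case: ifPn => _; last first.
    by under eq_integral do rewrite mulr0; rewrite integral0.
  under eq_integral do rewrite mulr1.
  rewrite (ge0_integral_translation_rV (s *: e) mdu)// => x.
  by rewrite lee_fin sqr_ge0.
rewrite integral_cst//= lebesgue_measure_itv/= lte_fin.
have : (0 <= C)%E by apply: integral_ge0 => x _; rewrite lee_fin sqr_ge0.
move: t0; rewrite le_eqVlt => /predU1P[<-|t0 C0]; first by rewrite mul0e expr0n mul0e.
by rewrite t0 oppr0 adde0 muleCA [X in (_ <= X)%E]muleC expr2 EFinM.
Qed.

End shift_axis.

(** The inequality that drives the De Giorgi iteration: for a function supported
    in S, the square L^2 norm is at most that of the gradient times a constant
    of order |S|^(2/n), which is small when S is. *)
Section faber_krahn.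
Context {R : realType} {n : nat}.
Local Notation mu := (@lebesgue_rV R n).

Variables (u : 'rV[R]_n -> R) (M : R).
Hypothesis cu : continuous u.
Hypothesis du : forall i x, derivable u x (delta_mx ord0 i).
Hypothesis cdu : forall i, continuous (partial i u).
Hypothesis u0 : forall x, M < `|x| -> u x = 0.

Let U : \bar R := \int[mu]_x (u x ^+ 2)%:E.
Let D : \bar R := (\sum_i \int[mu]_x (partial i u x ^+ 2)%:E)%E.

Let mu_ : measurable_fun setT u.
Proof. exact: continuous_measurable_fun_rV. Qed.

Let sqr_int_fin (g : 'rV[R]_n -> R) : continuous g ->
  (forall x, M < `|x| -> g x = 0) -> (\int[mu]_x (g x ^+ 2)%:E)%E \is a fin_num.
Proof.
move=> cg g0; apply: integrable_fin_num => //.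
apply: (@integrable_csupp _ _ (fun x => g x ^+ 2) M) => [x|x /g0 ->].
  exact: (continuousM (cg x) (cg x)).
by rewrite expr0n.
Qed.

Let int_ge0 (g : 'rV[R]_n -> R) : (0 <= \int[mu]_x (g x ^+ 2)%:E)%E.
Proof. by apply: integral_ge0 => x _; rewrite lee_fin sqr_ge0. Qed.

Let Ufin : U \is a fin_num. Proof. exact: sqr_int_fin. Qed.

Let D0 : (0 <= D)%E. Proof. by apply: sume_ge0 => i _; exact: int_ge0. Qed.

Let Dfin : D \is a fin_num.
Proof.
by apply/sum_fin_numP => i _ _; apply: sqr_int_fin => //; exact: partial_csupp.
Qed.

Let mshift (y : 'rV[R]_n) : measurable_fun setT (fun x : 'rV[R]_n => u (x + y)).
Proof. by apply: (measurableT_comp mu_); exact: measurable_addrV. Qed.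

(** The translation by y is performed one axis at a time. Each step costs at
    most h^2 D, and (a + b)^2 <= 2 a^2 + 2 b^2 loses a factor that 4^n absorbs. *)
Lemma shift_estimate (h : R) (y : 'rV[R]_n) : 0 <= h ->
  (forall i, 0 <= y ord0 i <= h) ->
  (\int[mu]_x ((u (x + y) - u x) ^+ 2)%:E <= (4 ^+ n * h ^+ 2)%:E * D)%E.
Proof.
move=> h0 yh.
pose Y k : 'rV[R]_n := \row_i (if (i < k)%N then y ord0 i else 0).
suff H k : (k <= n)%N -> (\int[mu]_x ((u (x + Y k) - u x) ^+ 2)%:E <=
    (4 ^+ k * h ^+ 2)%:E * D)%E.
  have -> : y = Y n by apply/rowP => i; rewrite mxE ltn_ord.
  exact: H.
elim: k => [_|k IH kn].
  have -> : Y 0%N = 0 by apply/rowP => i; rewrite !mxE.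
  rewrite integral0_eq => [|x _]; last by rewrite addr0 subrr expr0n.
  by rewrite mule_ge0// lee_fin mulr_ge0// sqr_ge0.
pose i := Ordinal kn.
have Yk : Y k.+1 = y ord0 i *: delta_mx ord0 i + Y k.
  apply/rowP => j; rewrite shift_rVE !mxE ltnS leq_eqVlt -val_eqE/=.
  have [jk|/= jk] := eqVneq (j : nat) k; last by rewrite mulr0 add0r.
  rewrite jk ltnn addr0 mulr1; congr (y _ _); exact/val_inj.
have Di : (\int[mu]_x (partial i u x ^+ 2)%:E <= D)%E.
  by rewrite /D (bigD1 i)//= leeDl// sume_ge0.
have := IH (ltnW kn); set E := (\int[mu]_x ((u (x + Y k) - u x) ^+ 2)%:E)%E => IHk.
have step : (\int[mu]_x ((u (x + Y k.+1) - u (x + Y k)) ^+ 2)%:E <=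
    (h ^+ 2)%:E * D)%E.
  have -> : (\int[mu]_x ((u (x + Y k.+1) - u (x + Y k)) ^+ 2)%:E =
      \int[mu]_x ((u (x + y ord0 i *: delta_mx ord0 i) - u x) ^+ 2)%:E)%E.
    rewrite -[RHS](@ge0_integral_translation_rV _ _ (Y k)).
    - apply: eq_integral => x _; rewrite Yk; congr (((u _ - _) ^+ 2)%:E).
      by rewrite addrA addrAC.
    - apply/measurable_EFinP; apply: measurable_funX; apply: measurable_funB => //.
    - by move=> x; rewrite lee_fin sqr_ge0.
  have /andP[yi0 yih] := yh i.
  apply: (le_trans (shift_axis_estimate yi0 (@du i) (@cdu i) cu)).
  apply: lee_pmul => //; first by rewrite lee_fin sqr_ge0.
  by rewrite lee_fin lerXn2r// nnegrE.
have mE : measurable_fun setT (fun x : 'rV[R]_n => ((u (x + Y k) - u x) ^+ 2)%:E).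
  by apply/measurable_EFinP; apply: measurable_funX; apply: measurable_funB.
have mF : measurable_fun setT (fun x : 'rV[R]_n => ((u (x + Y k.+1) - u (x + Y k)) ^+ 2)%:E).
  by apply/measurable_EFinP; apply: measurable_funX; apply: measurable_funB.
have s0 (a : R) : (0 <= (a ^+ 2)%:E)%E by rewrite lee_fin sqr_ge0.
apply: (@le_trans _ _ (2%:E * ((h ^+ 2)%:E * D) + 2%:E * E)%E).
  apply: (@le_trans _ _ (\int[mu]_x (2%:E *
      ((u (x + Y k.+1) - u (x + Y k)) ^+ 2)%:E +
      2%:E * ((u (x + Y k) - u x) ^+ 2)%:E))%E).
    apply: ge0_le_integral => //.
    - by apply/measurable_EFinP; apply: measurable_funX; apply: measurable_funB.
    - by apply: emeasurable_funD; exact: measurable_funeM.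
    - move=> x _; rewrite -!EFinM -EFinD lee_fin -subr_ge0.
      set a := u _; set b := u _; set c := u _.
      rewrite (_ : _ - _ = (a - b - (b - c)) ^+ 2) ?sqr_ge0//; ring.
  rewrite ge0_integralD//; last 4 first.
  - by move=> x _; rewrite mule_ge0.
  - exact: measurable_funeM.
  - by move=> x _; rewrite mule_ge0.
  - exact: measurable_funeM.
  rewrite !ge0_integralZl//; apply: leeD => //.
  by rewrite lee_pmul2l.
rewrite (le_trans (leeD (lexx _) (_ : _ <= 2%:E * ((4 ^+ k * h ^+ 2)%:E * D)))%E)//.
  by rewrite lee_pmul2l.
rewrite -(fineK Dfin) -!EFinM -EFinD lee_fin !mulrA -mulrDl.
rewrite ler_wpM2r ?fine_ge0// -mulrDl ler_wpM2r ?sqr_ge0// exprS.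
have : 1 <= (4 : R) ^+ k by rewrite exprn_ege1// ler1n.
by move=> k1; rewrite -mulrDl ler_wpM2r//; lra.
Qed.

(** On S, u(x)^2 <= 2 (u(x + y) - u(x))^2 + 2 u(x + y)^2. Averaged over y in the
    cube [0, h]^n, the last term integrates to at most 2 |S| / h^n times the
    square norm of u; this is at most half of it when h^n >= 4 |S|, and
    can be absorbed on the left. *)
Lemma faber_krahn (S : set 'rV[R]_n) (h : R) :
  measurable S -> (forall x, u x != 0 -> S x) -> 0 < h ->
  (4%:E * mu S <= (h ^+ n)%:E)%E -> (U <= (4 ^+ n.+1 * h ^+ 2)%:E * D)%E.
Proof.
move=> mS uS h0 muS.
pose I (i : 'I_n) : set (measurableTypeR R) := `[0, h]%classic.
pose Q := [set y : 'rV[R]_n | forall i, I i (y ord0 i)].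
have mI i : measurable (I i) by exact: measurable_itv.
have mQ : measurable Q.
  rewrite [X in measurable X](_ : _ =
    \bigcap_(i in [set: 'I_n]) (rV_coord i @^-1` I i)); last first.
    by apply/seteqP; split=> x /= k i; [move=> _; exact: k|exact: k].
  apply: fin_bigcap_measurable => // i _.
  by rewrite -[X in measurable X]setTI; exact: measurable_rV_coord.
have muQ : mu Q = (h ^+ n)%:E.
  rewrite /Q (@lebesgue_rV_box R n I)//.
  under eq_bigr do rewrite /I lebesgue_measure_itv/= lte_fin h0 oppr0 adde0.
  by rewrite prodEFin prodr_const card_ord.
(* K p is u (x + y)^2 for x in S, and J y its integral in x; integrating in y
   first gives |S| times the square norm of u *)
pose K (p : 'rV[R]_n * 'rV[R]_n) : \bar R := (\1_S p.1 * u (p.1 + p.2) ^+ 2)%:E.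
have mK : measurable_fun setT K.
  apply/measurable_EFinP; apply: measurable_funM.
    exact: (measurableT_comp (measurable_indic mS) measurable_fst).
  apply: measurable_funX; apply: (measurableT_comp mu_).
  by apply: measurable_addrV; [exact: measurable_fst|exact: measurable_snd].
have K0 p : (0 <= K p)%E by rewrite lee_fin mulr_ge0// sqr_ge0.
pose J y := (\int[mu]_x K (x, y))%E.
have J0 y : (0 <= J y)%E by exact: integral_ge0.
have mJ : measurable_fun setT J.
  exact: (measurable_fun_fubini_tonelli_G (m1 := mu) K).
have Uy y : Q y -> (U <= (2 * (4 ^+ n * h ^+ 2))%:E * D + 2%:E * J y)%E.
  move=> Qy; have yh i : 0 <= y ord0 i <= h by have := Qy i; rewrite /I/= in_itv.
  have := shift_estimate (ltW h0) yh => se.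
  have mE : measurable_fun setT (fun x : 'rV[R]_n => ((u (x + y) - u x) ^+ 2)%:E).
    by apply/measurable_EFinP; apply: measurable_funX; apply: measurable_funB.
  have mKy : measurable_fun setT (fun x => K (x, y)).
    exact: (measurableT_comp mK (pair2_measurable y)).
  have s0 (a : R) : (0 <= (a ^+ 2)%:E)%E by rewrite lee_fin sqr_ge0.
  apply: (@le_trans _ _ (\int[mu]_x (2%:E *
      ((u (x + y) - u x) ^+ 2)%:E + 2%:E * K (x, y)))%E).
    apply: ge0_le_integral => //.
    - by apply/measurable_EFinP; exact: measurable_funX.
    - by apply: emeasurable_funD; exact: measurable_funeM.
    - move=> x _; rewrite -!EFinM -EFinD lee_fin indicE.
      have [->|/uS Sx] := eqVneq (u x) 0.
        by rewrite expr0n/= addr_ge0// mulr_ge0// ?sqr_ge0// mulr_ge0// sqr_ge0.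
      rewrite mem_set// mul1r -subr_ge0; set a := u (x + y); set b := u x.
      rewrite (_ : _ - _ = (2 * a - b) ^+ 2) ?sqr_ge0//; ring.
  rewrite ge0_integralD//; last 4 first.
  - by move=> x _; rewrite mule_ge0.
  - exact: measurable_funeM.
  - by move=> x _; rewrite mule_ge0.
  - exact: measurable_funeM.
  rewrite !ge0_integralZl// EFinM -muleA; apply: leeD => //.
  by rewrite lee_pmul2l.
have intJ : (\int[mu]_(y in Q) J y <= mu S * U)%E.
  apply: (@le_trans _ _ (\int[mu]_y J y)%E); first exact: ge0_subset_integral.
  rewrite /J -(fubini_tonelli (m1 := mu) (m2 := mu) K)//.
  apply: (@le_trans _ _ (\int[mu]_x ((\1_S x)%:E * U))%E); last first.
    by rewrite ge0_integralZr//; [rewrite integral_indic// setIT|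
      apply/measurable_EFinP; exact: measurable_indic|exact: int_ge0].
  rewrite le_eqVlt; apply/orP; left; apply/eqP; apply: eq_integral => x _.
  under eq_integral do rewrite /K/= EFinM addrC.
  rewrite ge0_integralZl//; last 2 first.
  - apply/measurable_EFinP; apply: measurable_funX; apply: (measurableT_comp mu_).
    exact: measurable_addrV.
  - by move=> y _; rewrite lee_fin sqr_ge0.
  congr (_ * _)%E; rewrite (@ge0_integral_translation_rV _ _ x (fun z => (u z ^+ 2)%:E))//.
  - by apply/measurable_EFinP; exact: measurable_funX.
  - by move=> z; rewrite lee_fin sqr_ge0.
have main : ((h ^+ n)%:E * U <=
    (h ^+ n)%:E * ((2 * (4 ^+ n * h ^+ 2))%:E * D) + 2%:E * (mu S * U))%E.
  rewrite -muQ.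
  have -> : (mu Q * U = \int[mu]_(y in Q) U)%E by rewrite integral_cst// muleC.
  apply: (@le_trans _ _
    (\int[mu]_(y in Q) ((2 * (4 ^+ n * h ^+ 2))%:E * D + 2%:E * J y))%E).
    apply: ge0_le_integral => //.
    - by move=> y _; exact: int_ge0.
    - by apply: emeasurable_funD => //; apply: measurable_funeM; exact: measurable_funTS.
  have c0 : (0 <= (2 * (4 ^+ n * h ^+ 2))%:E * D)%E.
    by rewrite mule_ge0// lee_fin !mulr_ge0// ?sqr_ge0 ?ltW.
  rewrite ge0_integralD//; last 2 first.
  - by move=> y _; rewrite mule_ge0.
  - by apply: measurable_funeM; exact: measurable_funTS.
  rewrite integral_cst// ge0_integralZl//; last exact: measurable_funTS.
  by rewrite [X in (X + _ <= _)%E]muleC leeD// lee_pmul2l.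
have hn0 : 0 < h ^+ n by exact: exprn_gt0.
have U0 : (0 <= U)%E by exact: int_ge0.
have Sfin : mu S \is a fin_num.
  rewrite ge0_fin_numE// ltey; apply/eqP => Soo; move: muS.
  by rewrite Soo gt0_muley// leye_eq.
move: main muS U0 D0; rewrite -(fineK Sfin) -(fineK Ufin) -(fineK Dfin).
set s := fine (mu S); set a := fine U; set b := fine D.
rewrite -!EFinM -EFinD !lee_fin => main muS U0 D0'.
have h1 : 2 * (s * a) <= h ^+ n / 2 * a.
  by rewrite mulrA ler_wpM2r//; lra.
rewrite -(@ler_pM2l _ (h ^+ n))// exprS.
move: main h1; rewrite ?exprS; generalize (h ^+ n) (4 ^+ n : R) => H P main h1.
lra.
Qed.

End faber_krahn.

(** * Functions of class C^k *)

Section chain_rule.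
Context {R : realType}.

Lemma is_derive_comp1 (f g : R -> R) (x df dg : R) :
  is_derive x (1 : R) f df -> is_derive (f x) (1 : R) g dg ->
  is_derive x (1 : R) (g \o f) (dg * df).
Proof.
move=> [f1 fE] [g1 gE]; apply: DeriveDef.
  apply/derivable1_diffP; apply: differentiable_comp; exact/derivable1_diffP.
by rewrite -derive1E (derive1_comp f1 g1) !derive1E fE gE.
Qed.

(** Directional derivatives are derivatives along a line, so that the chain
    rule for g o f reduces to the one-variable chain rule. *)
Lemma is_derive_lineE n (f : 'rV[R]_n -> R) x v df :
  is_derive x v f df <-> is_derive (0 : R) (1 : R) (fun s : R => f (s *: v + x)) df.
Proof.
have e : (fun h : R => h^-1 *: (f (h *: 1 *: v + x) - f (0 *: v + x))) =
         (fun h : R => h^-1 *: (f (h *: v + x) - f x)).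
  by apply/funext => h; rewrite [_%:A]mulr1 scale0r add0r.
have e' : (fun h : R => h^-1 *: (f ((h *: 1 + 0) *: v + x) - f (0 *: v + x))) =
         (fun h : R => h^-1 *: (f (h *: v + x) - f x)).
  by apply/funext => h; rewrite [_%:A]mulr1 addr0 scale0r add0r.
by split=> -[]; rewrite /derivable /derive /= ?e' => h1 h2; apply: DeriveDef;
  rewrite /derivable /derive /= ?e'.
Qed.

Lemma is_derive_comp n (f : 'rV[R]_n -> R) (g : R -> R) x v df dg :
  is_derive x v f df -> is_derive (f x) (1 : R) g dg ->
  is_derive x v (g \o f) (dg * df).
Proof.
move=> /is_derive_lineE df1 dg1; apply/is_derive_lineE.
apply: (is_derive_comp1 df1); by rewrite scale0r add0r.
Qed.

End chain_rule.

Section Ck.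
Context {R : realType} {n : nat}.
Implicit Types (U V : set 'rV[R]_n) (f g : 'rV[R]_n -> R).

(** The scale between continuity and smoothness. Closure properties are proved
    by induction on k, and powers of the positive part are in the scale without
    being smooth. *)
Fixpoint Ck k U f : Prop :=
  if k is k'.+1 then
    [/\ forall x, U x -> {for x, continuous f},
        forall i x, U x -> derivable f x (delta_mx ord0 i) &
        forall i, Ck k' U (partial i f)]
  else forall x, U x -> {for x, continuous f}.

Lemma Ck_continuous k U f : Ck k U f -> forall x, U x -> {for x, continuous f}.
Proof. by case: k => [|k] // []. Qed.

Lemma Ck_derivable k U f : Ck k.+1 U f ->
  forall i x, U x -> derivable f x (delta_mx ord0 i).
Proof. by case. Qed.

Lemma Ck_partial k U f : Ck k.+1 U f -> forall i, Ck k U (partial i f).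
Proof. by case. Qed.

Lemma Ck_isderive k U f : Ck k.+1 U f -> forall i x, U x ->
  is_derive x (delta_mx ord0 i) f (partial i f x).
Proof. by move=> fk i x Ux; apply: DeriveDef => //; exact: Ck_derivable fk _ _ Ux. Qed.

Lemma Ck_le k l U f : (k <= l)%N -> Ck l U f -> Ck k U f.
Proof.
elim: k l f => [l f _|k IH [//|l] f kl [cf df pf]]; first exact: Ck_continuous.
by split=> // i; exact: IH (pf i).
Qed.

Lemma Ck_subset k U V f : V `<=` U -> Ck k U f -> Ck k V f.
Proof.
move=> VU; elim: k f => [f cf x /VU|k IH f [cf df pf]]; first exact: cf.
by split=> [x /VU Ux|i x /VU Ux|i]; [exact: cf|exact: (df i x Ux)|exact: IH (pf i)].
Qed.

Lemma Ck_union k U V f : Ck k U f -> Ck k V f -> Ck k (U `|` V) f.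
Proof.
elim: k f => [f cf cf' x []|k IH f [cf df pf] [cf' df' pf']].
- exact: cf.
- exact: cf'.
- split=> [x []|i x []|i]; [exact: cf|exact: cf'|exact: (df i x)|exact: (df' i x)|].
  exact: IH (pf i) (pf' i).
Qed.

Lemma near_open U x f g : open U -> (forall x, U x -> f x = g x) -> U x ->
  \forall y \near x, f y = g y.
Proof.
move=> oU fg Ux; have : nbhs x U by exact: open_nbhs_nbhs.
by apply: filterS => y /fg.
Qed.

Lemma continuous_at_eq U x f g : open U -> (forall x, U x -> f x = g x) ->
  U x -> {for x, continuous f} -> {for x, continuous g}.
Proof.
move=> oU fg Ux cf; rewrite /prop_for /continuous_at -(fg _ Ux).
apply: cvg_trans cf; apply: near_eq_cvg; first exact: (nbhs_filter x).
exact: (near_open oU fg Ux).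
Qed.

Lemma Ck_eq k U f g : open U -> (forall x, U x -> f x = g x) ->
  Ck k U f -> Ck k U g.
Proof.
move=> oU; elim: k f g => [|k IH] f g fg.
  move=> cf x Ux; exact: (continuous_at_eq oU fg Ux (cf x Ux)).
move=> [cf df pf]; split.
- move=> x Ux; exact: (continuous_at_eq oU fg Ux (cf x Ux)).
- by move=> i x Ux; apply: near_eq_derivable (df i x Ux); exact: (near_open oU fg Ux).
- move=> i; apply: IH (pf i) => x Ux; apply: near_eq_derive.
  exact: (near_open oU fg Ux).
Qed.

Lemma partial_eq U f g i x : open U -> (forall x, U x -> f x = g x) -> U x ->
  partial i f x = partial i g x.
Proof. by move=> oU fg Ux; apply: near_eq_derive; exact: (near_open oU fg Ux). Qed.

Lemma Ck_cst k U (c : R) : Ck k U (fun=> c).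
Proof.
elim: k c => [|k IH] c; first by move=> x _; exact: cst_continuous.
split=> [x _|i x _|i]; [exact: cst_continuous|exact: derivable_cst|].
rewrite (_ : partial _ _ = fun=> 0); first exact: IH.
by apply/funext => x; rewrite /partial derive_cst.
Qed.

Lemma partialD f g i x : derivable f x (delta_mx ord0 i) ->
  derivable g x (delta_mx ord0 i) ->
  partial i (fun x => f x + g x) x = partial i f x + partial i g x.
Proof. by move=> df dg; rewrite /partial (deriveD df dg). Qed.

Lemma partialM f g i x : derivable f x (delta_mx ord0 i) ->
  derivable g x (delta_mx ord0 i) ->
  partial i (fun x => f x * g x) x = f x * partial i g x + g x * partial i f x.
Proof. by move=> df dg; rewrite /partial (deriveM df dg). Qed.

Lemma CkD k U f g : open U -> Ck k U f -> Ck k U g -> Ck k U (fun x => f x + g x).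
Proof.
move=> oU; elim: k f g => [|k IH] f g.
  by move=> cf cg x Ux; exact: (continuousD (cf x Ux) (cg x Ux)).
move=> [cf df pf] [cg dg pg]; split.
- by move=> x Ux; exact: (continuousD (cf x Ux) (cg x Ux)).
- by move=> i x Ux; apply: derivableD; [exact: (df i x Ux)|exact: (dg i x Ux)].
- move=> i; apply: (Ck_eq (f := fun x => partial i f x + partial i g x)) => //.
    by move=> x Ux; rewrite partialD//; [exact: (df i x Ux)|exact: (dg i x Ux)].
  exact: IH (pf i) (pg i).
Qed.

Lemma CkM k U f g : open U -> Ck k U f -> Ck k U g -> Ck k U (fun x => f x * g x).
Proof.
move=> oU; elim: k f g => [|k IH] f g.
  by move=> cf cg x Ux; exact: (continuousM (cf x Ux) (cg x Ux)).
move=> fk gk; have [cf df pf] := fk; have [cg dg pg] := gk; split.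
- by move=> x Ux; exact: (continuousM (cf x Ux) (cg x Ux)).
- by move=> i x Ux; apply: derivableM; [exact: (df i x Ux)|exact: (dg i x Ux)].
- move=> i; apply: (Ck_eq (f := fun x => f x * partial i g x + g x * partial i f x)) => //.
    by move=> x Ux; rewrite partialM//; [exact: (df i x Ux)|exact: (dg i x Ux)].
  apply: CkD => //; apply: IH; [exact: Ck_le (leqnSn _) fk|exact: pg|
    exact: Ck_le (leqnSn _) gk|exact: pf].
Qed.

Lemma CkZ k U (c : R) f : open U -> Ck k U f -> Ck k U (fun x => c * f x).
Proof. by move=> oU; apply: CkM => //; exact: Ck_cst. Qed.

Lemma CkN k U f : open U -> Ck k U f -> Ck k U (fun x => - f x).
Proof.
move=> oU fk; rewrite (_ : (fun _ => _) = fun x => -1 * f x); first exact: CkZ.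
by apply/funext => x; rewrite mulN1r.
Qed.

Lemma CkB k U f g : open U -> Ck k U f -> Ck k U g -> Ck k U (fun x => f x - g x).
Proof. by move=> oU fk gk; apply: CkD => //; exact: CkN. Qed.

Lemma Ck_sum k U (I : Type) (r : seq I) (F : I -> 'rV[R]_n -> R) : open U ->
  (forall i, Ck k U (F i)) -> Ck k U (fun x => \sum_(i <- r) F i x).
Proof.
move=> oU Fk; elim: r => [|i r IH].
  by under eq_fun do rewrite big_nil; exact: Ck_cst.
by under eq_fun do rewrite big_cons; exact: CkD.
Qed.

Lemma smooth_onP U f : smooth_on U f <-> forall k, Ck k U f.
Proof.
have partialsE (s : seq 'I_n) i g : partials (rcons s i) g = partials s (partial i g).
  by rewrite /partials foldr_rcons.
split=> [sf k|].
  elim: k f sf => [|k IH] f sf; first by move=> x Ux; have [] := sf [::] x Ux.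
  split=> [x Ux|i x Ux|i]; [by have [] := sf [::] x Ux| |].
    by have [_] := sf [::] x Ux; exact.
  by apply: IH => s x Ux; rewrite -partialsE; exact: sf.
move=> fk s; elim/last_ind: s f fk => [|s i IH] f fk x Ux.
  split=> [|i]; first exact: (fk 0%N).
  by have [_] := fk 1%N => + _; exact.
rewrite partialsE; apply: IH => // k; exact: (Ck_partial (fk k.+1)).
Qed.

(** R^n is the union of the open sets U and ~ K, and the extension by zero is
    smooth on each. *)
Lemma Ck_extend k U K f : open U -> closed K -> K `<=` U ->
  (forall x, U x -> ~ K x -> f x = 0) -> Ck k U f -> Ck k setT (f \_ U).
Proof.
move=> oU cK KU f0 fk; have -> : setT = U `|` ~` K.
  by rewrite eqEsubset; split=> // x _; case: (pselect (K x)) => [/KU|]; [left|right].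
apply: Ck_union.
  by apply: Ck_eq fk => // x Ux; rewrite patchE mem_set.
apply: (Ck_eq (f := fun=> 0)); [exact: closed_openC| |exact: Ck_cst].
by move=> x Kx; rewrite patchE; case: ifPn => //; rewrite inE => Ux; rewrite f0.
Qed.

Lemma test_function_extend U K f : open U -> compact K -> K `<=` U ->
  (forall x, U x -> ~ K x -> f x = 0) -> (forall k, Ck k U f) ->
  test_function U (f \_ U).
Proof.
move=> oU cptK KU f0 fk; have cK : closed K.
  by apply: compact_closed => //; exact: norm_hausdorff.
have sK : closure [set x | (f \_ U) x != 0] `<=` K.
  rewrite [X in _ `<=` X](iffLR (closure_id K) cK); apply: closureS => x /=.
  rewrite patchE; case: ifPn; last by rewrite eqxx.
  by rewrite inE => Ux fx; apply: contrapT => Kx; rewrite f0// eqxx in fx.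
split; last exact: (subset_trans sK KU).
- by apply/smooth_onP => k; exact: (Ck_extend oU cK KU f0 (fk k)).
- by apply: (subclosed_compact _ cptK sK); exact: closed_closure.
Qed.

End Ck.

(** * Powers of the positive part and smooth truncations *)

Section Ck_special.
Context {R : realType}.

(** For gluing at 0: the functions below vanish on the negative axis and are
    O(h^2) at 0. *)
Lemma is_derive0_sqr_bound (F : R -> R) (C : R) : F 0 = 0 ->
  (forall h, `|h| <= 1 -> `|F h| <= C * h ^+ 2) -> is_derive (0 : R) (1 : R) F 0.
Proof.
move=> F0 FC.
have lim0 : (fun h : R => h^-1 *: (F (h *: 1 + 0) - F 0)) @ 0^' --> (0 : R).
  apply/cvgrPdist_le => e e0.
  have C0 : 0 <= C.
    by have := FC 1; rewrite normr1 lexx expr1n mulr1 => /(_ isT); exact: le_trans.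
  have C1 : 0 < C + 1 by rewrite ltr_wpDl.
  near=> h; rewrite sub0r normrN F0 subr0 addr0 [_%:A]mulr1 normrZ normfV.
  have h1 : `|h| <= 1.
    near: h; apply: dnbhs0_le; exact: ltr01.
  have he : `|h| <= e / (C + 1).
    by near: h; apply: dnbhs0_le; rewrite divr_gt0.
  have h0 : 0 < `|h| by rewrite normr_gt0; near: h; exact: nbhs_dnbhs_neq.
  rewrite ler_pdivrMl// (le_trans (FC _ h1))// -(real_normK (num_real h)) expr2 mulrCA.
  rewrite ler_wpM2l// (le_trans (ler_wpM2l C0 he))// mulrCA ler_piMr ?(ltW e0)//.
  by rewrite ler_pdivrMr// mul1r lerDl.
by apply: DeriveDef; [apply/cvg_ex; exists 0|apply/cvg_lim].
Unshelve. all: by end_near. Qed.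

Definition pospow (m : nat) (y : R) : R := Num.max y 0 ^+ m.

Lemma pospow_gt0E m (y : R) : 0 < y -> pospow m y = y ^+ m.
Proof. by move=> y0; rewrite /pospow max_l ?ltW. Qed.

Lemma pospow_le0E m (y : R) : y <= 0 -> pospow m.+1 y = 0.
Proof. by move=> y0; rewrite /pospow max_r// expr0n. Qed.

Lemma pospow_ge0 m (y : R) : 0 <= pospow m y.
Proof. by rewrite exprn_ge0// le_max lexx orbT. Qed.

Lemma is_derive_pospow m (y : R) :
  is_derive y (1 : R) (pospow m.+2) (m.+2%:R * pospow m.+1 y).
Proof.
have [y0|y0|->] := ltgtP y 0.
- rewrite pospow_le0E ?ltW// mulr0.
  apply: (@near_eq_is_derive _ _ _ (cst (0 : R))).
  near=> z; rewrite pospow_le0E// ltW//; near: z; exact: lt_nbhsl.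
- rewrite pospow_gt0E//.
  apply: (@near_eq_is_derive _ _ _ (fun z : R => z ^+ m.+2)).
    near=> z; rewrite pospow_gt0E//; near: z; exact: lt_nbhsr.
  apply: DeriveDef; first exact: exprn_derivable.
  by rewrite exp_derive [_%:A]mulr1.
- rewrite pospow_le0E// mulr0; apply: (@is_derive0_sqr_bound _ 1).
    by rewrite pospow_le0E.
  move=> h h1; rewrite mul1r ger0_norm ?pospow_ge0//.
  have [h0|h0] := ltP 0 h; last by rewrite pospow_le0E// sqr_ge0.
  rewrite pospow_gt0E// -[m.+2]addn2 exprD ler_piMl ?sqr_ge0//.
  by rewrite exprn_ile1 ?(ltW h0)// (le_trans (ler_norm _)).
Unshelve. all: by end_near. Qed.

Lemma continuous_pospow m : continuous (pospow m.+1).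
Proof.
move=> y; rewrite /pospow.
have cmax : {for y, continuous (fun z : R => Num.max z 0)}.
  by apply: (@continuous_max _ _ id (fun=> 0)); [exact: cvg_id|exact: cvg_cst].
exact: (continuous_comp cmax (@exprn_continuous _ m.+1 _)).
Qed.

Section comp.
Context {n : nat} (U : set 'rV[R]_n) (oU : open U).
Implicit Types f : 'rV[R]_n -> R.

Lemma Ck_pospow k m f : (k < m)%N -> Ck k U f -> Ck k U (fun x => pospow m (f x)).
Proof.
elim: k m f => [|k IH] [//|m] f km.
  move=> cf x Ux; exact: (continuous_comp (cf x Ux) (@continuous_pospow m _)).
case: m km => [//|m] km fk; have [cf df pf] := fk; split.
- move=> x Ux; exact: (continuous_comp (cf x Ux) (@continuous_pospow _ _)).
- move=> i x Ux.
  by have [] := is_derive_comp (Ck_isderive fk i Ux) (is_derive_pospow m (f x)).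
- move=> i; apply: (Ck_eq (f := fun x => m.+2%:R * pospow m.+1 (f x) * partial i f x)) => //.
    move=> x Ux.
    by have [_ <-] := is_derive_comp (Ck_isderive fk i Ux) (is_derive_pospow m (f x)).
  apply: CkM => //; last exact: pf.
  by apply: CkZ => //; apply: IH => //; exact: Ck_le (leqnSn _) fk.
Qed.

Lemma Ck_inv k f : (forall x, U x -> f x != 0) -> Ck k U f ->
  Ck k U (fun x => (f x)^-1).
Proof.
move=> f0; elim: k => [|k IH].
  by move=> cf x Ux; exact: (continuousV (f0 x Ux) (cf x Ux)).
move=> fk; have [cf df pf] := fk; split.
- by move=> x Ux; exact: (continuousV (f0 x Ux) (cf x Ux)).
- by move=> i x Ux; exact: (derivableV (f0 x Ux) (df i x Ux)).
- move=> i; apply: (Ck_eq (f := fun x => - ((f x)^-1 * (f x)^-1 * partial i f x))) => //.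
    move=> x Ux; rewrite /partial (deriveV (f0 x Ux) (df i x Ux)).
    by rewrite scaleNr -exprVn -expr2.
  apply: CkN => //; apply: CkM => //; last exact: pf.
  by apply: CkM => //; apply: IH; exact: Ck_le (leqnSn _) fk.
Qed.

Lemma Ck_ln k f : (forall x, U x -> 0 < f x) -> Ck k U f ->
  Ck k U (fun x => ln (f x)).
Proof.
move=> f0; elim: k => [|k IH].
  move=> cf x Ux; exact: (continuous_comp (cf x Ux) (continuous_ln (f0 x Ux))).
move=> fk; have [cf df pf] := fk; split.
- move=> x Ux; exact: (continuous_comp (cf x Ux) (continuous_ln (f0 x Ux))).
- move=> i x Ux.
  by have [] := is_derive_comp (Ck_isderive fk i Ux) (is_derive1_ln (f0 x Ux)).
- move=> i; apply: (Ck_eq (f := fun x => (f x)^-1 * partial i f x)) => //.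
    move=> x Ux.
    by have [_ <-] := is_derive_comp (Ck_isderive fk i Ux) (is_derive1_ln (f0 x Ux)).
  apply: CkM => //; last exact: pf.
  by apply: Ck_inv => [x Ux|]; [rewrite gt_eqF// f0|exact: Ck_le (leqnSn _) fk].
Qed.

End comp.

(** Extended by zero, these functions form a class closed under
    differentiation (see [is_derive_flat]); hence they are all smooth, and
    [flat 1] is the classical flat function. *)
Definition flat (p : {poly R}) (y : R) : R :=
  if 0 < y then p.[y^-1] * expR (- y^-1) else 0.

Lemma horner_le_expR (p : {poly R}) :
  exists2 C, 0 <= C & forall x, 0 <= x -> `|p.[x]| <= C * expR x.
Proof.
exists (\sum_(i < size p) `|p`_i| * i`!%:R).
  by apply: sumr_ge0 => i _; rewrite mulr_ge0.
move=> x x0; rewrite horner_coef (le_trans (ler_norm_sum _ _ _))// mulr_suml.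
apply: ler_sum => i _; rewrite normrM -mulrA ler_wpM2l//.
rewrite ger0_norm ?exprn_ge0// mulrC -ler_pdivrMr ?ltr0n ?fact_gt0//.
case: (nat_of_ord i) => [|j].
  by rewrite expr0 divr1 (le_trans _ (expR_ge1Dx x))// lerDl.
by rewrite (le_trans _ (expR_ge1Dxn j x0))// lerDr.
Qed.

Lemma flat_le0E p (y : R) : y <= 0 -> flat p y = 0.
Proof. by move=> y0; rewrite /flat ltNge y0. Qed.

(** The exponential dominates the polynomial X^2 p at 1/h. *)
Lemma flat_sqr_bound p : exists C, forall h, `|flat p h| <= C * h ^+ 2.
Proof.
have [C C0 pC] := horner_le_expR (p * 'X^2); exists C => h.
have [h0|h0] := leP h 0; first by rewrite flat_le0E// normr0 mulr_ge0// sqr_ge0.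
have hV0 : 0 < h^-1 by rewrite invr_gt0.
rewrite /flat h0 normrM expRN (ger0_norm (x := (expR _)^-1)); last first.
  by rewrite invr_ge0 expR_ge0.
rewrite ler_pdivrMr ?expR_gt0// mulrAC -ler_pdivrMr ?exprn_gt0// -exprVn.
have := pC _ (ltW hV0); rewrite hornerM hornerXn normrM.
by rewrite (ger0_norm (x := h^-1 ^+ 2))// sqr_ge0.
Qed.

(** With z = 1/y, the derivative of p(z) e^(-z) in y is
    - z^2 (p'(z) - p(z)) e^(-z). *)
Lemma is_derive_flat p (y : R) :
  is_derive y (1 : R) (flat p) (flat ('X^2 * (p - p^`())) y).
Proof.
have [y0|y0|->] := ltgtP y 0.
- rewrite flat_le0E ?ltW//.
  apply: (@near_eq_is_derive _ _ _ (cst (0 : R))).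
  near=> z; rewrite flat_le0E// ltW//; near: z; exact: lt_nbhsl.
- pose g z : R := p.[z] * expR (- z).
  apply: (@near_eq_is_derive _ _ _ (fun z : R => g z^-1)).
    near=> z; rewrite /flat ifT//; near: z; exact: lt_nbhsr.
  have dinv : is_derive y (1 : R) (fun z : R => z^-1) (- y ^- 2).
    have y1 : id y != 0 :> R by rewrite gt_eqF.
    have did : derivable id y (1 : R) by exact: derivable_id.
    apply: DeriveDef; first exact: (derivableV y1 did).
    by have := deriveV y1 did; rewrite derive_id [_%:A]mulr1.
  have dg z : is_derive z (1 : R) g ((p^`().[z] - p.[z]) * expR (- z)).
    have d1 : is_derive z (1 : R) (horner p) (p^`().[z]).
      by apply: DeriveDef; [exact: derivable_horner|rewrite -derive1E derivE].
    have d2 : is_derive z (1 : R) (expR \o -%R) (expR (- z) * -1).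
      by apply: is_derive_comp1.
    have := is_deriveM d1 d2.
    rewrite /GRing.scale/= => h; apply: is_derive_eq; ring.
  have := is_derive_comp1 dinv (dg y^-1); rewrite /flat y0 => h.
  apply: is_derive_eq; rewrite !hornerE exprVn; ring.
- rewrite flat_le0E//; have [C pC] := flat_sqr_bound p.
  by apply: (@is_derive0_sqr_bound _ C) => //; rewrite flat_le0E.
Unshelve. all: by end_near. Qed.

Lemma continuous_flat p : continuous (flat p).
Proof.
move=> y; apply: differentiable_continuous; apply/derivable1_diffP.
by have [] := is_derive_flat p y.
Qed.

Lemma Ck_flat n (U : set 'rV[R]_n) (oU : open U) k p f :
  Ck k U f -> Ck k U (fun x => flat p (f x)).
Proof.
elim: k p f => [|k IH] p f.
  by move=> cf x Ux; exact: (continuous_comp (cf x Ux) (@continuous_flat p _)).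
move=> fk; have [cf df pf] := fk; split.
- by move=> x Ux; exact: (continuous_comp (cf x Ux) (@continuous_flat p _)).
- move=> i x Ux.
  by have [] := is_derive_comp (Ck_isderive fk i Ux) (is_derive_flat p (f x)).
- move=> i; apply: (Ck_eq (f := fun x => flat ('X^2 * (p - p^`())) (f x) *
    partial i f x)) => //.
    move=> x Ux.
    by have [_ <-] := is_derive_comp (Ck_isderive fk i Ux) (is_derive_flat p (f x)).
  apply: CkM => //; last exact: pf.
  by apply: IH; exact: Ck_le (leqnSn _) fk.
Qed.

(** A smooth version of the identity above the level d: it vanishes for s <= d
    and, for s >= 0, lies between 0 and s and within 2 d of s. Composed
    with a positive solution that vanishes on the boundary it yields a test
    function. *)
Definition trunc (d s : R) : R := s * flat 1 (s / d - 1).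

Definition dtrunc (d s : R) : R :=
  flat 1 (s / d - 1) + s / d * flat 'X^2 (s / d - 1).

Lemma flat1_itv (t : R) : 0 <= flat 1 t <= 1.
Proof.
rewrite /flat; case: ifPn => [t0|_]; last by rewrite lexx ler01.
rewrite hornerC mul1r expR_ge0 -expR0 ler_expR oppr_le0 invr_ge0 ltW//.
Qed.

Lemma trunc_eq0 d s : 0 < d -> s <= d -> trunc d s = 0.
Proof.
by move=> d0 sd; rewrite /trunc flat_le0E ?mulr0// subr_le0 ler_pdivrMr// mul1r.
Qed.

Lemma trunc_itv d s : 0 <= s -> 0 <= trunc d s <= s.
Proof.
move=> s0; have /andP[h1 h2] := flat1_itv (s / d - 1).
by rewrite /trunc mulr_ge0//= ler_piMr.
Qed.

(** With t = s / d - 1 the defect is d (1 + t) (1 - e^(-1/t)). For t <= 1 the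
    last factor is at most 1; for t > 1 it is at most 1/t. *)
Lemma trunc_close d s : 0 < d -> 0 <= s -> s - trunc d s <= 2 * d.
Proof.
move=> d0 s0; have [sd|ds] := leP s d.
  by rewrite trunc_eq0//; lra.
set t := s / d - 1; have t0 : 0 < t by rewrite subr_gt0 ltr_pdivlMr// mul1r.
have -> : s - trunc d s = d * (1 + t) * (1 - flat 1 t).
  by rewrite /trunc -/t /t; field; rewrite gt_eqF.
have /andP[h1 h2] := flat1_itv t.
rewrite -mulrA mulrC [X in _ <= X]mulrC [leLHS]mulrC ler_pM2l//.
have [t1|t1] := leP t 1; first by nra.
have tV : 0 < t^-1 by rewrite invr_gt0.
have h3 : 1 - t^-1 <= flat 1 t.
  by rewrite /flat t0 hornerC mul1r expR_ge1Dx.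
have -> : 2 = (1 + t) * 1 + (1 - t) :> R by ring.
have : (1 + t) * (1 - flat 1 t) <= (1 + t) * t^-1 by apply: ler_wpM2l; lra.
have -> : (1 + t) * t^-1 = t^-1 + 1 by field; rewrite gt_eqF.
have : t^-1 <= 1 by rewrite invf_le1// ltW.
lra.
Qed.

Lemma is_derive_trunc d s : is_derive s (1 : R) (trunc d) (dtrunc d s).
Proof.
have d1 : is_derive s (1 : R) (fun s : R => s / d - 1) (d^-1).
  rewrite (_ : (fun _ => _) = d^-1 *: (id : R -> R) - cst 1); last first.
    by apply/funext => z /=; rewrite mulrC.
  apply: is_derive_eq; by rewrite subr0 [_%:A]mulr1.
have := is_deriveM (is_derive_id s (1 : R)) (is_derive_comp1 d1 (is_derive_flat 1 _)).
move=> h; rewrite (_ : trunc d = (id : R -> R) *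
  (flat 1 \o (fun s : R => s / d - 1)))//.
apply: is_derive_eq; rewrite /dtrunc derivC subr0 mulr1 /GRing.scale/=; ring.
Qed.

(** For s > d and x = d / (s - d) the derivative is (1 + x + x^2) e^(-x),
    and e^x dominates the first terms of its series. *)
Lemma dtrunc_bound d s : 0 < d -> 0 <= s -> `|dtrunc d s| <= 4.
Proof.
move=> d0 s0; rewrite /dtrunc; set t := s / d - 1.
have -> : s / d = 1 + t by rewrite /t; ring.
have [t0|t0] := leP t 0; first by rewrite !flat_le0E// mulr0 addr0 normr0.
have /andP[h1 h2] := flat1_itv t.
rewrite /flat t0 hornerXn expRN in h1 h2 *; rewrite hornerC mul1r in h1 h2 *.
set x := t^-1; have x0 : 0 < x by rewrite invr_gt0.
have -> : t = x^-1 by rewrite /x invrK.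
have ex0 : 0 < expR x := expR_gt0 x.
have e1 := expR_ge1Dx x; have := expR_ge1Dxn 1 (ltW x0); rewrite (_ : 2`! = 2%N)// => e2.
rewrite -mulrA -/x in h1 h2 *.
rewrite [X in `|_ + X|](_ : _ = (x ^+ 2 + x) / expR x); last by field; rewrite !gt_eqF.
rewrite -[X in X + _]mul1r -mulrDl ger0_norm; last first.
  by rewrite divr_ge0 ?addr_ge0 ?sqr_ge0 ?ler01 ?(ltW x0) ?(ltW ex0).
rewrite ler_pdivrMr//; lra.
Qed.

Lemma Ck_trunc n (U : set 'rV[R]_n) (oU : open U) k d f :
  Ck k U f -> Ck k U (fun x => trunc d (f x)).
Proof.
move=> fk; apply: CkM => //; apply: Ck_flat => //.
apply: CkB => //; last exact: Ck_cst.
by apply: CkM => //; exact: Ck_cst.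
Qed.

End Ck_special.

(** * Bounded functions on Omega and the divergence theorem *)

Section bounded_measurable.
Context {R : realType} {n : nat}.
Local Notation mu := (@lebesgue_rV R n).
Variable Omega : set 'rV[R]_n.
Hypothesis oO : open Omega.
Hypothesis bO : bounded_set Omega.
Implicit Types f g : 'rV[R]_n -> R.

(** Omega has finite measure, so these functions are integrable, and unlike the
    integrable ones they are stable under products. *)
Definition bounded_meas f :=
  measurable_fun Omega f /\ exists B, forall x, Omega x -> `|f x| <= B.

Local Notation bmeas := bounded_meas.

Lemma mOmega : measurable Omega. Proof. exact: open_measurable_rV. Qed.
Hint Resolve mOmega : core.

Lemma muOmega_lty : (mu Omega < +oo)%E.
Proof. exact: bounded_lebesgue_rV_lty. Qed.

Lemma bmeas_integrable f : bmeas f -> mu.-integrable Omega (EFin \o f).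
Proof.
move=> [mf [B fB]]; apply: measurable_bounded_integrable => //.
  exact: muOmega_lty.
by exists B; split=> [|N BN x Ox]; [exact: num_real|exact: le_trans (fB x Ox) (ltW BN)].
Qed.

Lemma bmeas_cst (c : R) : bmeas (fun=> c).
Proof. by split; [exact: measurable_cst|exists `|c|]. Qed.

Lemma bmeasD f g : bmeas f -> bmeas g -> bmeas (fun x => f x + g x).
Proof.
move=> [mf [B fB]] [mg [C gC]]; split; first exact: measurable_funD.
by exists (B + C) => x Ox; rewrite (le_trans (ler_normD _ _))// lerD ?fB ?gC.
Qed.

Lemma bmeasM f g : bmeas f -> bmeas g -> bmeas (fun x => f x * g x).
Proof.
move=> [mf [B fB]] [mg [C gC]]; split; first exact: measurable_funM.
by exists (B * C) => x Ox; rewrite normrM ler_pM ?fB ?gC.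
Qed.

Lemma bmeasZ (c : R) f : bmeas f -> bmeas (fun x => c * f x).
Proof. by apply: bmeasM; exact: bmeas_cst. Qed.

Lemma bmeasN f : bmeas f -> bmeas (fun x => - f x).
Proof.
move=> nf; rewrite (_ : (fun _ => _) = fun x => -1 * f x); first exact: bmeasZ.
by apply/funext => x; rewrite mulN1r.
Qed.

Lemma bmeasB f g : bmeas f -> bmeas g -> bmeas (fun x => f x - g x).
Proof. by move=> nf ng; apply: bmeasD => //; exact: bmeasN. Qed.

Lemma bmeasX f k : bmeas f -> bmeas (fun x => f x ^+ k).
Proof.
move=> nf; elim: k => [|k IH]; first by under eq_fun do rewrite expr0; exact: bmeas_cst.
by under eq_fun do rewrite exprS; exact: bmeasM.
Qed.

Lemma bmeas_norm f : bmeas f -> bmeas (fun x => `|f x|).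
Proof.
move=> [mf [B fB]]; split; first exact: measurableT_comp.
by exists B => x Ox; rewrite normr_id fB.
Qed.

Lemma bmeas_sum (I : Type) (r : seq I) (F : I -> 'rV[R]_n -> R) :
  (forall i, bmeas (F i)) -> bmeas (fun x => \sum_(i <- r) F i x).
Proof.
move=> Fk; elim: r => [|i r IH].
  by under eq_fun do rewrite big_nil; exact: bmeas_cst.
by under eq_fun do rewrite big_cons; exact: bmeasD.
Qed.

Lemma bmeas_eq f g : (forall x, Omega x -> f x = g x) -> bmeas f -> bmeas g.
Proof.
move=> fg [mf [B fB]]; split.
  by apply: eq_measurable_fun mf => x; rewrite inE => /fg.
by exists B => x Ox; rewrite -fg// fB.
Qed.

Local Notation Int f := (\int[mu]_(x in Omega) f x).

Lemma Int_eq f g : (forall x, Omega x -> f x = g x) -> Int f = Int g.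
Proof. by move=> fg; apply: eq_Rintegral => x; rewrite inE => /fg. Qed.

Lemma IntD f g : bmeas f -> bmeas g -> Int (fun x => f x + g x) = Int f + Int g.
Proof. by move=> nf ng; rewrite RintegralD//; exact: bmeas_integrable. Qed.

Lemma IntB f g : bmeas f -> bmeas g -> Int (fun x => f x - g x) = Int f - Int g.
Proof. by move=> nf ng; rewrite RintegralB//; exact: bmeas_integrable. Qed.

Lemma IntZ (c : R) f : bmeas f -> Int (fun x => c * f x) = c * Int f.
Proof. by move=> nf; rewrite RintegralZl//; exact: bmeas_integrable. Qed.

Lemma Int_sum (I : Type) (r : seq I) (F : I -> 'rV[R]_n -> R) :
  (forall i, bmeas (F i)) ->
  Int (fun x => \sum_(i <- r) F i x) = \sum_(i <- r) Int (F i).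
Proof.
move=> nF; elim: r => [|i r IH].
  by under eq_Rintegral do rewrite big_nil; rewrite big_nil Rintegral_cst// mul0r.
under eq_Rintegral do rewrite big_cons.
by rewrite IntD// ?IH ?big_cons//; exact: bmeas_sum.
Qed.

Lemma Int_le f g : bmeas f -> bmeas g -> (forall x, Omega x -> f x <= g x) ->
  Int f <= Int g.
Proof. by move=> nf ng fg; apply: le_Rintegral => //; exact: bmeas_integrable. Qed.

Lemma Int_ge0 f : (forall x, Omega x -> 0 <= f x) -> 0 <= Int f.
Proof. exact: Rintegral_ge0. Qed.

Lemma Int_cst (c : R) : Int (fun=> c) = c * fine (mu Omega).
Proof. by rewrite Rintegral_cst. Qed.

Lemma Int_norm_le f : bmeas f -> `|Int f| <= Int (fun x => `|f x|).
Proof. by move=> nf; apply: le_normr_Rintegral => //; exact: bmeas_integrable. Qed.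

Lemma Int_EFin f : bmeas f -> (Int f)%:E = (\int[mu]_(x in Omega) (f x)%:E)%E.
Proof.
move=> nf; rewrite /Rintegral fineK//; apply: integrable_fin_num => //.
exact: bmeas_integrable.
Qed.

Lemma Ck_measurable k f : Ck k Omega f -> measurable_fun Omega f.
Proof. by move=> /Ck_continuous cf; exact: open_continuous_measurable_fun_rV. Qed.

(** Compact support in Omega, for functions whose values outside Omega are
    irrelevant. *)
Definition csupp f := exists K : set 'rV[R]_n,
  [/\ compact K, K `<=` Omega & forall x, Omega x -> ~ K x -> f x = 0].

Lemma csupp_bounded f : csupp f ->
  exists M, forall x, M < `|x| -> (f \_ Omega) x = 0.
Proof.
move=> [K [cK KO f0]]; have [M [_ KM]] := compact_bounded cK.
exists (M + 1) => x Mx; rewrite patchE; case: ifPn => //; rewrite inE => Ox.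
rewrite f0// => Kx; have := KM (M + 1); rewrite ltrDl ltr01 => /(_ isT x Kx).
by rewrite /= leNgt Mx.
Qed.

Lemma csupp_Ck k f : csupp f -> Ck k Omega f -> Ck k setT (f \_ Omega).
Proof.
move=> [K [cK KO f0]] fk; apply: (Ck_extend oO _ KO f0 fk).
by apply: compact_closed => //; exact: norm_hausdorff.
Qed.

Lemma bmeas_csupp f : csupp f -> Ck 0 Omega f -> bmeas f.
Proof.
move=> sf fk; split; first exact: Ck_measurable fk.
have [M f0] := csupp_bounded sf.
have cf : continuous (f \_ Omega).
  by move=> x; exact: (Ck_continuous (csupp_Ck sf fk) Logic.I).
have [B _ fB] := continuous_bounded_csupp cf f0.
by exists B => x Ox; have := fB x; rewrite patchE mem_set.
Qed.

Lemma partial_off_compact (K : set 'rV[R]_n) f : compact K ->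
  (forall x, Omega x -> ~ K x -> f x = 0) ->
  forall i x, Omega x -> ~ K x -> partial i f x = 0.
Proof.
move=> cK f0 i x Ox Kx; rewrite /partial -(derive_cst (0 : R) x (delta_mx ord0 i)).
apply: near_eq_derive; have : nbhs x (Omega `&` ~` K).
  apply: open_nbhs_nbhs; split=> //; apply: openI => //; apply: closed_openC.
  by apply: compact_closed => //; exact: norm_hausdorff.
by apply: filterS => y [Oy Ky]; rewrite f0.
Qed.

Lemma csupp_partial f i : csupp f -> csupp (partial i f).
Proof.
move=> [K [cK KO f0]]; exists K; split=> // x Ox Kx.
exact: (partial_off_compact cK f0).
Qed.

Lemma csuppMl f g : csupp f -> csupp (fun x => f x * g x).
Proof. by move=> [K [cK KO f0]]; exists K; split=> // x Ox Kx; rewrite f0// mul0r. Qed.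

Lemma csuppMr f g : csupp g -> csupp (fun x => f x * g x).
Proof. by move=> [K [cK KO f0]]; exists K; split=> // x Ox Kx; rewrite f0// mulr0. Qed.

Lemma csuppD f g : csupp f -> csupp g -> csupp (fun x => f x + g x).
Proof.
move=> [K [cK KO f0]] [L [cL LO g0]]; exists (K `|` L); split.
- exact: compactU.
- by move=> x [/KO|/LO].
- move=> x Ox KLx; rewrite f0// ?g0// ?addr0// => ?; apply: KLx; [right|left] => //.
Qed.

Lemma partial_patch f i x : csupp f -> partial i (f \_ Omega) x = (partial i f \_ Omega) x.
Proof.
move=> [K [cK KO f0]]; rewrite patchE; case: ifPn => [|].
  rewrite inE => Ox; apply: partial_eq oO _ Ox => y Oy.
  by rewrite patchE mem_set.
move=> Ox; rewrite /partial -[RHS](derive_cst (0 : R) x (delta_mx ord0 i)).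
apply: near_eq_derive; have : nbhs x (~` K).
  apply: open_nbhs_nbhs; split; last by move=> /KO; rewrite notin_setE in Ox.
  by apply: closed_openC; apply: compact_closed => //; exact: norm_hausdorff.
apply: filterS => y Ky; rewrite patchE; case: ifPn => //; rewrite inE => Oy.
by rewrite f0.
Qed.

(** No boundary term: extended by zero the function is of class C^1 on R^n. *)
Lemma Int_partial f i : csupp f -> Ck 1 Omega f -> Int (partial i f) = 0.
Proof.
move=> sf fk; have [cf df pf] := csupp_Ck sf fk.
have [M f0] := csupp_bounded sf.
have := @integral_partial0 R n (f \_ Omega) i M.
rewrite Rintegral_mkcond /Rintegral.
under [in X in _ -> X]eq_integral do rewrite -partial_patch//.
move=> -> //.
- by move=> x; exact: (df i x Logic.I).
- by move=> x; exact: (pf i x Logic.I).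
Qed.

Lemma Int_divergence (V : 'I_n -> 'rV[R]_n -> R) :
  (forall i, csupp (V i)) -> (forall i, Ck 1 Omega (V i)) ->
  Int (fun x => \sum_i partial i (V i) x) = 0.
Proof.
move=> sV cV; rewrite Int_sum//.
  by rewrite big1// => i _; apply: Int_partial.
move=> i; apply: bmeas_csupp => //; first exact: csupp_partial.
exact: Ck_partial (cV i) i.
Qed.

Lemma csupp_test f : csupp f -> (forall k, Ck k Omega f) -> test_function Omega (f \_ Omega).
Proof. by move=> [K [cK KO f0]] fk; apply: (test_function_extend oO cK). Qed.

Lemma test_csupp f : test_function Omega f -> csupp f.
Proof.
move=> [_ cf fO]; exists (closure [set x | f x != 0]); split=> // x Ox fx.
by apply: contrapT => /eqP f0; apply: fx; exact: subset_closure.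
Qed.

Lemma test_Ck f k : test_function Omega f -> Ck k Omega f.
Proof.
move=> [/smooth_onP sf _ _]; apply: Ck_subset (sf k); exact: subsetT.
Qed.

Lemma closure_compact : compact (closure Omega).
Proof.
apply: bounded_closed_compact; last exact: closed_closure.
have [M [Mr OM]] := bO; exists M; split=> // N MN.
have cN : closed [set x : 'rV[R]_n | `|x| <= N].
  rewrite (_ : [set x | _] = (fun x : 'rV[R]_n => `|x|) @^-1` [set r | r <= N])//.
  by apply: preimage_closed => [x _|]; [exact: norm_continuous|exact: closed_le].
have h : closure Omega `<=` [set x : 'rV[R]_n | `|x| <= N].
  rewrite [X in _ `<=` X](iffLR (closure_id _) cN).
  by apply: closureS => y; exact: (OM N MN).
exact: h.
Qed.

Lemma closure_continuous_bounded g : {within closure Omega, continuous g} ->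
  exists B, forall x, closure Omega x -> `|g x| <= B.
Proof.
move=> cg; have : compact (g @` closure Omega).
  by apply: continuous_compact => //; exact: closure_compact.
move=> /compact_bounded[B [_ gB]]; exists (B + 1) => x Ox.
by apply: gB; [rewrite ltrDl|exists x].
Qed.

Lemma smooth_closure_Ck f k : smooth_on_closure Omega f -> Ck k Omega f.
Proof. by move=> [/smooth_onP]. Qed.

Lemma smooth_closure_bmeas f s : smooth_on_closure Omega f -> bmeas (partials s f).
Proof.
move=> [sf _ /(_ s)[g cg gf]]; split.
  apply: open_continuous_measurable_fun_rV => // x Ox; by have [] := sf s x Ox.
have [B gB] := closure_continuous_bounded cg; exists B => x Ox.
by rewrite -gf// gB//; exact: subset_closure.
Qed.

End bounded_measurable.

(** * Positivity of the solution *)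

Section interior_minimum.
Context {R : realType}.

(** If the second derivative a were negative, g' would be negative just to the
    right of 0, and the mean value theorem would give a smaller value of g. *)
Lemma derive2_at_min (g g' : R -> R) (a e : R) : 0 < e ->
  (forall t, `|t| < e -> is_derive t (1 : R) g (g' t)) ->
  is_derive (0 : R) (1 : R) g' a ->
  (forall t, `|t| < e -> g 0 <= g t) -> g' 0 = 0 /\ 0 <= a.
Proof.
move=> e0 dg [dg' dg'a] gmin.
have inE_ t : t \in `](- e), e[ -> `|t| < e by rewrite in_itv/= ltr_norml.
have z0 : `|0 : R| < e by rewrite normr0.
have g'0 : g' 0 = 0.
  have [_ <-] := dg _ z0.
  suff [_ ->] : is_derive (0 : R) (1 : R) g 0 by [].
  apply: (@derive1_at_min R g (- e) e 0) => [|t /inE_ te||t /inE_ te].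
  - by rewrite (@le_trans _ _ 0)// ?oppr_le0 ltW.
  - by have [] := dg t te.
  - by rewrite in_itv/= oppr_lt0 e0.
  - exact: gmin.
split=> //; rewrite leNgt; apply/negP => a0.
have lim : (fun h : R => h^-1 *: (g' (h *: 1 + 0) - g' 0)) @ 0^' --> a.
  by rewrite -dg'a.
have /cvgr_lt := lim => /(_ _ a0) near_neg.
have [d /= d0 dP] : \forall h \near 0^', h^-1 *: (g' (h *: 1 + 0) - g' 0) < 0 by [].
pose h := Num.min (d / 2) (e / 2).
have h0 : 0 < h by rewrite lt_min !divr_gt0.
have hd : h < d by rewrite gt_min ltr_pdivrMr// ltr_pMr// ltr1n.
have he : h < e by rewrite gt_min [X in _ || X]ltr_pdivrMr// ltr_pMr// ltr1n orbT.
have [||c] := @MVT R g g' _ _ h0.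
- move=> t; rewrite in_itv/= => /andP[t0 th]; apply: dg.
  by rewrite gtr0_norm// (lt_trans th).
- apply: derivable_within_continuous => t; rewrite in_itv/= => /andP[t0 th].
  by have [] := dg t; rewrite ?ger0_norm// (le_lt_trans th).
rewrite in_itv/= => /andP[c0 ch]; rewrite subr0 => gE.
have : h^-1 * (g h - g 0) < 0.
  rewrite gE mulrC mulfK ?gt_eqF//.
  have := dP c; rewrite /ball_/= sub0r normrN gtr0_norm// (lt_trans ch)//.
  rewrite gt_eqF// => /(_ isT isT).
  by rewrite g'0 subr0 addr0 [_%:A]mulr1 /GRing.scale/= pmulr_rlt0// invr_gt0.
rewrite pmulr_rlt0 ?invr_gt0// subr_lt0 ltNge gmin// gtr0_norm//.
Qed.

Lemma interior_minimum n (Omega : set 'rV[R]_n) (f : 'rV[R]_n -> R) x :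
  open Omega -> Ck 2 Omega f -> Omega x -> (forall y, Omega y -> f x <= f y) ->
  forall i, partial i f x = 0 /\ 0 <= partial i (partial i f) x.
Proof.
move=> oO fk Ox fmin i; set e := delta_mx ord0 i : 'rV[R]_n.
have : \forall s \near (0 : R), Omega (s *: e + x).
  have : (fun s : R => s *: e + x) @ (0 : R) --> x.
    have := @continuous_line R n x e 0; rewrite /continuous_at.
    by rewrite scale0r add0r.
  by apply; exact: open_nbhs_nbhs.
move=> /nbhs_ballP[r /= r0 rO].
have rO' t : `|t| < r -> Omega (t *: e + x).
  by move=> tr; apply: rO; rewrite -ball_normE /ball_/= sub0r normrN.
have := @derive2_at_min (fun s : R => f (s *: e + x))
  (fun s : R => partial i f (s *: e + x)) (partial i (partial i f) x) r r0.
rewrite scale0r add0r; apply.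
- move=> t tr; apply: is_derive_line; exact: (Ck_derivable fk) (rO' _ tr).
- have := @is_derive_line R n (partial i f) x e 0; rewrite scale0r add0r; apply.
  exact: (Ck_derivable (Ck_partial fk i)) Ox.
- by move=> t tr; apply: fmin; exact: rO'.
Qed.

End interior_minimum.

Section bvp_positive.
Context {R : realType} {n : nat}.
Variable Omega : set 'rV[R]_n.
Hypothesis oO : open Omega.
Hypothesis bO : bounded_set Omega.
Variables (c : 'rV[R]_n -> 'rV[R]_n) (A : R) (psi : 'rV[R]_n -> R).
Hypothesis sol : solves_bvp Omega c A psi.

(** At an interior minimum grad psi = 0 and lap psi >= 0, which contradicts
    - lap psi + A c . grad psi = 1. So the minimum over the closure is attained
    on the boundary, and nowhere else. *)
Lemma bvp_positive x : Omega x -> 0 < psi x.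
Proof.
move=> Ox; have [[sp cp _] eqn bd] := sol; rewrite ltNge; apply/negP => px.
have no_min z : Omega z -> (forall y, Omega y -> psi z <= psi y) -> False.
  move=> Oz pmin; have p2 : Ck 2 Omega psi by move/smooth_onP: sp.
  have im := interior_minimum oO p2 Oz pmin.
  have := eqn z Oz; rewrite /dotr big1 => [|i _]; last first.
    by rewrite mxE (im i).1 mulr0.
  rewrite mulr0 addr0 => /eqP; rewrite -subr_eq0 => /eqP h.
  have : 0 <= laplacian psi z by apply: sumr_ge0 => i _; exact: (im i).2.
  move: h; lra.
have cO : closure Omega !=set0 by exists x; exact: subset_closure.
have [z Oz zmin] := EVT_min_rV cO (closure_compact bO) cp.
rewrite inE in Oz.
have [Oz'|Oz'] := pselect (Omega z).
  by apply: (no_min z) => // y Oy; apply: zmin; rewrite inE; exact: subset_closure.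
have pz : psi z = 0.
  by apply: bd; split=> //; rewrite /interior; move=> /nbhs_singleton.
apply: (no_min x) => // y Oy; rewrite (le_trans px)// -pz; apply: zmin.
by rewrite inE; exact: subset_closure.
Qed.

(** Beyond positivity, the boundary condition acts through this fact: functions
    of psi that vanish for small values have compact support in Omega, so that
    integrations by parts take place away from the boundary. *)
Lemma superlevel_compact k : 0 < k -> exists K : set 'rV[R]_n,
  [/\ compact K, K `<=` Omega & forall x, Omega x -> ~ K x -> psi x < k].
Proof.
move=> k0; have [[sp cp _] eqn bd] := sol.
exists (closure Omega `&` psi @^-1` [set r | k <= r]); split.
- apply: (subclosed_compact _ (closure_compact bO)); last by move=> x [].
  have : closed ((psi : subspace (closure Omega) -> R) @^-1` [set r | k <= r]).
    by apply: preimage_closed => [x _|]; [exact: cp|exact: closed_ge].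
  move=> /closed_subspaceP[V cV VE].
  by rewrite setIC -VE; apply: closedI => //; exact: closed_closure.
- move=> x [Ox /= kx]; apply: contrapT => nOx.
  have : psi x = 0 by apply: bd; split=> //; rewrite /interior; move=> /nbhs_singleton.
  by move=> px; rewrite px leNgt k0 in kx.
- move=> x Ox /not_andP[]; first by move=> h; exfalso; apply: h; exact: subset_closure.
  by move=> /negP; rewrite -ltNge.
Qed.

End bvp_positive.

(** * Energy identities *)

Section bvp_energy.
Context {R : realType} {n : nat}.
Local Notation mu := (@lebesgue_rV R n).
Variable Omega : set 'rV[R]_n.
Hypothesis oO : open Omega.
Hypothesis bO : bounded_set Omega.
Variables (c : 'rV[R]_n -> 'rV[R]_n).
Hypothesis c_smooth : smooth_vector_field Omega c.
Hypothesis div_c : incompressible Omega c.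

Local Notation Int f := (\int[mu]_(x in Omega) f x).
Local Notation bmeas := (bounded_meas Omega).

Lemma Ck_field k i : Ck k Omega (fun x => c x ord0 i).
Proof. exact: smooth_closure_Ck (c_smooth i). Qed.

Lemma bmeas_field i : bmeas (fun x => c x ord0 i).
Proof. exact: (smooth_closure_bmeas oO bO [::] (c_smooth i)). Qed.

Section solution.
Variables (A : R) (psi : 'rV[R]_n -> R).
Hypothesis sol : solves_bvp Omega c A psi.

Let spsi : smooth_on_closure Omega psi. Proof. by case: sol. Qed.

Lemma psi_Ck k : Ck k Omega psi. Proof. exact: smooth_closure_Ck spsi. Qed.

Lemma psi_bmeas : bmeas psi.
Proof. exact: (smooth_closure_bmeas oO bO [::] spsi). Qed.

Lemma partial_psi_bmeas i : bmeas (partial i psi).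
Proof. exact: (smooth_closure_bmeas oO bO [:: i] spsi). Qed.

Lemma psi_gt0 x : Omega x -> 0 < psi x.
Proof. exact: (bvp_positive oO bO sol). Qed.

Lemma psi_eqn x : Omega x ->
  - (\sum_i partial i (partial i psi) x) +
  A * (\sum_i c x ord0 i * partial i psi x) = 1.
Proof.
move=> Ox; have [_ /(_ x Ox) + _] := sol.
by rewrite /dotr; under [X in A * X]eq_bigr do rewrite mxE.
Qed.

Definition sqgrad x := \sum_i partial i psi x ^+ 2.

Lemma sqgrad_bmeas : bmeas sqgrad.
Proof. by apply: bmeas_sum => i; apply: bmeasX => //; exact: partial_psi_bmeas. Qed.

Lemma sqgrad_ge0 x : 0 <= sqgrad x.
Proof. by apply: sumr_ge0 => i _; exact: sqr_ge0. Qed.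

Lemma csupp_comp (h : R -> R) k : 0 < k -> (forall s, s < k -> h s = 0) ->
  csupp Omega (fun x => h (psi x)).
Proof.
move=> k0 h0; have [K [cK KO pK]] := superlevel_compact bO sol k0.
by exists K; split=> // x Ox Kx; rewrite h0// pK.
Qed.

(** The divergence theorem for h1(psi) grad psi - A h0(psi) c. As h0' = h1 and
    div c = 0, the drift term A h1(psi) c . grad psi is the divergence of
    A h0(psi) c and integrates to 0: this is why the estimates below do not
    depend on A. *)
Lemma bvp_truncated_energy (h0 h1 h2 : R -> R) k : 0 < k ->
  (forall s, is_derive s (1 : R) h0 (h1 s)) ->
  (forall s, is_derive s (1 : R) h1 (h2 s)) ->
  (forall s, s < k -> h0 s = 0) -> (forall s, s < k -> h1 s = 0) ->
  (forall s, s < k -> h2 s = 0) ->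
  Ck 1 Omega (fun x => h0 (psi x)) -> Ck 1 Omega (fun x => h1 (psi x)) ->
  Ck 0 Omega (fun x => h2 (psi x)) ->
  Int (fun x => h2 (psi x) * sqgrad x) = Int (fun x => h1 (psi x)).
Proof.
move=> k0 dh0 dh1 h0k h1k h2k ch0 ch1 ch2.
pose V i x := h1 (psi x) * partial i psi x - A * (h0 (psi x) * c x ord0 i).
have sV i : csupp Omega (V i).
  apply: csuppD; first by apply: csuppMl; exact: csupp_comp k0 h1k.
  rewrite (_ : (fun _ => _) = fun x => h0 (psi x) * (- A * c x ord0 i)).
    by apply: csuppMl; exact: csupp_comp k0 h0k.
  by apply/funext => x; ring.
have cV i : Ck 1 Omega (V i).
  have c1 := CkM oO ch1 (Ck_partial (psi_Ck 2) i).
  exact: (CkB oO c1 (CkZ A oO (CkM oO ch0 (Ck_field 1 i)))).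
have := Int_divergence oO bO sV cV.
rewrite (@Int_eq _ _ _ _ (fun x => h2 (psi x) * sqgrad x - h1 (psi x))); last first.
  move=> x Ox; set e := fun i : 'I_n => delta_mx ord0 i : 'rV[R]_n.
  have dV i : partial i (V i) x =
      h1 (psi x) * partial i (partial i psi) x +
      h2 (psi x) * partial i psi x ^+ 2 -
      A * (h0 (psi x) * partial i (fun y => c y ord0 i) x +
           h1 (psi x) * (c x ord0 i * partial i psi x)).
    have dp := Ck_isderive (psi_Ck 1) i Ox.
    have d1 := is_derive_comp dp (dh1 (psi x)).
    have d0 := is_derive_comp dp (dh0 (psi x)).
    have d2 := Ck_isderive (Ck_partial (psi_Ck 2) i) i Ox.
    have d3 := Ck_isderive (Ck_field 1 i) i Ox.
    have [_] := is_deriveB (is_deriveM d1 d2) (is_deriveZ A (is_deriveM d0 d3)).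
    rewrite /partial => dE; apply: (etrans dE).
    rewrite /GRing.scale/=; ring.
  under eq_bigr do rewrite dV.
  rewrite sumrB big_split/= -!mulr_sumr big_split/= -!mulr_sumr.
  rewrite -/(sqgrad x); have := div_c Ox; rewrite /divergence => ->.
  have := psi_eqn Ox; set a := \sum_i _; set b := \sum_i _ => eqn.
  have -> : a = A * b - 1 by move: eqn; lra.
  ring.
have n2 : bmeas (fun x => h2 (psi x) * sqgrad x).
  apply: bmeasM; last exact: sqgrad_bmeas.
  by apply: bmeas_csupp => //; exact: csupp_comp k0 h2k.
have n1 : bmeas (fun x => h1 (psi x)).
  by apply: bmeas_csupp => //; [exact: csupp_comp k0 h1k|exact: Ck_le ch1].
by rewrite (IntB oO bO n2 n1) => /eqP; rewrite subr_eq0 => /eqP.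
Qed.

Definition excess m k x := pospow m (psi x - k).

Lemma excess_ge0 m k x : 0 <= excess m k x. Proof. exact: pospow_ge0. Qed.

Lemma excess_Ck j m k : (j < m)%N -> Ck j Omega (excess m k).
Proof.
move=> jm; apply: (Ck_pospow oO jm); apply: CkB => //; first exact: psi_Ck.
exact: Ck_cst.
Qed.

Lemma excess_csupp m k : 0 < k -> csupp Omega (excess m.+1 k).
Proof.
move=> k0; apply: (@csupp_comp (fun s => pospow m.+1 (s - k)) k) => // s sk.
by rewrite pospow_le0E// subr_le0 ltW.
Qed.

Lemma excess_bmeas m k : bmeas (excess m.+1 k).
Proof.
split; first by apply: Ck_measurable (excess_Ck k (ltn0Sn m)).
have [_ [B pB]] := psi_bmeas; exists ((B + `|k|) ^+ m.+1) => x Ox.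
rewrite ger0_norm ?excess_ge0// /excess /pospow lerXn2r ?nnegrE//.
- by rewrite le_max lexx orbT.
- by rewrite addr_ge0// (le_trans _ (pB _ Ox)).
- rewrite ge_max; apply/andP; split.
    have h2 := ler_norm (- k); rewrite normrN in h2.
    exact: lerD (le_trans (ler_norm _) (pB _ Ox)) h2.
  by rewrite addr_ge0// (le_trans _ (pB _ Ox)).
Qed.

Lemma is_derive_pospow_shift m k s :
  is_derive s (1 : R) (fun s => pospow m.+2 (s - k)) (m.+2%:R * pospow m.+1 (s - k)).
Proof.
have d1 : is_derive s (1 : R) (fun s : R => s - k) 1.
  rewrite (_ : (fun _ => _) = (id : R -> R) - cst k)//.
  by apply: is_derive_eq; rewrite subr0.
by have := is_derive_comp1 d1 (is_derive_pospow m (s - k)); rewrite mulr1.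
Qed.

(** The truncated energy identity with h1 = (s - k)_+^(m + 2). *)
Lemma excess_energy m k : 0 < k ->
  m.+2%:R * Int (fun x => excess m.+1 k x * sqgrad x) = Int (excess m.+2 k).
Proof.
move=> k0.
pose h0 s := m.+3%:R^-1 * pospow m.+3 (s - k).
have ps j s : s < k -> pospow j.+1 (s - k) = 0.
  by move=> sk; rewrite pospow_le0E// subr_le0 ltW.
rewrite -IntZ//; last by apply: bmeasM; [exact: excess_bmeas|exact: sqgrad_bmeas].
transitivity (Int (fun x => (m.+2%:R * pospow m.+1 (psi x - k)) * sqgrad x)).
  by apply: Int_eq => x Ox; rewrite /excess mulrA.
apply: (@bvp_truncated_energy h0 (fun s => pospow m.+2 (s - k))
  (fun s => m.+2%:R * pospow m.+1 (s - k)) k k0).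
- move=> s; rewrite /h0.
  have := is_deriveZ (m.+3%:R^-1) (is_derive_pospow_shift m.+1 k s).
  by rewrite /GRing.scale/= mulrA mulVf ?mul1r// pnatr_eq0.
- by move=> s; exact: is_derive_pospow_shift.
- by move=> s sk; rewrite /h0 ps// mulr0.
- by move=> s sk; rewrite ps.
- by move=> s sk; rewrite ps// mulr0.
- by apply: CkZ => //; exact: excess_Ck.
- exact: excess_Ck.
- by apply: CkZ => //; exact: excess_Ck.
Qed.

(** The piecewise linear function going from 0 to 1 between d and 2 d. A
    difference of two energy identities thus bounds the energy carried by
    the region psi > 2 d, uniformly in d. *)
Definition ramp (d s : R) := (pospow 1 (s - d) - pospow 1 (s - 2 * d)) / d.

Lemma ramp_ge0 d s : 0 < d -> 0 <= ramp d s.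
Proof.
move=> d0; rewrite /ramp divr_ge0 ?(ltW d0)// subr_ge0 /pospow !expr1.
by rewrite ge_max le_max lerD2l lerN2 ler_peMl ?(ltW d0) ?ler1n//= le_max lexx orbT.
Qed.

Lemma ramp_eq1 d s : 0 < d -> 2 * d <= s -> ramp d s = 1.
Proof.
move=> d0 ds; rewrite /ramp /pospow !expr1 !max_l; first by field; rewrite gt_eqF.
- by rewrite subr_ge0.
- by rewrite subr_ge0 (le_trans _ ds)// ler_peMl ?(ltW d0) ?ler1n.
Qed.

(** It remains to see that (s - d)_+^2 - (s - 2 d)_+^2 <= 2 d s for s > 0. *)
Lemma bvp_energy d : 0 < d -> Int (fun x => ramp d (psi x) * sqgrad x) <= Int psi.
Proof.
move=> d0; have d20 : 0 < 2 * d by rewrite mulr_gt0.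
have ng k : bmeas (fun x => excess 1 k x * sqgrad x).
  by apply: bmeasM; [exact: excess_bmeas|exact: sqgrad_bmeas].
have -> : Int (fun x => ramp d (psi x) * sqgrad x) =
    (2 * d)^-1 * (Int (excess 2 d) - Int (excess 2 (2 * d))).
  rewrite -!excess_energy// -mulrBr -IntB// mulrA.
  rewrite (_ : (2 * d)^-1 * 2%:R = d^-1); last by field; rewrite gt_eqF.
  rewrite -IntZ//; last exact: bmeasB.
  by apply: Int_eq => x Ox; rewrite /ramp /excess; ring.
rewrite -IntB//; try exact: excess_bmeas.
rewrite -IntZ//; last by apply: bmeasB; exact: excess_bmeas.
apply: Int_le => //.
- by apply: bmeasZ => //; apply: bmeasB; exact: excess_bmeas.
- exact: psi_bmeas.
- move=> x Ox; rewrite /excess ler_pdivrMl//; have p0 := psi_gt0 Ox.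
  set s := psi x in p0 *.
  have [sd|ds] := leP s d.
    have z1 : s - d <= 0 by lra.
    have z2 : s - 2 * d <= 0 by lra.
    by rewrite (pospow_le0E _ z1) (pospow_le0E _ z2) subrr; nra.
  have z1 : 0 < s - d by lra.
  rewrite (pospow_gt0E _ z1).
  have [s2|s2] := leP s (2 * d).
    have z2 : s - 2 * d <= 0 by lra.
    by rewrite (pospow_le0E _ z2) subr0; nra.
  have z2 : 0 < s - 2 * d by lra.
  by rewrite (pospow_gt0E _ z2); nra.
Qed.

End solution.
End bvp_energy.

(** * De Giorgi iteration *)

Section faber_krahn_csupp.
Context {R : realType} {n : nat}.
Local Notation mu := (@lebesgue_rV R n).
Variable Omega : set 'rV[R]_n.
Hypothesis oO : open Omega.
Hypothesis bO : bounded_set Omega.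
Local Notation Int f := (\int[mu]_(x in Omega) f x).

(** The inequality on R^n, applied to the extension by zero. *)
Lemma faber_krahn_csupp f (S : set 'rV[R]_n) (h : R) :
  csupp Omega f -> Ck 1 Omega f -> measurable S ->
  (forall x, Omega x -> f x != 0 -> S x) -> 0 < h ->
  (4%:E * mu S <= (h ^+ n)%:E)%E ->
  Int (fun x => f x ^+ 2) <=
  4 ^+ n.+1 * h ^+ 2 * Int (fun x => \sum_i partial i f x ^+ 2).
Proof.
move=> sf fk mS fS h0 muS.
have patch_sqr (g : 'rV[R]_n -> R) : csupp Omega g -> Ck 0 Omega g ->
    (\int[mu]_x ((g \_ Omega) x ^+ 2)%:E = (Int (fun x => g x ^+ 2))%:E)%E.
  move=> sg gk; have ng := bmeas_csupp oO sg gk.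
  rewrite (Int_EFin oO bO (bmeasX 2 ng)) [RHS]integral_mkcond.
  apply: eq_integral => x _; rewrite !patchE; case: ifPn => //.
  by rewrite expr0n.
have fkT := csupp_Ck oO sf fk.
have [M f0] := csupp_bounded sf.
have cu : continuous (f \_ Omega).
  by move=> x; exact: (Ck_continuous fkT Logic.I).
have du i x : derivable (f \_ Omega) x (delta_mx ord0 i).
  exact: (Ck_derivable fkT) Logic.I.
have cdu i : continuous (partial i (f \_ Omega)).
  by move=> x; exact: (Ck_continuous (Ck_partial fkT i) Logic.I).
have uS x : (f \_ Omega) x != 0 -> S x.
  rewrite patchE; case: ifPn; last by rewrite eqxx.
  by rewrite inE => Ox; exact: fS.
have := faber_krahn cu du cdu f0 mS uS h0 muS.
have fk0 : Ck 0 Omega f by exact: Ck_le fk.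
rewrite (patch_sqr _ sf fk0).
have -> : (\sum_i \int[mu]_x (partial i (f \_ Omega) x ^+ 2)%:E =
    (Int (fun x => \sum_i partial i f x ^+ 2))%:E)%E.
  have nd i : bounded_meas Omega (partial i f).
    apply: (bmeas_csupp oO); first exact: csupp_partial.
    exact: (Ck_partial fk i).
  rewrite (Int_sum oO bO _ (fun i => bmeasX 2 (nd i))) -sumEFin.
  apply: eq_bigr => i _.
  rewrite -(patch_sqr _ (csupp_partial oO i sf) (Ck_partial fk i)).
  by apply: eq_integral => x _; rewrite partial_patch.
by rewrite -EFinM lee_fin.
Qed.

End faber_krahn_csupp.

Section de_giorgi.
Context {R : realType} {n : nat}.
Local Notation mu := (@lebesgue_rV R n).
Variable Omega : set 'rV[R]_n.
Hypothesis oO : open Omega.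
Hypothesis bO : bounded_set Omega.
Variables (c : 'rV[R]_n -> 'rV[R]_n).
Hypothesis c_smooth : smooth_vector_field Omega c.
Hypothesis div_c : incompressible Omega c.
Variables (A : R) (psi : 'rV[R]_n -> R).
Hypothesis sol : solves_bvp Omega c A psi.
Local Notation Int f := (\int[mu]_(x in Omega) f x).

Definition suplevel k := [set x | Omega x /\ k < psi x].

Lemma open_suplevel k : open (suplevel k).
Proof.
rewrite openE => x [Ox kx]; apply: filterI; first exact: open_nbhs_nbhs.
have cp : {for x, continuous psi} by exact: Ck_continuous (psi_Ck sol 0) x Ox.
exact: (cp _ (lt_nbhsr kx)).
Qed.

Lemma measurable_suplevel k : measurable (suplevel k).
Proof. apply: open_measurable_rV; exact: open_suplevel. Qed.

Definition mu_suplevel k : R := fine (mu (suplevel k)).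

Lemma mu_suplevelE k : (mu_suplevel k)%:E = mu (suplevel k).
Proof.
rewrite /mu_suplevel fineK// ge0_fin_numE//.
apply: le_lt_trans (muOmega_lty oO bO); apply: le_measure; rewrite ?inE.
- exact: measurable_suplevel.
- exact: mOmega.
- by move=> x [].
Qed.

Lemma mu_suplevel_ge0 k : 0 <= mu_suplevel k. Proof. exact: fine_ge0. Qed.

(** With K = 4^(n + 1) (4 / 3) rho^2 as in [de_giorgi_step], this is the
    constant for which 16 K^4 = de_giorgi_cst rho^8. *)
Definition de_giorgi_cst : R := 16 * (4 ^+ n.+1 * (4 / 3)) ^+ 4.

Lemma de_giorgi_cst_gt0 : 0 < de_giorgi_cst.
Proof. by rewrite mulr_gt0// exprn_gt0// mulr_gt0// exprn_gt0. Qed.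

Lemma Int_indic_suplevel k (a : R) :
  Int (fun x => a * \1_(suplevel k) x) = a * mu_suplevel k.
Proof.
have ni : bounded_meas Omega (\1_(suplevel k) : _ -> R).
  split; first by apply: measurable_indic; exact: measurable_suplevel.
  exists 1 => x _; rewrite indicE; case: (_ \in _) => /=; rewrite ?normr1 ?normr0//.
rewrite IntZ//; congr (_ * _); apply: EFin_inj; rewrite Int_EFin// mu_suplevelE.
rewrite integral_indic//; last 2 first.
- exact: mOmega.
- exact: measurable_suplevel.
by congr (mu _); rewrite setIidl// => x [].
Qed.

Lemma bmeas_indic_suplevel k (a : R) :
  bounded_meas Omega (fun x => a * \1_(suplevel k) x).
Proof.
apply: bmeasZ => //; split; first by apply: measurable_indic; exact: measurable_suplevel.
exists 1 => x _; rewrite indicE; case: (_ \in _) => /=; rewrite ?normr1 ?normr0//.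
Qed.

(** For v = (psi - k)_+ the Faber-Krahn inequality for v^2 and the energy
    identity for v^3 bound the integral of v^4 by K times that of v^3; Young's
    inequality K v^3 <= v^4 / 2 + 8 K^4 on {v > 0} absorbs the first term. *)
Lemma de_giorgi_step k rho : 0 < k -> 0 < rho -> 4 * mu_suplevel k <= rho ^+ n ->
  Int (excess psi 4 k) <= de_giorgi_cst * rho ^+ 8 * mu_suplevel k.
Proof.
move=> k0 r0 mk.
pose K := 4 ^+ n.+1 * (4 / 3) * rho ^+ 2 : R.
have K0 : 0 < K by rewrite !mulr_gt0// exprn_gt0.
have fk : Int (excess psi 4 k) <= K * Int (excess psi 3 k).
  have := @faber_krahn_csupp R n Omega oO bO (excess psi 2 k) (suplevel k) rho
    (excess_csupp bO sol 1 k0) (excess_Ck oO sol k (ltnSn 1)) (measurable_suplevel k).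
  have -> : Int (fun x => excess psi 2 k x ^+ 2) = Int (excess psi 4 k).
    by apply: Int_eq => x Ox; rewrite /excess /pospow -exprM.
  have -> : Int (fun x => \sum_i partial i (excess psi 2 k) x ^+ 2) =
      4 / 3 * Int (excess psi 3 k).
    rewrite -(excess_energy oO bO c_smooth div_c sol 1 k0) mulrA.
    have -> : 4 / 3 * 3%:R = 4 :> R by field.
    rewrite -IntZ//; last first.
      apply: bmeasM => //; first exact: (excess_bmeas oO bO sol).
      exact: (sqgrad_bmeas oO bO sol).
    apply: Int_eq => x Ox; rewrite /sqgrad mulrA mulr_sumr; apply: eq_bigr => i _.
    have [_] := is_derive_comp (Ck_isderive (psi_Ck sol 1) i Ox)
      (is_derive_pospow_shift 0 k (psi x)).
    rewrite /excess /partial => ->.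
    rewrite /pospow; ring.
  have KE B : 4 ^+ n.+1 * rho ^+ 2 * (4 / 3 * B) = K * B by rewrite /K; ring.
  rewrite KE; apply => //.
  - move=> x Ox; rewrite /excess => px; split=> //; rewrite ltNge; apply/negP => xk.
    by rewrite pospow_le0E ?eqxx// ?subr_le0 in px.
  - by rewrite -mu_suplevelE -EFinM lee_fin.
have young : K * Int (excess psi 3 k) <= 2^-1 * Int (excess psi 4 k) + 8 * K ^+ 4 * mu_suplevel k.
  have np m : bounded_meas Omega (excess psi m.+1 k) by exact: (excess_bmeas oO bO sol).
  rewrite -IntZ// -Int_indic_suplevel -[X in _ <= X + _]IntZ// -IntD//; last 2 first.
  - exact: bmeasZ.
  - exact: bmeas_indic_suplevel.
  apply: Int_le => //; first exact: bmeasZ.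
    by apply: bmeasD; [exact: bmeasZ|exact: bmeas_indic_suplevel].
  move=> x Ox; rewrite indicE /excess; have [xk|kx] := leP (psi x) k.
    have K4 : 0 <= K ^+ 4 by rewrite exprn_ge0 ?(ltW K0).
    rewrite !pospow_le0E ?subr_le0// !mulr0 add0r; apply: mulr_ge0 => //; lra.
  rewrite mem_set// mulr1 !pospow_gt0E ?subr_gt0//; set v := psi x - k.
  have v0 : 0 < v by rewrite subr_gt0.
  have [v2|v2] := leP (2 * K) v.
    have : v ^+ 3 * (2 * K) <= v ^+ 3 * v by rewrite ler_pM2l// exprn_gt0.
    have : 0 <= K ^+ 4 by rewrite exprn_ge0 ?(ltW K0).
    rewrite -exprSr; lra.
  have : K * v ^+ 3 <= K * (2 * K) ^+ 3.
    by rewrite ler_pM2l// lerXn2r ?nnegrE ?(ltW v0) ?(ltW v2)// mulr_ge0// ltW.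
  have : 0 <= v ^+ 4 by rewrite exprn_ge0 ?(ltW v0).
  have -> : K * (2 * K) ^+ 3 = 8 * K ^+ 4 by ring.
  lra.
have -> : de_giorgi_cst * rho ^+ 8 * mu_suplevel k = 16 * K ^+ 4 * mu_suplevel k.
  by rewrite /de_giorgi_cst /K; ring.
move: fk young; lra.
Qed.

Lemma chebyshev_mu_suplevel k h : 0 < k -> k < h ->
  (h - k) ^+ 4 * mu_suplevel h <= Int (excess psi 4 k).
Proof.
move=> k0 kh; rewrite -Int_indic_suplevel; apply: Int_le => //.
- exact: bmeas_indic_suplevel.
- exact: (excess_bmeas oO bO sol).
- move=> x Ox; rewrite indicE; case: (boolP (x \in suplevel h)) => [|_]; last first.
    by rewrite mulr0 excess_ge0.
  rewrite inE => -[_ hx]; rewrite mulr1 /excess pospow_gt0E ?subr_gt0 ?(lt_trans kh)//.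
  by rewrite lerXn2r ?nnegrE ?subr_ge0 ?lerD2r ?(ltW kh) ?(ltW (lt_trans kh hx)) ?(ltW hx).
Qed.

Lemma mu_suplevel_le k h : k <= h -> mu_suplevel h <= mu_suplevel k.
Proof.
move=> kh; rewrite -lee_fin !mu_suplevelE; apply: le_measure; rewrite ?inE.
- exact: measurable_suplevel.
- exact: measurable_suplevel.
- by move=> x [Ox hx]; split=> //; exact: le_lt_trans hx.
Qed.

Lemma mu_suplevel_eq0 k : mu_suplevel k = 0 -> forall x, Omega x -> psi x <= k.
Proof.
move=> mk x Ox; rewrite leNgt; apply/negP => kx.
have : (0 < mu (suplevel k))%E.
  by apply: open_lebesgue_rV_gt0; [exact: open_suplevel|exists x].
by rewrite -mu_suplevelE mk ltxx.
Qed.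

(** With levels k_j = k0 + d (1 - 2^-j) and scales rho_j = rho0 / 4^j, the step
    and Chebyshev's inequality propagate 4 |{psi > k_j}| <= rho_j^n: the gain
    rho_j^8 = O(4^(-8 j)) beats the loss 16^(j + 1) from the shrinking gaps
    between the levels. In the limit {psi > k0 + d} is null, and, being open,
    empty. *)
Lemma de_giorgi_iteration k0 d rho0 : (0 < n)%N -> 0 < k0 -> 0 < d -> 0 < rho0 ->
  rho0 <= 1 -> de_giorgi_cst * rho0 ^+ 8 <= d ^+ 4 / (16 * 4 ^+ n) ->
  4 * mu_suplevel k0 <= rho0 ^+ n -> forall x, Omega x -> psi x <= k0 + d.
Proof.
move=> n0 k00 d0 r0 r1 rd m0.
pose k j : R := k0 + d * (1 - (2 ^+ j)^-1).
pose rho j : R := rho0 / 4 ^+ j.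
have p2 j : 0 < (2 : R) ^+ j by rewrite exprn_gt0.
have p4 j : 0 < (4 : R) ^+ j by rewrite exprn_gt0.
have kk j : k j.+1 - k j = d / 2 ^+ j.+1.
  by rewrite /k exprS; field; rewrite gt_eqF.
have kpos j : 0 < k j.
  have : 1 <= (2 : R) ^+ j by rewrite exprn_ege1// ler1n.
  rewrite -(invf_le1 (p2 j)) => q1; rewrite /k ltr_wpDr//.
  by rewrite mulr_ge0 ?(ltW d0)// subr_ge0.
have rpos j : 0 < rho j by rewrite divr_gt0.
have claim j : 4 * mu_suplevel (k j) <= rho j ^+ n.
  elim: j => [|j IH].
    by rewrite /k /rho !expr0 invr1 subrr mulr0 addr0 mulr1.
  have klt : k j < k j.+1 by rewrite -subr_gt0 kk divr_gt0.
  have h1 := de_giorgi_step (kpos j) (rpos j) IH.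
  have h2 := chebyshev_mu_suplevel (kpos j) klt; rewrite kk in h2.
  have h3 : de_giorgi_cst * rho j ^+ 8 * 4 ^+ n <= (d / 2 ^+ j.+1) ^+ 4.
    rewrite /rho expr_div_n (exprS 2) expr_div_n exprMn -exprM -exprM.
    have q : (4 : R) ^+ (j * 8) = 2 ^+ (j * 4) * (2 ^+ (j * 4)) ^+ 3.
      have -> : (4 : R) = 2 ^+ 2 by ring.
      by rewrite -!exprM -exprD; congr (_ ^+ _); ring.
    have e1 : 1 <= (2 : R) ^+ (j * 4) by rewrite exprn_ege1// ler1n.
    have e3 : 1 <= ((2 : R) ^+ (j * 4)) ^+ 3 by rewrite exprn_ege1.
    have q0 : 0 < (2 : R) ^+ (j * 4) by exact: p2.
    rewrite q; set X := 2 ^+ (j * 4) in e1 e3 q0 *.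
    have -> : de_giorgi_cst * (rho0 ^+ 8 / (X * X ^+ 3)) * 4 ^+ n =
        (de_giorgi_cst * rho0 ^+ 8) * (16 * 4 ^+ n) / (16 * (X * X ^+ 3)).
      field; by rewrite gt_eqF.
    have -> : (2 : R) ^+ 4 = 16 by ring.
    rewrite ler_pdivrMr; last by rewrite !mulr_gt0// exprn_gt0.
    rewrite [leRHS](_ : _ = d ^+ 4 * X ^+ 3); last by field; rewrite gt_eqF.
    move: rd; rewrite ler_pdivlMr ?mulr_gt0// => rd.
    by rewrite (le_trans rd)// ler_peMr// exprn_ge0 ?(ltW d0).
  have D0 : 0 < (d / 2 ^+ j.+1) ^+ 4 by rewrite exprn_gt0// divr_gt0.
  have -> : rho j.+1 ^+ n = rho j ^+ n / 4 ^+ n.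
    rewrite -expr_div_n; congr (_ ^+ _); rewrite /rho exprS; field.
    by rewrite gt_eqF.
  rewrite ler_pdivlMr// -(ler_pM2l D0).
  have h4 : 4 * mu_suplevel (k j) * (d / 2 ^+ j.+1) ^+ 4 <= rho j ^+ n * (d / 2 ^+ j.+1) ^+ 4.
    by rewrite ler_pM2r.
  have h5 : 4 * 4 ^+ n * ((d / 2 ^+ j.+1) ^+ 4 * mu_suplevel (k j.+1)) <=
      4 * 4 ^+ n * (de_giorgi_cst * rho j ^+ 8 * mu_suplevel (k j)).
    by rewrite ler_pM2l ?mulr_gt0//; exact: le_trans h1.
  have h6 : de_giorgi_cst * rho j ^+ 8 * 4 ^+ n * (4 * mu_suplevel (k j)) <=
      (d / 2 ^+ j.+1) ^+ 4 * (4 * mu_suplevel (k j)).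
    by rewrite ler_wpM2r// mulr_ge0// mu_suplevel_ge0.
  move: h4 h5 h6.
  set a := (d / _) ^+ 4; set b := mu_suplevel _; set e := mu_suplevel _; set f := rho j ^+ 8.
  lra.
apply: mu_suplevel_eq0; apply/eqP; rewrite eq_le mu_suplevel_ge0 andbT.
apply/ler_addgt0Pr => e e0; rewrite add0r.
have [j je] : exists j : nat, (4 ^+ j)^-1 <= e :> R.
  exists (Num.Def.truncn e^-1).+1.
  rewrite -[leRHS]invrK lef_pV2 ?posrE ?invr_gt0//.
  rewrite (le_trans (ltW (truncnS_gt _)))// -natrX ler_nat.
  by apply: ltnW; exact: ltn_expl.
rewrite (le_trans _ je)// (le_trans (_ : _ <= mu_suplevel (k j)))//.
  by apply: mu_suplevel_le; rewrite /k lerD2l ler_piMr ?(ltW d0)// gerBl invr_ge0.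
have := claim j.
have : rho j ^+ n <= rho j.
  rewrite -[n]prednK// exprS ler_piMr ?(ltW (rpos j))// exprn_ile1 ?(ltW (rpos j))//.
  by rewrite /rho ler_pdivrMr// mul1r (le_trans r1)// exprn_ege1// ler1n.
have : rho j <= (4 ^+ j)^-1 by rewrite /rho ler_piMl// invr_ge0 ltW.
have := mu_suplevel_ge0 (k j); lra.
Qed.

End de_giorgi.

(** * Bounds uniform in A and the effect of the drift *)

Section approximants.
Context {R : realType} {n : nat}.
Local Notation mu := (@lebesgue_rV R n).
Variable Omega : set 'rV[R]_n.
Hypothesis oO : open Omega.
Hypothesis bO : bounded_set Omega.
Local Notation Int f := (\int[mu]_(x in Omega) f x).
Local Notation bmeas := (bounded_meas Omega).

(** One De Giorgi step at level 1, where the measure of Omega bounds that of the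
    superlevel set: (psi - 1)_+ is then bounded in L^4, by a constant that
    depends on neither A nor c. *)
Lemma uniform_integral_bound : (0 < n)%N -> exists2 B : R, 0 <= B &
  forall c A psi, smooth_vector_field Omega c -> incompressible Omega c ->
    solves_bvp Omega c A psi ->
    Int psi <= B /\ Int (fun x => psi x ^+ 2) <= B.
Proof.
move=> n0; pose m := fine (mu Omega); have m0 : 0 <= m by exact: fine_ge0.
have mE : m%:E = mu Omega by rewrite fineK// ge0_fin_numE// muOmega_lty.
(* 4 m <= rho^n because rho >= 1 and n >= 1 *)
pose rho := 4 * m + 1; have r0 : 0 < rho by rewrite ltr_wpDl// mulr_ge0.
pose C8 := @de_giorgi_cst R n * rho ^+ 8 * m.
have C80 : 0 <= C8.
  apply: mulr_ge0 => //; apply: mulr_ge0; first exact/ltW/de_giorgi_cst_gt0.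
  by rewrite exprn_ge0 ?(ltW r0).
exists (4 * m + 2 * C8); first by apply: addr_ge0; exact: mulr_ge0.
move=> c A psi sc dc sol.
have mm : mu_suplevel Omega psi 1 <= m.
  rewrite -lee_fin (mu_suplevelE oO bO sol) mE; apply: le_measure; rewrite ?inE.
  - exact: (measurable_suplevel oO sol _).
  - exact: mOmega.
  - by move=> x [].
have m1 : 4 * mu_suplevel Omega psi 1 <= rho ^+ n.
  have : rho <= rho ^+ n by rewrite ler_eXnr// /rho lerDr mulr_ge0.
  by rewrite {1}/rho; lra.
have p4 : Int (excess psi 4 1) <= C8.
  apply: (le_trans (de_giorgi_step oO bO sc dc sol ltr01 r0 m1)).
  rewrite /C8 ler_wpM2l//; apply: mulr_ge0; first exact/ltW/de_giorgi_cst_gt0.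
  by rewrite exprn_ge0 ?(ltW r0).
have np : bmeas (excess psi 4 1) by exact: (excess_bmeas oO bO sol _ _).
have npsi := psi_bmeas oO bO sol.
have ncst (a : R) : bmeas (fun=> a) by exact: bmeas_cst.
have bnd f : bmeas f -> (forall x, Omega x -> f x <= 4 + 2 * excess psi 4 1 x) ->
    Int f <= 4 * m + 2 * C8.
  move=> nf fle; have := Int_le oO bO nf (bmeasD (ncst 4) (bmeasZ 2 np)) fle.
  rewrite IntD//; last exact: bmeasZ.
  rewrite IntZ// Int_cst// -/m => /le_trans; apply; rewrite lerD2l ler_pM2l//.
have key x : Omega x -> psi x <= 1 + excess psi 1 1 x /\ 0 < psi x.
  move=> Ox; split; last exact: (psi_gt0 oO bO sol Ox).
  by rewrite /excess /pospow expr1 -lerBlDl le_max lexx.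
have v4 x : excess psi 4 1 x = excess psi 1 1 x ^+ 4 by rewrite /excess /pospow -exprM.
have aux (v : R) : 2 * v ^+ 2 <= v ^+ 4 + 1.
  by rewrite -subr_ge0 [leRHS](_ : _ = (v ^+ 2 - 1) ^+ 2) ?sqr_ge0//; ring.
split; apply: bnd => //; try exact: bmeasX.
- move=> x Ox; have [h1 h2] := key x Ox; rewrite v4.
  have := aux (excess psi 1 1 x); have := sqr_ge0 (excess psi 1 1 x - 1).
  have := sqr_ge0 (excess psi 1 1 x); rewrite sqrrB1; lra.
- move=> x Ox; have [h1 h2] := key x Ox; rewrite v4.
  have := aux (excess psi 1 1 x); have := sqr_ge0 (excess psi 1 1 x - 1); rewrite sqrrB1.
  have := sqr_ge0 (excess psi 1 1 x).
  have : psi x ^+ 2 <= (1 + excess psi 1 1 x) ^+ 2.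
    by rewrite lerXn2r// nnegrE ?(ltW h2)// (le_trans _ h1)// ltW.
  rewrite sqrrD expr1n mul1r; lra.
Qed.

Section drift.
Variables (c : 'rV[R]_n -> 'rV[R]_n).
Hypothesis c_smooth : smooth_vector_field Omega c.
Hypothesis div_c : incompressible Omega c.

Definition cgrad (f : 'rV[R]_n -> R) x := \sum_i c x ord0 i * partial i f x.

Lemma test_bmeas chi : test_function Omega chi -> bmeas chi.
Proof. by move=> tchi; apply: bmeas_csupp => //; [exact: test_csupp|exact: test_Ck]. Qed.

Lemma test_partial_bmeas chi i : test_function Omega chi -> bmeas (partial i chi).
Proof.
move=> tchi; apply: bmeas_csupp => //; first exact: csupp_partial (test_csupp tchi).
exact: (Ck_partial (test_Ck 1 tchi) i).
Qed.

Lemma cgrad_bmeas f : (forall i, bmeas (partial i f)) -> bmeas (cgrad f).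
Proof.
by move=> nf; apply: bmeas_sum => i; apply: bmeasM => //; exact: (bmeas_field oO bO c_smooth i).
Qed.

Lemma sqgrad_test_bmeas chi : test_function Omega chi -> bmeas (sqgrad chi).
Proof. by move=> tchi; apply: bmeas_sum => i; apply: bmeasX; exact: test_partial_bmeas. Qed.

(** Incompressibility makes c . grad antisymmetric. *)
Lemma Int_cgrad_anti f chi : (forall k, Ck k Omega f) -> test_function Omega chi ->
  Int (fun x => f x * cgrad chi x) = - Int (fun x => chi x * cgrad f x).
Proof.
move=> fk tchi; have schi := test_csupp tchi; have ck := fun k => test_Ck k tchi.
pose V i x := chi x * (f x * c x ord0 i).
have sV i : csupp Omega (V i) by exact: csuppMl.
have cV i : Ck 1 Omega (V i).
  by apply: CkM => //; apply: CkM => //; exact: Ck_field.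
have n1 : bmeas (fun x => f x * cgrad chi x).
  apply: (@bmeas_eq _ _ Omega (fun x => \sum_i partial i chi x * (f x * c x ord0 i))).
    by move=> x _; rewrite /cgrad mulr_sumr; apply: eq_bigr => i _; ring.
  apply: bmeas_sum => i; apply: bmeas_csupp => //.
    by apply: csuppMl; exact: csupp_partial.
  by apply: CkM => //; [exact: (Ck_partial (ck 1%N) i)|apply: CkM => //; exact: Ck_field].
have n2 : bmeas (fun x => chi x * cgrad f x).
  apply: bmeas_csupp => //; first exact: csuppMl.
  apply: CkM => //; apply: Ck_sum => // i; apply: CkM => //; first exact: Ck_field.
  exact: (Ck_partial (fk 1%N) i).
have := Int_divergence oO bO sV cV.
rewrite (@Int_eq _ _ _ _ (fun x => f x * cgrad chi x + chi x * cgrad f x)).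
  by rewrite IntD// => /eqP; rewrite addr_eq0 => /eqP.
move=> x Ox; rewrite /cgrad.
rewrite (eq_bigr (fun i => f x * (c x ord0 i * partial i chi x) +
    chi x * (c x ord0 i * partial i f x) +
    chi x * f x * partial i (fun y => c y ord0 i) x)).
  rewrite !big_split/= -!mulr_sumr; have := div_c Ox; rewrite /divergence => ->.
  by rewrite mulr0 addr0.
move=> i _.
have d1 := Ck_isderive (ck 1%N) i Ox; have d2 := Ck_isderive (fk 1%N) i Ox.
have d3 := Ck_isderive (Ck_field c_smooth 1 i) i Ox.
have [_] := is_deriveM d1 (is_deriveM d2 d3).
rewrite /partial => dE; apply: (etrans dE); rewrite /GRing.scale/= !fctE. ring.
Qed.

Section with_solution.
Variables (A : R) (psi : 'rV[R]_n -> R).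
Hypothesis A0 : 0 < A.
Hypothesis sol : solves_bvp Omega c A psi.

(** Dividing the equation, tested against chi, by A: weak limits of psi as
    A tends to infinity are constant along c. The right-hand side involves only
    chi and the integral of psi. *)
Lemma psi_pairing chi : test_function Omega chi ->
  `|Int (fun x => psi x * cgrad chi x)| <=
  A^-1 * (Int (fun x => `|chi x|) + 2^-1 * (Int (sqgrad chi) + Int psi)).
Proof.
move=> tchi; have schi := test_csupp tchi; have ck := fun k => test_Ck k tchi.
have npsi := psi_bmeas oO bO sol; have nchi := test_bmeas tchi.
have ndp i := partial_psi_bmeas oO bO sol i.
have ncp : bmeas (cgrad psi) by exact: cgrad_bmeas.
(* the divergence theorem for chi grad psi gives
   A (chi, c . grad psi) = (chi, 1) - (grad chi, grad psi) *)
pose dd x := \sum_i partial i chi x * partial i psi x.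
have ndd : bmeas dd by apply: bmeas_sum => i; apply: bmeasM => //; exact: test_partial_bmeas.
pose W i x := chi x * partial i psi x.
have sW i : csupp Omega (W i) by exact: csuppMl.
have cW i : Ck 1 Omega (W i).
  by apply: CkM => //; exact: (Ck_partial (psi_Ck sol 2) i).
have eqA : Int (fun x => chi x * cgrad psi x) = A^-1 * (Int chi - Int dd).
  have nx : bmeas (fun x => chi x * cgrad psi x) by exact: bmeasM.
  have := Int_divergence oO bO sW cW.
  rewrite (@Int_eq _ _ _ _ (fun x => (A * (chi x * cgrad psi x) - chi x) + dd x)).
    rewrite IntD//; last by apply: bmeasB => //; exact: bmeasZ.
    rewrite IntB//; last exact: bmeasZ.
    rewrite IntZ// => /eqP; rewrite addr_eq0 => /eqP h.
    have -> : Int (fun x => chi x * cgrad psi x) =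
        A^-1 * (A * Int (fun x => chi x * cgrad psi x)) by rewrite mulKf// gt_eqF.
    congr (_ * _); move: h; lra.
  move=> x Ox; have eqn := psi_eqn sol Ox.
  rewrite (eq_bigr (fun i => chi x * partial i (partial i psi) x +
     partial i chi x * partial i psi x)).
    rewrite big_split/= -mulr_sumr -/(dd x) /cgrad; congr (_ + _).
    set a := \sum_i _ in eqn *; set b := \sum_i _ in eqn *.
    have -> : a = A * b - 1 by move: eqn; lra.
    ring.
  move=> i _; have d1 := Ck_isderive (ck 1%N) i Ox.
  have d2 := Ck_isderive (Ck_partial (psi_Ck sol 2) i) i Ox.
  have [_] := is_deriveM d1 d2.
  rewrite /partial => dE; apply: (etrans dE); rewrite /GRing.scale/=; ring.
rewrite Int_cgrad_anti//; last by move=> k; exact: (psi_Ck sol k).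
rewrite normrN eqA normrM gtr0_norm ?invr_gt0// ler_pM2l ?invr_gt0//.
rewrite (le_trans (ler_normB _ _))// lerD//; first exact: Int_norm_le.
(* psi is at least 2 d on the compact support of chi, so that only the energy
   of psi in the region where the ramp is 1 occurs *)
have [d d0 dP] : exists2 d, 0 < d & forall x, Omega x -> psi x < 2 * d ->
    forall i, partial i chi x = 0.
  have [K [cK KO chi0]] := schi.
  have dchi0 x : Omega x -> ~ K x -> forall i, partial i chi x = 0.
    by move=> Ox Kx i; exact: (partial_off_compact oO cK chi0).
  have [K0|/set0P K0] := eqVneq K set0.
    by exists 1 => // x Ox _; apply: dchi0 => //; rewrite K0.
  have cpK : {within K, continuous psi}.
    apply: continuous_in_subspaceT => x; rewrite inE => Kx.
    exact: Ck_continuous (psi_Ck sol 0) _ (KO _ Kx).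
  have [z Kz zmin] := EVT_min_rV K0 cK cpK; rewrite inE in Kz.
  exists (psi z / 2); first by rewrite divr_gt0// (psi_gt0 oO bO sol)//; exact: KO.
  move=> x Ox; rewrite mulrC divfK// => px; apply: dchi0 => // Kx.
  by have := zmin x; rewrite inE => /(_ Kx); rewrite leNgt px.
have nr : bmeas (fun x => ramp d (psi x) * sqgrad psi x).
  apply: bmeasM; last exact: (sqgrad_bmeas oO bO sol).
  rewrite /ramp; under eq_fun do rewrite mulrC.
  by apply: bmeasZ; apply: bmeasB; exact: (excess_bmeas oO bO sol 0 _).
have ngc := sqgrad_test_bmeas tchi.
apply: (@le_trans _ _ (Int (fun x => 2^-1 * (sqgrad chi x + ramp d (psi x) * sqgrad psi x)))).
  apply: (le_trans (Int_norm_le oO bO ndd)); apply: Int_le => //.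
  - exact: bmeas_norm.
  - by apply: bmeasZ; exact: bmeasD.
  move=> x Ox; have [px|px] := ltP (psi x) (2 * d).
    rewrite /dd big1 ?normr0; last by move=> i _; rewrite (dP x Ox px) mul0r.
    rewrite mulr_ge0// addr_ge0 ?sqgrad_ge0// mulr_ge0 ?sqgrad_ge0//.
    exact: ramp_ge0.
  rewrite ramp_eq1// mul1r /sqgrad -big_split/= mulr_sumr (le_trans (ler_norm_sum _ _ _))//.
  apply: ler_sum => i _; rewrite ler_norml; set a := partial i chi x; set b := partial i psi x.
  have := sqr_ge0 (a + b); have := sqr_ge0 (a - b); rewrite sqrrB sqrrD => h1 h2.
  by apply/andP; split; lra.
rewrite IntZ//; last exact: bmeasD.
rewrite IntD// ler_pM2l// lerD2l.
exact: (bvp_energy oO bO c_smooth div_c sol d0).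
Qed.

Variable d : R.
Hypothesis d0 : 0 < d.

(** The test functions that stand for psi, up to an error of order d. *)
Definition approx := (fun x => trunc d (psi x)) \_ Omega.

Lemma approxE x : Omega x -> approx x = trunc d (psi x).
Proof. by move=> Ox; rewrite /approx patchE mem_set. Qed.

Lemma approx_test : test_function Omega approx.
Proof.
apply: csupp_test => //.
  by apply: (csupp_comp bO sol d0) => s sd; rewrite trunc_eq0// ltW.
by move=> k; apply: Ck_trunc => //; exact: (psi_Ck sol k).
Qed.

Lemma approx_bounds x : Omega x -> 0 <= approx x <= psi x /\ psi x - approx x <= 2 * d.
Proof.
move=> Ox; have p0 := psi_gt0 oO bO sol Ox; rewrite approxE//; split.
  exact: trunc_itv (ltW p0).
exact: trunc_close (ltW p0).
Qed.

Lemma approx_partial i x : Omega x ->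
  partial i approx x = dtrunc d (psi x) * partial i psi x.
Proof.
move=> Ox; rewrite (@partial_eq _ _ Omega approx (fun x => trunc d (psi x)))//.
  have [_] := is_derive_comp (Ck_isderive (psi_Ck sol 1) i Ox) (is_derive_trunc d (psi x)).
  by [].
by move=> y Oy; rewrite approxE.
Qed.

Let nappr : bmeas approx. Proof. exact: (test_bmeas approx_test). Qed.

Lemma approx_Int : Int psi - 2 * d * fine (mu Omega) <= Int approx.
Proof.
have npsi := psi_bmeas oO bO sol.
rewrite -Int_cst// -IntB//; last exact: bmeas_cst.
apply: Int_le => //; first by apply: bmeasB => //; exact: bmeas_cst.
by move=> x Ox; have [_] := approx_bounds Ox; lra.
Qed.

Lemma approx_Int_sqr : Int (fun x => approx x ^+ 2) <= Int (fun x => psi x ^+ 2).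
Proof.
have npsi := psi_bmeas oO bO sol.
apply: Int_le => //; try exact: bmeasX.
move=> x Ox; have [/andP[h1 h2] _] := approx_bounds Ox.
by rewrite lerXn2r// nnegrE// (le_trans h1).
Qed.

(** The chain rule and |trunc'| <= 4, with the energy bound in the region
    psi > d where the truncation is not constant. *)
Lemma approx_Int_sqgrad : Int (sqgrad approx) <= 16 * Int psi.
Proof.
have d2 : 0 < d / 2 by rewrite divr_gt0.
have nr : bmeas (fun x => ramp (d / 2) (psi x) * sqgrad psi x).
  apply: bmeasM; last exact: (sqgrad_bmeas oO bO sol).
  rewrite /ramp; under eq_fun do rewrite mulrC.
  by apply: bmeasZ; apply: bmeasB; exact: (excess_bmeas oO bO sol 0 _).
apply: (@le_trans _ _ (Int (fun x => 16 * (ramp (d / 2) (psi x) * sqgrad psi x)))).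
  apply: Int_le => //; [exact: (sqgrad_test_bmeas approx_test)|exact: bmeasZ|].
  move=> x Ox; have p0 := psi_gt0 oO bO sol Ox.
  have -> : sqgrad approx x = dtrunc d (psi x) ^+ 2 * sqgrad psi x.
    rewrite /sqgrad mulr_sumr; apply: eq_bigr => i _.
    by rewrite approx_partial// exprMn.
  have [pd|dp] := leP (psi x) d.
    rewrite /dtrunc !flat_le0E ?subr_le0 ?ler_pdivrMr ?mul1r// mulr0 addr0 expr0n/= mul0r.
    by rewrite mulr_ge0// mulr_ge0 ?sqgrad_ge0// ramp_ge0.
  rewrite ramp_eq1//; last by rewrite mulrC divfK// ltW.
  rewrite mul1r ler_wpM2r ?sqgrad_ge0// -(real_normK (num_real (dtrunc _ _))).
  have := dtrunc_bound d0 (ltW p0).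
  have : 0 <= `|dtrunc d (psi x)| by [].
  set t := `|_|; nra.
by rewrite IntZ// ler_pM2l//; exact: (bvp_energy oO bO c_smooth div_c sol d2).
Qed.

Lemma approx_pairing chi : test_function Omega chi ->
  `|Int (fun x => approx x * cgrad chi x)| <=
  A^-1 * (Int (fun x => `|chi x|) + 2^-1 * (Int (sqgrad chi) + Int psi)) +
  2 * d * Int (fun x => `|cgrad chi x|).
Proof.
move=> tchi; have npsi := psi_bmeas oO bO sol.
have nc : bmeas (cgrad chi) by apply: cgrad_bmeas => i; exact: test_partial_bmeas.
have -> : Int (fun x => approx x * cgrad chi x) =
    Int (fun x => psi x * cgrad chi x) - Int (fun x => (psi x - approx x) * cgrad chi x).
  rewrite -IntB//; try by apply: bmeasM => //; exact: bmeasB.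
  - by apply: Int_eq => x _; ring.
rewrite (le_trans (ler_normB _ _))// lerD//; first exact: psi_pairing.
have n1 : bmeas (fun x => (psi x - approx x) * cgrad chi x).
  by apply: bmeasM => //; exact: bmeasB.
rewrite (le_trans (Int_norm_le oO bO n1))// -IntZ//; last exact: bmeas_norm.
apply: Int_le => //; [exact: bmeas_norm|by apply: bmeasZ; exact: bmeas_norm|].
move=> x Ox; have [/andP[h1 h2] h3] := approx_bounds Ox.
by rewrite normrM ler_wpM2r// ger0_norm// subr_ge0.
Qed.

End with_solution.
End drift.
End approximants.

(** * L^2 calculus *)

Section l2_calculus.
Context {R : realType} {n : nat}.
Local Notation mu := (@lebesgue_rV R n).
Variable Omega : set 'rV[R]_n.
Hypothesis oO : open Omega.
Hypothesis bO : bounded_set Omega.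
Implicit Types u v f g : 'rV[R]_n -> R.
Implicit Types us vs : nat -> 'rV[R]_n -> R.
Local Notation Int f := (\int[mu]_(x in Omega) f x).
Local Notation bmeas := (bounded_meas Omega).
Local Notation L2 := (L2 Omega).

Let mO : measurable Omega := mOmega oO.

Lemma integrable_EFinD f g : mu.-integrable Omega (EFin \o f) ->
  mu.-integrable Omega (EFin \o g) ->
  mu.-integrable Omega (EFin \o (fun x => f x + g x)).
Proof.
move=> fi gi; rewrite (_ : _ \o _ = (EFin \o f) \+ (EFin \o g))%E.
  exact: integrableD.
by apply/funext => x.
Qed.

Lemma integrable_EFinZ (a : R) f : mu.-integrable Omega (EFin \o f) ->
  mu.-integrable Omega (EFin \o (fun x => a * f x)).
Proof.
move=> fi; rewrite (_ : _ \o _ = (fun x => a%:E * (EFin \o f) x)%E).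
  exact: integrableZl.
by apply/funext => x.
Qed.

Lemma L2_sqr_integrable u : L2 u -> mu.-integrable Omega (EFin \o (fun x => u x ^+ 2)).
Proof.
move=> [mu_ u2]; apply/integrableP; split.
  by apply/measurable_EFinP; exact: measurable_funX.
apply: le_lt_trans u2; rewrite le_eqVlt; apply/orP; left; apply/eqP.
by apply: eq_integral => x _ /=; rewrite ger0_norm// sqr_ge0.
Qed.

Lemma L2_mul_integrable u v : L2 u -> L2 v ->
  mu.-integrable Omega (EFin \o (fun x => u x * v x)).
Proof.
move=> Lu Lv; have i := integrable_EFinD (L2_sqr_integrable Lu) (L2_sqr_integrable Lv).
apply: (le_integrable mO _ _ i).
  by apply/measurable_EFinP; apply: measurable_funM; [case: Lu|case: Lv].
move=> x _ /=; rewrite lee_fin [leRHS]ger0_norm ?addr_ge0 ?sqr_ge0// ler_norml.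
have := sqr_ge0 (u x + v x); have := sqr_ge0 (u x - v x).
rewrite sqrrB sqrrD; have := sqr_ge0 (u x); have := sqr_ge0 (v x).
move=> *; apply/andP; split; lra.
Qed.

Lemma L2_sqnorm u : L2 u -> sqnormL2 Omega u = (Int (fun x => u x ^+ 2))%:E.
Proof.
move=> Lu; rewrite /Rintegral fineK//; apply: integrable_fin_num => //.
exact: L2_sqr_integrable.
Qed.

(** Domination of the square by an integrable function. *)
Lemma L2_intro u v : measurable_fun Omega u -> mu.-integrable Omega (EFin \o v) ->
  (forall x, Omega x -> u x ^+ 2 <= v x) -> L2 u.
Proof.
move=> mu_ iv uv; split=> //; rewrite /sqnormL2.
apply: (@le_lt_trans _ _ (\int[mu]_(x in Omega) `|(EFin \o v) x|)%E); last first.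
  by case/integrableP : iv.
apply: ge0_le_integral => //.
- by move=> x _; rewrite lee_fin sqr_ge0.
- by apply/measurable_EFinP; exact: measurable_funX.
- by apply: measurableT_comp => //; exact: measurable_int iv.
- by move=> x Ox; rewrite lee_fin (le_trans (uv x Ox))// ler_norm.
Qed.

Lemma bmeas_L2 u : bmeas u -> L2 u.
Proof.
move=> nu; apply: (@L2_intro u (fun x => u x ^+ 2)) => //; first by case: nu.
by apply: bmeas_integrable => //; exact: bmeasX.
Qed.

Lemma L2D u v : L2 u -> L2 v -> L2 (fun x => u x + v x).
Proof.
move=> Lu Lv; have iu := L2_sqr_integrable Lu; have iv := L2_sqr_integrable Lv.
apply: (@L2_intro _ (fun x => 2 * u x ^+ 2 + 2 * v x ^+ 2)).
- by apply: measurable_funD; [case: Lu|case: Lv].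
- exact: (integrable_EFinD (integrable_EFinZ 2 iu) (integrable_EFinZ 2 iv)).
- by move=> x _; have := sqr_ge0 (u x - v x); rewrite sqrrB sqrrD; lra.
Qed.

Lemma L2_bmeasM h u : bmeas h -> L2 u -> L2 (fun x => h x * u x).
Proof.
move=> [mh [B hB]] Lu; apply: (@L2_intro _ (fun x => B ^+ 2 * u x ^+ 2)).
- by apply: measurable_funM => //; case: Lu.
- exact: (integrable_EFinZ (B ^+ 2) (L2_sqr_integrable Lu)).
- move=> x Ox; rewrite exprMn ler_wpM2r ?sqr_ge0// -(real_normK (num_real (h x))).
  by rewrite lerXn2r ?nnegrE// ?hB// (le_trans _ (hB x Ox)).
Qed.

Lemma L2Z (c : R) u : L2 u -> L2 (fun x => c * u x).
Proof. by apply: L2_bmeasM; exact: bmeas_cst. Qed.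

Lemma L2B u v : L2 u -> L2 v -> L2 (fun x => u x - v x).
Proof.
move=> Lu Lv; rewrite (_ : (fun _ => _) = fun x => u x + -1 * v x).
  by apply: L2D => //; exact: L2Z.
by apply/funext => x; rewrite mulN1r.
Qed.

Lemma L2_sum (I : Type) (r : seq I) (F : I -> 'rV[R]_n -> R) :
  (forall i, L2 (F i)) -> L2 (fun x => \sum_(i <- r) F i x).
Proof.
move=> Fk; elim: r => [|i r IH].
  by under eq_fun do rewrite big_nil; apply: bmeas_L2; exact: bmeas_cst.
by under eq_fun do rewrite big_cons; exact: L2D.
Qed.

Lemma Int_mulBl u v w : L2 u -> L2 v -> L2 w ->
  Int (fun x => (u x - v x) * w x) = Int (fun x => u x * w x) - Int (fun x => v x * w x).
Proof.
move=> Lu Lv Lw; under eq_Rintegral do rewrite mulrBl.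
by rewrite RintegralB//; exact: L2_mul_integrable.
Qed.

Lemma Int_mulC u v : Int (fun x => u x * v x) = Int (fun x => v x * u x).
Proof. by apply: Int_eq => x _; rewrite mulrC. Qed.

Lemma Int_sum_mul (I : Type) (r : seq I) (F G : I -> 'rV[R]_n -> R) :
  (forall i, L2 (F i)) -> (forall i, L2 (G i)) ->
  Int (fun x => \sum_(i <- r) F i x * G i x) = \sum_(i <- r) Int (fun x => F i x * G i x).
Proof.
move=> LF LG; have LFG i := L2_mul_integrable (LF i) (LG i).
suff : mu.-integrable Omega (EFin \o (fun x => \sum_(i <- r) F i x * G i x)) /\
    Int (fun x => \sum_(i <- r) F i x * G i x) =
    \sum_(i <- r) Int (fun x => F i x * G i x) by case.
elim: r => [|i r [IHi IH]].
  rewrite big_nil; under eq_fun do rewrite big_nil.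
  split; last by rewrite Rintegral_cst// mul0r.
  by apply: bmeas_integrable => //; exact: bmeas_cst.
rewrite big_cons; under eq_fun do rewrite big_cons.
split; first exact: integrable_EFinD.
by rewrite RintegralD// IH.
Qed.

Lemma Int_sqrE u : Int (fun x => u x ^+ 2) = Int (fun x => u x * u x).
Proof. by apply: Int_eq => x _; rewrite expr2. Qed.

Lemma Int_sqr_ge0 u : 0 <= Int (fun x => u x ^+ 2).
Proof. by apply: Int_ge0 => x _; exact: sqr_ge0. Qed.

(** The integral of (u + t v)^2 is a nonnegative polynomial in t. *)
Lemma cauchy_schwarz u v : L2 u -> L2 v ->
  Int (fun x => u x * v x) ^+ 2 <= Int (fun x => u x ^+ 2) * Int (fun x => v x ^+ 2).
Proof.
move=> Lu Lv; set b := Int (fun x => u x * v x); set a := Int (fun x => u x ^+ 2).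
set c := Int (fun x => v x ^+ 2).
have q t : 0 <= a + 2 * t * b + t ^+ 2 * c.
  have iu := L2_sqr_integrable Lu; have iv := L2_sqr_integrable Lv.
  have iuv := L2_mul_integrable Lu Lv.
  have i1 := integrable_EFinZ (2 * t) iuv; have i2 := integrable_EFinZ (t ^+ 2) iv.
  have : 0 <= Int (fun x => (u x + t * v x) ^+ 2) by exact: Int_sqr_ge0.
  rewrite (@Int_eq _ _ _ _ (fun x => u x ^+ 2 + (2 * t) * (u x * v x) +
    t ^+ 2 * v x ^+ 2)); last by move=> x _; ring.
  rewrite (RintegralD mO (integrable_EFinD iu i1) i2) (RintegralD mO iu i1).
  by rewrite !RintegralZl.
have a0 : 0 <= a by exact: Int_sqr_ge0.
have : 0 <= c by exact: Int_sqr_ge0.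
rewrite le_eqVlt => /predU1P[c0|c0].
  have [->|b0] := eqVneq b 0; first by rewrite expr0n/= -c0 mulr0.
  have := q (- (a + 1) / (2 * b)); rewrite -c0 mulr0 addr0.
  have -> : a + 2 * (- (a + 1) / (2 * b)) * b = -1 by field.
  by move=> h; exfalso; move: h; lra.
have := q (- b / c).
have -> : a + 2 * (- b / c) * b + (- b / c) ^+ 2 * c = (a * c - b ^+ 2) / c.
  by field; rewrite gt_eqF.
by rewrite pmulr_lge0 ?invr_gt0// subr_ge0.
Qed.

Definition L2cvg us u :=
  (fun m => Int (fun x => (us m x - u x) ^+ 2)) @ \oo --> (0 : R).

Lemma cvg_sqr0 (x_ b_ : nat -> R) : (forall m, x_ m ^+ 2 <= b_ m) ->
  b_ @ \oo --> (0 : R) -> x_ @ \oo --> (0 : R).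
Proof.
move=> xb /cvgrPdist_lt b0; apply/cvgrPdist_lt => e e0.
have e20 : 0 < e ^+ 2 by rewrite exprn_gt0.
near=> m; rewrite sub0r normrN.
have : `|0 - b_ m| < e ^+ 2 by near: m; exact: b0.
rewrite sub0r normrN => /(le_lt_trans (ler_norm _)) /(le_lt_trans (xb m)).
by rewrite -(real_normK (num_real (x_ m))) ltr_pXn2r// nnegrE// ltW.
Unshelve. all: by end_near. Qed.

(** The product minus its limit is (u_m - u) v + (v_m - v) u +
    (u_m - u) (v_m - v); Cauchy-Schwarz for each term. *)
Lemma L2cvg_mul us u vs v : (forall m, L2 (us m)) -> (forall m, L2 (vs m)) ->
  L2 u -> L2 v -> L2cvg us u -> L2cvg vs v ->
  (fun m => Int (fun x => us m x * vs m x)) @ \oo --> Int (fun x => u x * v x).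
Proof.
move=> Lu_ Lv_ Lu Lv uu vv.
have Ldu m := L2B (Lu_ m) Lu; have Ldv m := L2B (Lv_ m) Lv.
have t1 : (fun m => Int (fun x => (us m x - u x) * v x)) @ \oo --> (0 : R).
  apply: (cvg_sqr0 (fun m => cauchy_schwarz (Ldu m) Lv)).
  by rewrite -[X in _ --> X](mul0r (Int (fun x => v x ^+ 2))); apply: cvgMl.
have t2 : (fun m => Int (fun x => (vs m x - v x) * u x)) @ \oo --> (0 : R).
  apply: (cvg_sqr0 (fun m => cauchy_schwarz (Ldv m) Lu)).
  by rewrite -[X in _ --> X](mul0r (Int (fun x => u x ^+ 2))); apply: cvgMl.
have t3 : (fun m => Int (fun x => (us m x - u x) * (vs m x - v x))) @ \oo --> (0 : R).
  apply: (cvg_sqr0 (fun m => cauchy_schwarz (Ldu m) (Ldv m))).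
  by rewrite -[X in _ --> X](mul0r (0 : R)); exact: cvgM.
rewrite (_ : (fun m => _) = (fun m => Int (fun x => (us m x - u x) * v x) +
   Int (fun x => (vs m x - v x) * u x) +
   Int (fun x => (us m x - u x) * (vs m x - v x)) + Int (fun x => u x * v x))).
  rewrite -[X in _ --> X]add0r -[X in _ --> X + _]add0r -[X in _ --> X + _ + _]add0r.
  apply: cvgD; last exact: cvg_cst.
  by apply: cvgD => //; exact: cvgD.
apply/funext => m.
rewrite (Int_mulC _ (fun x => vs m x - v x)) !Int_mulBl//.
rewrite (Int_mulC v (fun x => us m x - u x)) (Int_mulC (vs m) (fun x => us m x - u x)).
rewrite !Int_mulBl// (Int_mulC (vs m) u) (Int_mulC v u); ring.
Qed.

Lemma L2cvg_cst u : L2cvg (fun=> u) u.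
Proof.
rewrite /L2cvg (_ : (fun _ => _) = fun=> 0); first exact: cvg_cst.
apply/funext => m; under eq_Rintegral do rewrite subrr expr0n.
by rewrite Rintegral_cst// mul0r.
Qed.

Lemma L2cvg_pair us u v : (forall m, L2 (us m)) -> L2 u -> L2 v -> L2cvg us u ->
  (fun m => Int (fun x => us m x * v x)) @ \oo --> Int (fun x => u x * v x).
Proof.
by move=> Lu_ Lu Lv uu; apply: (@L2cvg_mul us u (fun=> v) v) => //; exact: L2cvg_cst.
Qed.

Lemma L2cvgD us u vs v : (forall m, L2 (us m)) -> (forall m, L2 (vs m)) ->
  L2 u -> L2 v -> L2cvg us u -> L2cvg vs v ->
  L2cvg (fun m x => us m x + vs m x) (fun x => u x + v x).
Proof.
move=> Lu_ Lv_ Lu Lv uu vv.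
have Ldu m := L2B (Lu_ m) Lu; have Ldv m := L2B (Lv_ m) Lv.
have key : (fun m => 2 * Int (fun x => (us m x - u x) ^+ 2) +
    2 * Int (fun x => (vs m x - v x) ^+ 2)) @ \oo --> (0 : R).
  rewrite -[X in _ --> X](addr0 (0 : R)) -[X in _ --> X + _](mulr0 (2 : R)).
  rewrite -[X in _ --> _ + X](mulr0 (2 : R)).
  by apply: cvgD; apply: cvgM => //; exact: cvg_cst.
apply: (squeeze_cvgr _ (cvg_cst (0 : R)) key); near=> m.
rewrite Int_sqr_ge0/= -!RintegralZl//; try exact: L2_sqr_integrable.
rewrite -RintegralD//; last 2 first.
- exact: (integrable_EFinZ 2 (L2_sqr_integrable (Ldu m))).
- exact: (integrable_EFinZ 2 (L2_sqr_integrable (Ldv m))).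
apply: le_Rintegral => //.
- by apply: L2_sqr_integrable; apply: L2B; exact: L2D.
- apply: integrable_EFinD.
    exact: (integrable_EFinZ 2 (L2_sqr_integrable (Ldu m))).
  exact: (integrable_EFinZ 2 (L2_sqr_integrable (Ldv m))).
move=> x _; set a := us m x; set b := u x; set c := vs m x; set d := v x.
have := sqr_ge0 ((a - b) - (c - d)); rewrite -subr_ge0 => h.
rewrite -subr_ge0 [leRHS](_ : _ = (a - b - (c - d)) ^+ 2) ?sqr_ge0//; ring.
Unshelve. all: by end_near. Qed.

Lemma L2cvg_bmeasM h us u : bmeas h -> (forall m, L2 (us m)) -> L2 u ->
  L2cvg us u -> L2cvg (fun m x => h x * us m x) (fun x => h x * u x).
Proof.
move=> [mh [B hB]] Lu_ Lu uu.
have nh : bmeas h by split=> //; exists B.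
have Ldu m := L2B (Lu_ m) Lu.
have key : (fun m => B ^+ 2 * Int (fun x => (us m x - u x) ^+ 2)) @ \oo --> (0 : R).
  by rewrite -[X in _ --> X](mulr0 (B ^+ 2)); apply: cvgM => //; exact: cvg_cst.
apply: (squeeze_cvgr _ (cvg_cst (0 : R)) key); near=> m.
rewrite Int_sqr_ge0/= -!RintegralZl//; try exact: L2_sqr_integrable.
apply: le_Rintegral => //.
- by apply: L2_sqr_integrable; apply: L2B; exact: L2_bmeasM.
- exact: (integrable_EFinZ _ (L2_sqr_integrable (Ldu m))).
move=> x Ox; rewrite -mulrBr exprMn ler_wpM2r ?sqr_ge0//.
rewrite -(real_normK (num_real (h x))).
by rewrite lerXn2r ?nnegrE// ?hB// (le_trans _ (hB x Ox)).
Unshelve. all: by end_near. Qed.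

Lemma L2cvg_sum (I : Type) (r : seq I) (F_ : nat -> I -> 'rV[R]_n -> R) F :
  (forall m i, L2 (F_ m i)) -> (forall i, L2 (F i)) ->
  (forall i, L2cvg (fun m => F_ m i) (F i)) ->
  L2cvg (fun m x => \sum_(i <- r) F_ m i x) (fun x => \sum_(i <- r) F i x).
Proof.
move=> LF_ LF FF; elim: r => [|i r IH].
  rewrite (_ : (fun m x => _) = fun=> fun=> 0); last first.
    by apply/funext => m; apply/funext => x; rewrite big_nil.
  rewrite (_ : (fun x => \sum_(i <- [::]) F i x) = fun=> 0); last first.
    by apply/funext => x; rewrite big_nil.
  exact: L2cvg_cst.
rewrite (_ : (fun m x => _) = fun m x => F_ m i x + \sum_(i <- r) F_ m i x); last first.
  by apply/funext => m; apply/funext => x; rewrite big_cons.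
rewrite (_ : (fun x => \sum_(j <- i :: r) F j x) =
    fun x => F i x + \sum_(j <- r) F j x); last first.
  by apply/funext => x; rewrite big_cons.
apply: L2cvgD => //; [by move=> m; exact: L2_sum|exact: L2_sum].
Qed.

Lemma Int_sqr_eq0 u : L2 u -> Int (fun x => u x ^+ 2) = 0 -> ae_zero Omega u.
Proof.
move=> Lu u0; have [mu_ _] := Lu.
have : (\int[mu]_(x in Omega) `|(u x ^+ 2)%:E| = 0)%E.
  transitivity (sqnormL2 Omega u); last by rewrite L2_sqnorm// u0.
  by apply: eq_integral => x _; rewrite gee0_abs// lee_fin sqr_ge0.
have mu2 : measurable_fun Omega (fun x => (u x ^+ 2)%:E).
  by apply/measurable_EFinP; exact: measurable_funX.
move/(ae_eq_integral_abs mu mO mu2); apply: filterS => x /= + Ox => /(_ Ox) [].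
by move=> /eqP; rewrite sqrf_eq0 => /eqP.
Qed.

End l2_calculus.

(** * Nearly minimal elements of nested convex sets *)

(** This takes the part of weak compactness in H^1. The infima d_i of q over
    C_i increase and are bounded, hence converge. If x in C_i and y in C_j,
    i <= j, nearly minimize q, their midpoint is in C_i and so q of it is at
    least d_i: by the parallelogram identity q (x - y) is small. *)
Section nested_convex.
Context {R : realType} {E : lmodType R}.
Variables (q : E -> R) (C : nat -> set E) (Q : R).
Hypothesis q_ge0 : forall x, 0 <= q x.
Hypothesis C_nested : forall i j, (i <= j)%N -> C j `<=` C i.
Hypothesis C_mid : forall i x y, C i x -> C i y -> C i (2^-1 *: (x + y)).
Hypothesis C_bounded : forall i, exists2 x, C i x & q x <= Q.
Hypothesis parallelogram : forall x y, C 0%N x -> C 0%N y ->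
  q (x - y) = 2 * q x + 2 * q y - 4 * q (2^-1 *: (x + y)).

Lemma nested_convex_cauchy : exists y : nat -> E, (forall i, C i (y i)) /\
  forall e, 0 < e -> exists N, forall i j, (N <= i)%N -> (N <= j)%N ->
    q (y i - y j) <= e.
Proof.
pose d i := inf (q @` C i).
have hi i : has_inf (q @` C i).
  split; first by have [x Cx _] := C_bounded i; exists (q x), x.
  by exists 0 => _ [x _ <-].
have dlb i x : C i x -> d i <= q x.
  by move=> Cx; apply: (ge_inf (hi i).2); exists x.
have dQ i : d i <= Q.
  by have [x Cx xQ] := C_bounded i; exact: le_trans (dlb _ _ Cx) xQ.
have dmono i j : (i <= j)%N -> d i <= d j.
  move=> ij; apply: lb_le_inf; first exact: (hi j).1.
  by move=> _ [x Cx <-]; apply: dlb; exact: C_nested Cx.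
have /choice[y yP] i : exists x, C i x /\ q x < d i + i.+1%:R^-1.
  have ei : 0 < i.+1%:R^-1 :> R by rewrite invr_gt0.
  have [_ [x Cx <-] xd] := inf_adherent ei (hi i).
  by exists x.
exists y; split=> [i|e e0]; first by have [] := yP i.
pose D := sup (range d).
have hD : has_sup (range d).
  by split; [exists (d 0%N), 0%N|exists Q => _ [i _ <-]].
have dD i : d i <= D by apply: (ub_le_sup hD.2); exists i.
have e8 : 0 < e / 8 by rewrite divr_gt0.
have [_ [N1 _ <-] DN] := sup_adherent e8 hD; rewrite -/D in DN.
pose N2 := Num.Def.truncn (8 / e).
have invN i : (N2 <= i)%N -> i.+1%:R^-1 <= e / 8 :> R.
  move=> Ni; rewrite -[leRHS]invrK invf_div lef_pV2 ?posrE ?divr_gt0//.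
  by rewrite (le_trans (ltW (truncnS_gt _)))// ler_nat.
exists (maxn N1 N2).
suff W i j : (maxn N1 N2 <= i)%N -> (i <= j)%N -> q (y i - y j) <= e /\ q (y j - y i) <= e.
  move=> i j Ni Nj; have [ij|/ltnW ji] := leqP i j.
    exact: (W i j Ni ij).1.
  exact: (W j i Nj ji).2.
move=> Ni ij.
have N1i : (N1 <= i)%N by rewrite (leq_trans _ Ni)// leq_maxl.
have N2i : (N2 <= i)%N by rewrite (leq_trans _ Ni)// leq_maxr.
have [Ci qi] := yP i; have [Cj qj] := yP j.
have Cj' := C_nested ij Cj.
have m1 := dlb _ _ (C_mid Ci Cj'); have m2 := dlb _ _ (C_mid Cj' Ci).
rewrite (parallelogram (C_nested (leq0n _) Ci) (C_nested (leq0n _) Cj)).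
rewrite (parallelogram (C_nested (leq0n _) Cj) (C_nested (leq0n _) Ci)).
have := invN i N2i; have := invN j (leq_trans N2i ij).
have := dmono _ _ N1i; have := dmono _ _ ij; have := dD j; have := dD i.
move=> h1 h2 h3 h4 h5 h6.
have arith (a b m di dj DD dn ri rj : R) : DD - e / 8 < dn -> dj <= DD ->
    dn <= di -> ri <= e / 8 -> rj <= e / 8 -> a < di + ri -> b < dj + rj ->
    di <= m -> 2 * a + 2 * b - 4 * m <= e.
  by lra.
have key m := arith _ _ m _ _ _ _ _ _ DN h2 h4 h6 h5 qi qj.
split; first exact: key.
by rewrite [X in X - _]addrC; exact: key.
Qed.

End nested_convex.

(** * Completeness of L^2 *)

(** The Riesz-Fischer theorem. Along a subsequence with
    dist (f_k, f_k+1) <= 8^-k / 2, the sum of the 4^k (f_k+1 - f_k)^2 is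
    integrable, hence finite almost everywhere; where it is finite the
    subsequence converges, and Fatou's lemma bounds the distance to the limit. *)
Section l2_complete.
Context {R : realType} d (T : measurableType d).
Variables (mu : {measure set T -> \bar R}) (D : set T) (mD : measurable D).
Variable f : nat -> T -> R.
Hypothesis mf : forall i, measurable_fun D (f i).
Local Notation dist u v := (\int[mu]_(x in D) ((u x - v x) ^+ 2)%:E)%E.
Hypothesis cauchy_f : forall e : R, 0 < e -> exists N, forall i j,
  (N <= i)%N -> (N <= j)%N -> (dist (f i) (f j) <= e%:E)%E.

(** The increments are dominated by the geometric series (1 + S) / 2^k. *)
Lemma fast_cauchy_cvg (u : nat -> R) (S : R) : 0 <= S ->
  (forall k, 4 ^+ k * (u k.+1 - u k) ^+ 2 <= S) -> cvgn u.
Proof.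
move=> S0 uS.
have inc k : `|u k.+1 - u k| <= geometric (1 + S) 2^-1 k.
  have p0 : 0 < (2 : R) ^+ k by rewrite exprn_gt0.
  rewrite /geometric /= exprVn ler_pdivlMr//.
  rewrite -[leLHS]ger0_norm ?mulr_ge0 ?(ltW p0)// -(ler_pXn2r (n := 2))// ?nnegrE ?addr_ge0//.
  rewrite real_normK ?num_real// exprMn real_normK ?num_real// -exprM mulnC exprM.
  have -> : (2 : R) ^+ 2 = 4 by ring.
  rewrite mulrC (le_trans (uS k))// sqrrD expr1n mul1r.
  have : 0 <= S ^+ 2 by exact: sqr_ge0.
  lra.
have h2 : `|2^-1 : R| < 1 by rewrite ger0_norm ?invr_ge0// invf_lt1// ltr1n.
have cv : cvgn (series (telescope u)).
  apply: normed_cvg.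
  apply: (series_le_cvg _ _ inc (@is_cvg_geometric_series R (1 + S) 2^-1 h2)) => k.
    exact: normr_ge0.
  by rewrite geometric_ge0// ?addr_ge0.
rewrite (_ : u = fun k => u 0%N + series (telescope u) k).
  by apply: is_cvgD => //; exact: is_cvg_cst.
by apply/funext => k; exact: eq_sum_telescope.
Qed.

Lemma l2_complete : exists2 g : T -> R, measurable_fun D g &
  forall e : R, 0 < e -> exists N, forall i, (N <= i)%N -> (dist g (f i) <= e%:E)%E.
Proof.
have /choice[N NP] (k : nat) : exists N, forall i j, (N <= i)%N -> (N <= j)%N ->
    (dist (f i) (f j) <= (1 / (4 ^+ k * (2 ^ (k + 1))%:R))%:E)%E.
  by apply: cauchy_f; rewrite divr_gt0// mulr_gt0// ?exprn_gt0// ltr0n expn_gt0.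
pose phi k := (\sum_(j < k.+1) (N j).+1)%N.
have phi_le k : (phi k <= phi k.+1)%N.
  by rewrite /phi [leqRHS]big_ord_recr/= leq_addr.
have Nphi k : (N k <= phi k)%N.
  by rewrite /phi big_ord_recr/= (leq_trans (leqnSn _))// leq_addl.
have kphi k : (k <= phi k)%N.
  elim: k => [//|k IH]; rewrite /phi big_ord_recr/= -/(phi k).
  by rewrite -addn1 leq_add.
have phi_mono i j : (i <= j)%N -> (phi i <= phi j)%N.
  elim: j => [|j IH]; first by rewrite leqn0 => /eqP ->.
  by rewrite leq_eqVlt => /predU1P[->//|/IH ij]; exact: leq_trans (phi_le _).
pose h k := f (phi k).
pose a k x : \bar R := (4 ^+ k * (h k.+1 x - h k x) ^+ 2)%:E.
have a0 k x : (0 <= a k x)%E by rewrite lee_fin mulr_ge0 ?sqr_ge0// exprn_ge0.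
have mh k : measurable_fun D (h k) by exact: mf.
have ma k : measurable_fun D (a k).
  apply/measurable_EFinP; apply: measurable_funM => //.
  by apply: measurable_funX; exact: measurable_funB.
pose S x := (\sum_(k <oo) a k x)%E.
have S0 x : (0 <= S x)%E by apply: nneseries_ge0 => k _ _; exact: a0.
have mS : measurable_fun D S by exact: ge0_emeasurable_sum.
have intS : (\int[mu]_(x in D) S x < +oo)%E.
  rewrite integral_nneseries//.
  apply: (@le_lt_trans _ _ (\sum_(k <oo) (1 / (2 ^ (k + 1))%:R)%:E)%E).
    apply: lee_nneseries => k _; first by move=> _; exact: integral_ge0.
    rewrite /a; under eq_integral do rewrite EFinM.
    have msq : measurable_fun D (fun x => ((h k.+1 x - h k x) ^+ 2)%:E).
      by apply/measurable_EFinP; apply: measurable_funX; exact: measurable_funB.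
    have p4 : (0 <= (4 ^+ k)%:E :> \bar R)%E by rewrite lee_fin exprn_ge0.
    rewrite (ge0_integralZl mu mD msq _ p4); last by move=> x _; rewrite lee_fin sqr_ge0.
    have := NP k (phi k.+1) (phi k) (leq_trans (Nphi k) (phi_le k)) (Nphi k).
    move=> /(lee_wpmul2l p4)/le_trans; apply.
    rewrite -EFinM lee_fin le_eqVlt; apply/orP; left; apply/eqP.
    by field; rewrite !gt_eqF ?exprn_gt0 ?ltr0n ?expn_gt0.
  rewrite (cvg_lim _ (@cvg_geometric_eseries_half R 1 0))//.
  by rewrite ltry.
pose G := D `&` [set x | (S x < +oo)%E].
have mG : measurable G by exact: emeasurable_fun_infty_o.
pose g_ k x := h k x * \1_G x.
have cvg_g x : D x -> cvgn (g_ ^~ x).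
  move=> Dx; have [Gx|nGx] := pselect (G x); last first.
    rewrite (_ : g_ ^~ x = fun=> 0); first exact: is_cvg_cst.
    by apply/funext => k; rewrite /g_ indicE memNset// mulr0.
  rewrite (_ : g_ ^~ x = h ^~ x); last first.
    by apply/funext => k; rewrite /g_ indicE mem_set// mulr1.
  have Sfin : S x \is a fin_num by rewrite ge0_fin_numE//; case: Gx.
  apply: (@fast_cauchy_cvg _ (fine (S x))); first exact: fine_ge0.
  move=> k; rewrite -lee_fin fineK//.
  apply: le_trans (nneseries_lim_ge k.+1 (fun n _ _ => a0 n x)).
  by rewrite big_nat_recr//= leeDr// sume_ge0.
pose g x := limn (g_ ^~ x).
have mg_ k : measurable_fun D (g_ k).
  by apply: measurable_funM => //; exact: measurable_indic.
have mg : measurable_fun D g by apply: (measurable_fun_cvg mg_) => x /cvg_g.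
have aeG : {ae mu, forall x, D x -> G x}.
  have iS : mu.-integrable D S.
    apply/integrableP; split => //; apply: le_lt_trans intS.
    rewrite le_eqVlt; apply/orP; left; apply/eqP.
    by apply: eq_integral => x _; rewrite gee0_abs.
  have := integrable_ae mD iS; apply: filterS => x /= SD Dx; split => //.
  by rewrite /= -ge0_fin_numE// SD.
have dist_g k i : (dist (g_ k) (f i) = dist (h k) (f i))%E.
  apply: ae_eq_integral => //.
  - by apply/measurable_EFinP; apply: measurable_funX; exact: measurable_funB.
  - by apply/measurable_EFinP; apply: measurable_funX; exact: measurable_funB.
  - move: aeG; apply: filterS => x /= DG Dx; rewrite /g_ indicE mem_set ?mulr1//.
    exact: DG.
exists g => // e e0; have [M MP] := cauchy_f e0; exists M => i Mi.
apply: (@le_trans _ _ (limn_einf (fun k => dist (g_ k) (f i)))).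
  apply: le_trans (fatou mu mD _ _); last 2 first.
  - by move=> k; apply/measurable_EFinP; apply: measurable_funX; exact: measurable_funB.
  - by move=> k x _; rewrite lee_fin sqr_ge0.
  rewrite le_eqVlt; apply/orP; left; apply/eqP; apply: eq_integral => x.
  rewrite inE => Dx; apply/esym/(cvg_limn_einf_sup _).1.
  apply: cvg_EFin; first exact: nearW.
  have gx : g_ ^~ x @ \oo --> g x by exact: cvg_g.
  have gd : (fun k => g_ k x - f i x) @ \oo --> g x - f i x.
    by apply: cvgB => //; exact: cvg_cst.
  by rewrite /= expr2; under eq_fun do rewrite expr2; exact: cvgM.
rewrite limn_einf_lim; apply: lime_le; first exact: is_cvg_einfs.
near=> k; apply: (@le_trans _ _ (dist (g_ k) (f i))).
  by apply: ereal_inf_lbound; exists k => //=.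
rewrite dist_g; apply: MP => //.
by rewrite (leq_trans _ (kphi k))//; near: k; exact: nbhs_infty_ge.
Unshelve. all: by end_near. Qed.

End l2_complete.

(** * Construction of a first integral *)

Section construct.
Context {R : realType} {n : nat}.
Local Notation mu := (@lebesgue_rV R n).
Variable Omega : set 'rV[R]_n.
Hypothesis oO : open Omega.
Hypothesis bO : bounded_set Omega.
Local Notation Int f := (\int[mu]_(x in Omega) f x).
Local Notation bmeas := (bounded_meas Omega).
Local Notation L2 := (L2 Omega).

Lemma l2_limit (f_ : nat -> 'rV[R]_n -> R) : (forall m, bmeas (f_ m)) ->
  (forall e, 0 < e -> exists N, forall i j, (N <= i)%N -> (N <= j)%N ->
    Int (fun x => (f_ i x - f_ j x) ^+ 2) <= e) ->
  exists2 g, L2 g & L2cvg Omega f_ g.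
Proof.
move=> nf fc.
have mf i : measurable_fun Omega (f_ i) by case: (nf i).
have [|g mg gP] := @l2_complete R _ _ mu Omega (mOmega oO) f_ mf.
  move=> e e0; have [N NP] := fc e e0; exists N => i j Ni Nj.
  by rewrite -Int_EFin ?lee_fin; [exact: NP| | |apply: bmeasX; exact: bmeasB].
have Lg : L2 g.
  have [N NP] := gP 1 ltr01.
  have : L2 (fun x => (g x - f_ N x) + f_ N x).
    apply: L2D => //; last exact: bmeas_L2.
    split; first exact: measurable_funB.
    by apply: le_lt_trans (NP N (leqnn _)) _; rewrite ltry.
  by congr L2; apply/funext => x; rewrite subrK.
exists g => //; apply/cvgrPdist_le => e e0.
have [N NP] := gP e e0; near=> m.
rewrite sub0r normrN ger0_norm ?Int_sqr_ge0//.
have := NP m; rewrite (_ : (\int[mu]_(x in Omega) _)%E =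
    (Int (fun x => (f_ m x - g x) ^+ 2))%:E).
  by rewrite lee_fin; apply; near: m; exact: nbhs_infty_ge.
rewrite -(L2_sqnorm oO (L2B oO (bmeas_L2 oO bO (nf m)) Lg)) /sqnormL2.
by apply: eq_integral => x _; congr EFin; ring.
Unshelve. all: by end_near. Qed.

Lemma test_patch f : test_function Omega f -> f \_ Omega = f.
Proof.
move=> [_ _ fO]; apply/funext => x; rewrite patchE; case: ifPn => //.
rewrite notin_setE => Ox; apply/esym/eqP; apply: contrapT => /negP fx.
by apply: Ox; apply: fO; exact: subset_closure.
Qed.

Lemma test_lin (a b : R) f g : test_function Omega f -> test_function Omega g ->
  test_function Omega (fun x => a * f x + b * g x).
Proof.
move=> tf tg; rewrite -(_ : (fun x => a * f x + b * g x) \_ Omega =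
    fun x => a * f x + b * g x); last first.
  apply/funext => x; have fx := congr1 (@^~ x) (test_patch tf).
  have gx := congr1 (@^~ x) (test_patch tg).
  move: fx gx; rewrite /= !patchE; case: ifPn => // _ <- <-.
  by rewrite !mulr0 addr0.
apply: csupp_test => //.
  by apply: csuppD; apply: csuppMr; exact: test_csupp.
by move=> k; apply: CkD => //; apply: CkZ => //; exact: test_Ck.
Qed.

Lemma partial_lin (a b : R) f g i x : test_function Omega f -> test_function Omega g ->
  Omega x -> partial i (fun x => a * f x + b * g x) x =
  a * partial i f x + b * partial i g x.
Proof.
move=> tf tg Ox.
have d1 := Ck_isderive (test_Ck 1 tf) i Ox; have d2 := Ck_isderive (test_Ck 1 tg) i Ox.
by have [_] := is_deriveD (is_deriveZ a d1) (is_deriveZ b d2).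
Qed.

(** The codomain R^o makes the functions a module over R, as
    [nested_convex_cauchy] requires. *)
Definition sqh1norm (f : 'rV[R]_n -> R^o) : R := Int (fun x => f x ^+ 2) + Int (sqgrad f).

Lemma sqh1norm_ge0 f : 0 <= sqh1norm f.
Proof. by rewrite addr_ge0 ?Int_sqr_ge0//; apply: Int_ge0 => x _; exact: sqgrad_ge0. Qed.

Lemma sqh1norm_parallelogram (f g : 'rV[R]_n -> R^o) :
  test_function Omega f -> test_function Omega g ->
  sqh1norm (f - g) = 2 * sqh1norm f + 2 * sqh1norm g - 4 * sqh1norm (2^-1 *: (f + g)).
Proof.
move=> tf tg.
have subE : f - g = (fun x => 1 * f x + (-1) * g x).
  by apply/funext => x; rewrite mul1r mulN1r.
have midE : 2^-1 *: (f + g) = (fun x => 2^-1 * f x + 2^-1 * g x).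
  by apply/funext => x; rewrite -mulrDr.
rewrite subE midE.
have nf := test_bmeas oO tf; have ng := test_bmeas oO tg.
have nm := test_bmeas oO (test_lin 2^-1 2^-1 tf tg).
have gf := sqgrad_test_bmeas oO tf; have gg := sqgrad_test_bmeas oO tg.
have gm := sqgrad_test_bmeas oO (test_lin 2^-1 2^-1 tf tg).
have e1 : Int (fun x => (1 * f x + -1 * g x) ^+ 2) =
    2 * Int (fun x => f x ^+ 2) + 2 * Int (fun x => g x ^+ 2) -
    4 * Int (fun x => (2^-1 * f x + 2^-1 * g x) ^+ 2).
  have n1 := bmeasX 2 nf; have n2 := bmeasX 2 ng; have n3 := bmeasX 2 nm.
  rewrite -!IntZ// -IntD; [|exact: oO|exact: bO|exact: bmeasZ|exact: bmeasZ].
  rewrite -IntB; [|exact: oO|exact: bO| |exact: bmeasZ]; last first.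
    by apply: bmeasD; exact: bmeasZ.
  by apply: Int_eq => x _; field.
have e2 : Int (sqgrad (fun x => 1 * f x + -1 * g x)) =
    2 * Int (sqgrad f) + 2 * Int (sqgrad g) - 4 * Int (sqgrad (fun x => 2^-1 * f x + 2^-1 * g x)).
  have bf := bmeasZ 2 gf; have bg := bmeasZ 2 gg; have bm := bmeasZ 4 gm.
  rewrite -(IntZ oO bO 2 gf) -(IntZ oO bO 2 gg) -(IntZ oO bO 4 gm).
  rewrite -(IntD oO bO bf bg) -(IntB oO bO (bmeasD bf bg) bm).
  apply: Int_eq => x Ox; rewrite /sqgrad !mulr_sumr -big_split -sumrB/=.
  by apply: eq_bigr => i _; rewrite !partial_lin//; field.
have arith (a b a' b' a'' b'' : R) : 2 * a + 2 * b - 4 * a' + (2 * b' + 2 * a'' - 4 * b'') =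
    2 * (a + b') + 2 * (b + a'') - 4 * (a' + b'') by ring.
by rewrite /sqh1norm e1 e2 arith.
Qed.

Variables (c : 'rV[R]_n -> 'rV[R]_n).
Hypothesis c_smooth : smooth_vector_field Omega c.
Hypothesis div_c : incompressible Omega c.
Variable psi : R -> 'rV[R]_n -> R.
Hypothesis psi_sol : forall A : R, 0 < A -> solves_bvp Omega c A (psi A).

(** If the integrals of psi_A do not tend to 0, then for every m there are
    test functions that are bounded in H^1, have integral at least eps and pair
    with every c . grad chi to at most p(chi) / (m + 1): the truncations of
    psi_A with A large. These conditions define nested convex sets; a sequence
    of nearly minimal elements converges strongly in H^1. *)
Lemma persistent_cauchy (eps : R) : (0 < n)%N -> 0 < eps ->
  (forall A0, exists2 A, A0 <= A & 0 < A /\ 2 * eps <= Int (psi A)) ->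
  exists y : nat -> 'rV[R]_n -> R, [/\
    forall m, test_function Omega (y m),
    forall m, eps <= Int (y m),
    forall chi, test_function Omega chi ->
      (fun m => Int (fun x => y m x * cgrad c chi x)) @ \oo --> (0 : R) &
    forall e, 0 < e -> exists N, forall i j, (N <= i)%N -> (N <= j)%N ->
      sqh1norm (fun x => y i x - y j x) <= e].
Proof.
move=> n0 eps0 psi_large.
have [B B0 BP] := uniform_integral_bound oO bO n0.
pose p chi := Int (fun x => `|chi x|) + 2^-1 * (Int (sqgrad chi) + B) +
  Int (fun x => `|cgrad c chi x|).
have p0 chi : 0 <= p chi.
  rewrite addr_ge0//; last by apply: Int_ge0.
  rewrite addr_ge0//; first by apply: Int_ge0.
  by rewrite mulr_ge0// addr_ge0//; apply: Int_ge0 => x _; exact: sqgrad_ge0.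
pose C m : set ('rV[R]_n -> R^o) := [set f | [/\ test_function Omega f,
  eps <= Int f & forall chi, test_function Omega chi ->
    `|Int (fun x => f x * cgrad c chi x)| <= m.+1%:R^-1 * p chi]].
have C_nested i j : (i <= j)%N -> C j `<=` C i.
  move=> ij f [tf ef cf]; split=> // chi tchi; rewrite (le_trans (cf chi tchi))//.
  by rewrite ler_wpM2r// lef_pV2 ?posrE// ler_nat.
have C_mid i f g : C i f -> C i g -> C i (2^-1 *: (f + g)).
  move=> [tf ef cf] [tg eg cg].
  have midE : 2^-1 *: (f + g) = (fun x => 2^-1 * f x + 2^-1 * g x).
    by apply/funext => x; rewrite -mulrDr.
  have nf := test_bmeas oO tf; have ng := test_bmeas oO tg.
  rewrite midE; split; first exact: test_lin.
    rewrite IntD; [|exact: oO|exact: bO|exact: bmeasZ|exact: bmeasZ].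
    rewrite !IntZ//; lra.
  move=> chi tchi; have nc : bmeas (cgrad c chi).
    by apply: (cgrad_bmeas oO bO c_smooth) => j; exact: test_partial_bmeas.
  rewrite (@Int_eq _ _ _ _ (fun x => 2^-1 * (f x * cgrad c chi x) +
    2^-1 * (g x * cgrad c chi x))); last by move=> x _; ring.
  have nfc := bmeasM nf nc; have ngc := bmeasM ng nc.
  rewrite IntD; [|exact: oO|exact: bO|exact: bmeasZ|exact: bmeasZ].
  rewrite !IntZ// (le_trans (ler_normD _ _))// !normrM ger0_norm//.
  have arith (a b q : R) : a <= q -> b <= q -> 2^-1 * a + 2^-1 * b <= q by lra.
  exact: arith (cf chi tchi) (cg chi tchi).
have C_bounded i : exists2 f, C i f & sqh1norm f <= 17 * B.
  have [A iA [A0 eA]] := psi_large i.+1%:R.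
  have sol := psi_sol A0; have [IB IB2] := BP _ _ _ c_smooth div_c sol.
  pose m := fine (mu Omega); have m0 : 0 <= m by exact: fine_ge0.
  (* truncating at level d changes the integral by at most eps, and the pairing
   with c . grad chi by at most 1 / (i + 1) times the L^1 norm of the latter *)
pose d := Num.min (eps / (2 * (m + 1))) (i.+1%:R^-1 / 2).
  have m1 : 0 < m + 1 by rewrite ltr_wpDl.
  have d0 : 0 < d by rewrite lt_min !divr_gt0// ?mulr_gt0// invr_gt0.
  have d1 : 2 * d * (m + 1) <= eps.
    have : d <= eps / (2 * (m + 1)) by rewrite ge_min lexx.
    by rewrite ler_pdivlMr ?mulr_gt0//; lra.
  have d2 : 2 * d <= i.+1%:R^-1.
    have : d <= i.+1%:R^-1 / 2 by rewrite ge_min lexx orbT.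
    by rewrite ler_pdivlMr// mulrC.
  exists (approx Omega (psi A) d).
    split; first exact: (approx_test oO bO sol d0).
      apply: le_trans (approx_Int oO bO sol d0); rewrite -/m.
      have : 0 <= d by exact: ltW.
      move: d1 eA; nra.
    move=> chi tchi.
    apply: (le_trans (approx_pairing oO bO c_smooth div_c A0 sol d0 tchi)).
    rewrite /p [leRHS]mulrDr lerD//; last by rewrite ler_wpM2r//; exact: Int_ge0.
    apply: ler_pM => //.
    - by rewrite invr_ge0 ltW.
    - rewrite addr_ge0//; first exact: Int_ge0.
      rewrite mulr_ge0// addr_ge0//; first by apply: Int_ge0 => x _; exact: sqgrad_ge0.
      by apply: Int_ge0 => x Ox; exact/ltW/(psi_gt0 oO bO sol Ox).
    - by rewrite lef_pV2 ?posrE.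
    - by rewrite lerD2l ler_pM2l// lerD2l.
  have := approx_Int_sqr oO bO sol d0.
  have := approx_Int_sqgrad oO bO c_smooth div_c sol d0.
  rewrite /sqh1norm; lra.
have [y [yC yq]] := nested_convex_cauchy sqh1norm_ge0 C_nested C_mid C_bounded
  (fun f g Cf Cg => sqh1norm_parallelogram
    (let: And3 t _ _ := Cf in t) (let: And3 t _ _ := Cg in t)).
exists y; split.
- by move=> m; have [] := yC m.
- by move=> m; have [] := yC m.
- move=> chi tchi; apply/norm_cvg0P.
  have key : (fun m => m.+1%:R^-1 * p chi) @ \oo --> (0 : R).
    rewrite -[X in _ --> X](mul0r (p chi)); apply: cvgM; last exact: cvg_cst.
    exact: cvg_harmonic.
  apply: (squeeze_cvgr _ (cvg_cst (0 : R)) key); near=> m.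
  by rewrite normr_ge0/=; have [_ _] := yC m; exact.
- by move=> e e0; have [N NP] := yq e e0; exists N.
Unshelve. all: by end_near. Qed.

End construct.

Section limit.
Context {R : realType} {n : nat}.
Local Notation mu := (@lebesgue_rV R n).
Variable Omega : set 'rV[R]_n.
Hypothesis oO : open Omega.
Hypothesis bO : bounded_set Omega.
Local Notation Int f := (\int[mu]_(x in Omega) f x).
Local Notation bmeas := (bounded_meas Omega).
Local Notation L2 := (L2 Omega).
Variables (c : 'rV[R]_n -> 'rV[R]_n).
Hypothesis c_smooth : smooth_vector_field Omega c.
Hypothesis div_c : incompressible Omega c.

Lemma test_integral_by_parts f chi i : (forall k, Ck k Omega f) ->
  test_function Omega chi -> bmeas f -> bmeas (partial i f) ->
  Int (fun x => f x * partial i chi x) = - Int (fun x => partial i f x * chi x).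
Proof.
move=> fk tchi nf ndf.
have nc := test_bmeas oO tchi; have ndc := test_partial_bmeas oO i tchi.
have sV : csupp Omega (fun x => f x * chi x) by apply: csuppMr; exact: test_csupp.
have cV : Ck 1 Omega (fun x => f x * chi x) by apply: CkM => //; exact: test_Ck.
have := Int_partial oO i sV cV.
rewrite (@Int_eq _ _ _ _ (fun x => f x * partial i chi x + partial i f x * chi x)).
  by rewrite IntD//; [move=> /eqP; rewrite addr_eq0 => /eqP|exact: bmeasM|exact: bmeasM].
move=> x Ox; have d1 := Ck_isderive (fk 1%N) i Ox.
have d2 := Ck_isderive (test_Ck 1 tchi) i Ox.
have [_] := is_deriveM d1 d2.
by rewrite /partial => dE; apply: (etrans dE); rewrite /GRing.scale/= [X in _ + X]mulrC.
Qed.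

Variables (y : nat -> 'rV[R]_n -> R) (eps : R).
Hypothesis eps0 : 0 < eps.
Hypothesis ty : forall m, test_function Omega (y m).
Hypothesis Iy : forall m, eps <= Int (y m).
Hypothesis cy : forall chi, test_function Omega chi ->
  (fun m => Int (fun x => y m x * cgrad c chi x)) @ \oo --> (0 : R).
Hypothesis y_cauchy : forall e, 0 < e -> exists N, forall i j,
  (N <= i)%N -> (N <= j)%N -> sqh1norm Omega (fun x => y i x - y j x) <= e.

Let ny m : bmeas (y m). Proof. exact: (test_bmeas oO (ty m)). Qed.
Let ndy i m : bmeas (partial i (y m)). Proof. exact: (test_partial_bmeas oO i (ty m)). Qed.

(** Psi is the limit of the y_m and G that of their gradients. The limit
    g = c . G of c . grad y_m is orthogonal to all test functions, by
    antisymmetry; since each c . grad y_m is itself a test function, g is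
    orthogonal to its own approximations, so that g = 0. The integral of Psi is
    at least eps, so Psi does not vanish. *)
Lemma first_integral_of_cauchy : exists Psi : 'rV[R]_n -> R,
  [/\ H10 Omega Psi, first_integral Omega c Psi & ~ ae_zero Omega Psi].
Proof.
have subE m k : (fun x => y m x - y k x) = (fun x => 1 * y m x + -1 * y k x).
  by apply/funext => x; rewrite mul1r mulN1r.
have tsub m k : test_function Omega (fun x => y m x - y k x).
  by rewrite subE; exact: test_lin.
have [Psi LPsi yPsi] : exists2 g, L2 g & L2cvg Omega y g.
  apply: l2_limit => // e e0; have [N NP] := y_cauchy e0; exists N => i j Ni Nj.
  apply: le_trans (NP i j Ni Nj); rewrite /sqh1norm lerDl.
  by apply: Int_ge0 => x _; exact: sqgrad_ge0.
have /choice[G GP] (i : 'I_n) : exists g, L2 g /\ L2cvg Omega (fun m => partial i (y m)) g.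
  have [|e e0|g Lg yg] := @l2_limit R n Omega oO bO (fun m => partial i (y m)).
  - by move=> m; exact: ndy.
  - have [N NP] := y_cauchy e0; exists N => j k Nj Nk.
    apply: le_trans (NP j k Nj Nk); rewrite /sqh1norm.
    rewrite (@le_trans _ _ (Int (sqgrad (fun x => y j x - y k x))))//; last first.
      by rewrite lerDr Int_sqr_ge0.
    apply: Int_le => //.
    - by apply: bmeasX; exact: bmeasB.
    - exact: (sqgrad_test_bmeas oO (tsub j k)).
    move=> x Ox; rewrite /sqgrad (bigD1 i)//= subE (partial_lin 1 (-1) i (ty j) (ty k) Ox).
    rewrite mul1r mulN1r.
    by rewrite lerDl; apply: sumr_ge0 => l _; exact: sqr_ge0.
  - by exists g.
have LG i : L2 (G i) by have [] := GP i.
have yG i : L2cvg Omega (fun m => partial i (y m)) (G i) by have [] := GP i.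
pose GG x : 'rV[R]_n := \row_i G i x.
have Ly m : L2 (y m) by exact: bmeas_L2.
have Ldy i m : L2 (partial i (y m)) by exact: bmeas_L2.
have GGE i : (fun x => GG x ord0 i) = G i by apply/funext => x; rewrite mxE.
have H1 : H1_gradient Omega Psi GG.
  split=> [//|i|i phi tphi]; first by rewrite GGE.
  have ndphi := test_partial_bmeas oO i tphi; have nphi := test_bmeas oO tphi.
  have c1 := L2cvg_pair oO Ly LPsi (bmeas_L2 oO bO ndphi) yPsi.
  have c2 := L2cvg_pair oO (Ldy i) (LG i) (bmeas_L2 oO bO nphi) (yG i).
  have c3 : (fun m => Int (fun x => y m x * partial i phi x)) @ \oo -->
      - Int (fun x => G i x * phi x).
    have -> : (fun m => Int (fun x => y m x * partial i phi x)) =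
        (fun m => - Int (fun x => partial i (y m) x * phi x)).
      apply/funext => m; apply: test_integral_by_parts => // k.
      exact: (test_Ck k (ty m)).
    exact: (cvgN c2).
  have -> := cvg_unique (@Rhausdorff R) c1 c3.
  by congr (- _); apply: Int_eq => x _; rewrite mxE.
exists Psi; split.
- exists GG => // e e0.
  pose e' := e / (2 * (n%:R + 1)); have e'0 : 0 < e'.
    by rewrite divr_gt0// mulr_gt0// ltr_wpDl.
  have n1 : \forall m \near \oo, Int (fun x => (y m x - Psi x) ^+ 2) <= e'.
    have /cvgrPdist_le := yPsi => /(_ _ e'0); apply: filterS => m.
    by rewrite sub0r normrN; apply: le_trans; exact: ler_norm.
  have n2 : \forall m \near \oo, forall i,
      Int (fun x => (partial i (y m) x - G i x) ^+ 2) <= e'.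
    apply: filter_forall => i; have /cvgrPdist_le := yG i => /(_ _ e'0).
    by apply: filterS => m; rewrite sub0r normrN; apply: le_trans; exact: ler_norm.
  have [m [m1 m2]] := filter_ex (filterI n1 n2).
  exists (y m) => //; rewrite /sqnormH1.
  have -> : sqnormL2 Omega (fun x => Psi x - y m x) =
      (Int (fun x => (y m x - Psi x) ^+ 2))%:E.
    rewrite (L2_sqnorm oO (L2B oO LPsi (Ly m))); congr EFin.
    by apply: Int_eq => x _; ring.
  have -> : (\sum_i sqnormL2 Omega (fun x => (GG x - gradient (y m) x)%R ord0 i) =
      (\sum_i Int (fun x => (partial i (y m) x - G i x) ^+ 2))%:E)%E.
    rewrite -sumEFin; apply: eq_bigr => i _.
    rewrite (_ : (fun x => _) = fun x => G i x - partial i (y m) x); last first.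
      by apply/funext => x; rewrite !mxE.
    rewrite (L2_sqnorm oO (L2B oO (LG i) (Ldy i m))); congr EFin.
    by apply: Int_eq => x _; ring.
  rewrite -EFinD lte_fin.
  have : \sum_i Int (fun x => (partial i (y m) x - G i x) ^+ 2) <= \sum_(i < n) e'.
    by apply: ler_sum => i _; exact: m2.
  rewrite sumr_const card_ord -mulr_natl => m3.
  have e'E : n%:R * e' + e' = e / 2.
    by rewrite /e'; field; rewrite gt_eqF// ltr_wpDl.
  have : e / 2 < e by rewrite ltr_pdivrMr// ltr_pMr// ltr1n.
  rewrite -e'E; apply: le_lt_trans; rewrite addrC; exact: lerD.
- exists GG => //.
  pose g x := \sum_i c x ord0 i * G i x.
  have nc i := bmeas_field oO bO c_smooth i.
  have Lcy m : L2 (cgrad c (y m)).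
    by apply: bmeas_L2 => //; apply: (cgrad_bmeas oO bO c_smooth).
  have Lg : L2 g by apply: L2_sum => // i; exact: L2_bmeasM.
  have yg : L2cvg Omega (fun m => cgrad c (y m)) g.
    apply: (@L2cvg_sum R n Omega oO bO _ _ (fun m i x => c x ord0 i * partial i (y m) x)
      (fun i x => c x ord0 i * G i x)).
    - by move=> m i; exact: L2_bmeasM.
    - by move=> i; exact: L2_bmeasM.
    - by move=> i; apply: L2cvg_bmeasM => //; exact: Ldy.
  have g_orth chi : test_function Omega chi -> Int (fun x => g x * chi x) = 0.
    move=> tchi; have nchi := test_bmeas oO tchi.
    have c1 := L2cvg_pair oO Lcy Lg (bmeas_L2 oO bO nchi) yg.
    have c2 : (fun m => Int (fun x => cgrad c (y m) x * chi x)) @ \oo --> (0 : R).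
      have -> : (fun m => Int (fun x => cgrad c (y m) x * chi x)) =
          (fun m => - Int (fun x => y m x * cgrad c chi x)).
        apply/funext => m; rewrite (Int_cgrad_anti oO bO c_smooth div_c _ tchi).
          by rewrite opprK; exact: Int_mulC.
        by move=> k; exact: (test_Ck k (ty m)).
      by rewrite -[X in _ --> X]oppr0; exact: (cvgN (cy tchi)).
    exact: (cvg_unique (@Rhausdorff R) c1 c2).
  have g_cy m : Int (fun x => g x * cgrad c (y m) x) = 0.
    have tcy : test_function Omega (cgrad c (y m) \_ Omega).
      apply: csupp_test => //.
        have [K [cK KO y0]] := test_csupp (ty m).
        exists K; split=> // x Ox Kx; rewrite /cgrad big1// => i _.
        by rewrite (partial_off_compact oO cK y0)// mulr0.
      move=> k; apply: Ck_sum => // i; apply: CkM => //; first exact: Ck_field.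
      exact: (Ck_partial (test_Ck k.+1 (ty m)) i).
    rewrite -[RHS](g_orth _ tcy); apply: Int_eq => x Ox.
    by rewrite patchE mem_set.
  have g0 : Int (fun x => g x ^+ 2) = 0.
    rewrite Int_sqrE; have := L2cvg_pair oO Lcy Lg Lg yg.
    rewrite (_ : (fun m => _) = fun=> 0); last first.
      by apply/funext => m; rewrite Int_mulC g_cy.
    by move=> /(cvg_unique (@Rhausdorff R)); apply; exact: cvg_cst.
  have := Int_sqr_eq0 oO Lg g0; apply: filterS => x /= gx Ox.
  rewrite -(gx Ox) /dotr /g; apply: eq_bigr => i _; by rewrite mxE.
- move=> Psi0.
  have n1 : bmeas (fun=> 1 : R) by exact: bmeas_cst.
  have c1 := L2cvg_pair oO Ly LPsi (bmeas_L2 oO bO n1) yPsi.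
  have : eps <= Int (fun x => Psi x * 1).
    apply: (cvgr_to_ge c1); apply: nearW => m; rewrite (@Int_eq _ _ _ _ (y m))//.
    by move=> x _; rewrite mulr1.
  suff -> : Int (fun x => Psi x * 1) = 0 by rewrite leNgt eps0.
  rewrite /Rintegral (@ae_eq_integral _ _ _ mu Omega (cst 0%E)) ?integral0//.
  - exact: mOmega.
  - by apply/measurable_EFinP; apply: measurable_funM => //; case: LPsi.
  - by move: Psi0; apply: filterS => x /= P0 Ox; rewrite P0// mul0r.
Qed.

End limit.

(** * A first integral keeps the solutions away from zero *)

Section obstruction.
Context {R : realType} {n : nat}.
Local Notation mu := (@lebesgue_rV R n).
Variable Omega : set 'rV[R]_n.
Hypothesis oO : open Omega.
Hypothesis bO : bounded_set Omega.
Local Notation Int f := (\int[mu]_(x in Omega) f x).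
Local Notation bmeas := (bounded_meas Omega).
Local Notation L2 := (L2 Omega).
Variables (c : 'rV[R]_n -> 'rV[R]_n).
Hypothesis c_smooth : smooth_vector_field Omega c.
Hypothesis div_c : incompressible Omega c.

Section test_inequality.
Variables (A delta : R) (psi : 'rV[R]_n -> R).
Hypothesis sol : solves_bvp Omega c A psi.
Hypothesis delta0 : 0 < delta.

Let w x := (psi x + delta)^-1.
Let zeta x := ln (psi x + delta).

Let pd0 x : Omega x -> 0 < psi x + delta.
Proof. by move=> Ox; rewrite addr_gt0// (psi_gt0 oO bO sol Ox). Qed.

Let pd_Ck k : Ck k Omega (fun x => psi x + delta).
Proof. by apply: CkD => //; [exact: (psi_Ck sol k)|exact: Ck_cst]. Qed.

Lemma inv_shift_Ck k : Ck k Omega w.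
Proof. by apply: Ck_inv => // x Ox; rewrite gt_eqF// pd0. Qed.

Lemma ln_shift_Ck k : Ck k Omega zeta.
Proof. by apply: Ck_ln => // x Ox; exact: pd0. Qed.

Lemma inv_shift_bmeas : bmeas w.
Proof.
split; first exact: (Ck_measurable oO (inv_shift_Ck 0)).
exists delta^-1 => x Ox; rewrite ger0_norm ?invr_ge0 ?(ltW (pd0 Ox))//.
by rewrite lef_pV2 ?posrE ?pd0// lerDr (ltW (psi_gt0 oO bO sol Ox)).
Qed.

Lemma ln_shift_bmeas : bmeas zeta.
Proof.
split; first exact: (Ck_measurable oO (ln_shift_Ck 0)).
have [_ [B pB]] := psi_bmeas oO bO sol; exists (`|ln delta| + `|ln (B + delta)|) => x Ox.
have p0 := psi_gt0 oO bO sol Ox.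
have pBx : psi x <= B by rewrite (le_trans (ler_norm _))// pB.
have l1 : ln delta <= zeta x by rewrite ler_ln ?posrE ?pd0// lerDr ltW.
have l2 : zeta x <= ln (B + delta).
  by rewrite ler_ln ?posrE ?pd0// ?lerD2r// (lt_le_trans (pd0 Ox))// lerD2r.
rewrite ler_norml; apply/andP; split.
  apply: le_trans l1; rewrite lerNl (le_trans (ler_norm _))// normrN.
  by rewrite lerDl.
by rewrite (le_trans l2)// (le_trans (ler_norm _))// lerDr.
Qed.

(** The equation tested against phi^2 / (psi + delta). With the logarithm zeta
    of psi + delta, the drift term is an integral of phi^2 c . grad zeta, which
    becomes a pairing of c . grad phi; and the square
    |grad phi - phi w grad psi|^2 >= 0 removes the gradient of psi. *)
Lemma test_inequality phi : test_function Omega phi ->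
  Int (fun x => phi x ^+ 2 * w x) <=
  Int (sqgrad phi) - 2 * A * Int (fun x => phi x * (zeta x * cgrad c phi x)).
Proof.
move=> tphi; have fk := fun k => test_Ck k tphi; have sphi := test_csupp tphi.
have nphi := test_bmeas oO tphi; have ng := sqgrad_test_bmeas oO tphi.
have nc : bmeas (cgrad c phi).
  by apply: (cgrad_bmeas oO bO c_smooth) => i; exact: (test_partial_bmeas oO i tphi).
have nw := inv_shift_bmeas; have nz := ln_shift_bmeas.
pose V i x := phi x * (phi x * (w x * partial i psi x)) -
  A * (phi x * (phi x * (zeta x * c x ord0 i))).
have sV i : csupp Omega (V i).
  apply: csuppD; first exact: csuppMl.
  rewrite (_ : (fun _ => _) = fun x => phi x * (- A * (phi x * (zeta x * c x ord0 i)))).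
    exact: csuppMl.
  by apply/funext => x; ring.
have cV i : Ck 1 Omega (V i).
  apply: CkB => //.
    do 2 apply: CkM => //; apply: CkM => //; first exact: inv_shift_Ck.
    exact: (Ck_partial (psi_Ck sol 2) i).
  apply: CkZ => //; do 2 apply: CkM => //; apply: CkM => //; first exact: ln_shift_Ck.
  exact: Ck_field.
have I0 := Int_divergence oO bO sV cV.
pose rhs x := sqgrad phi x - 2 * A * (phi x * (zeta x * cgrad c phi x)) - phi x ^+ 2 * w x.
have n1 : bmeas (fun x => phi x * (zeta x * cgrad c phi x)).
  by apply: bmeasM => //; exact: bmeasM.
have n2 : bmeas (fun x => phi x ^+ 2 * w x) by apply: bmeasM => //; exact: bmeasX.
have n3 : bmeas (fun x => sqgrad phi x - 2 * A * (phi x * (zeta x * cgrad c phi x))).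
  by apply: bmeasB => //; exact: bmeasZ.
have nrhs : bmeas rhs by exact: bmeasB.
have le_rhs : Int (fun x => \sum_i partial i (V i) x) <= Int rhs.
  apply: Int_le => //.
    apply: bmeas_sum => i; apply: bmeas_csupp => //; first exact: csupp_partial.
    exact: (Ck_partial (cV i) i).
  move=> x Ox; have eqn := psi_eqn sol Ox.
  pose t i := 2 * partial i phi x * (phi x * w x * partial i psi x) -
       (phi x * w x * partial i psi x) ^+ 2.
  have dV i : partial i (V i) x =
      phi x ^+ 2 * w x * partial i (partial i psi) x + t i -
      2 * A * (phi x * zeta x) * (c x ord0 i * partial i phi x) -
      A * (phi x ^+ 2 * w x) * (c x ord0 i * partial i psi x) -
      A * (phi x ^+ 2 * zeta x) * partial i (fun y => c y ord0 i) x.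
    have dp := Ck_isderive (fk 1%N) i Ox.
    have dpsi := Ck_isderive (pd_Ck 1) i Ox.
    have dpsiE : partial i (fun x => psi x + delta) x = partial i psi x.
      have d1 := Ck_isderive (psi_Ck sol 1) i Ox.
      have [_] := is_deriveD d1 (is_derive_cst delta x (delta_mx ord0 i)).
      by rewrite addr0.
    rewrite dpsiE in dpsi.
    have dpp := Ck_isderive (Ck_partial (psi_Ck sol 2) i) i Ox.
    have dc := Ck_isderive (Ck_field c_smooth 1 i) i Ox.
    have dz := is_derive_comp dpsi (is_derive1_ln (pd0 Ox)).
    have dw : is_derive x (delta_mx ord0 i) w (- (w x ^+ 2 * partial i psi x)).
      have pn0 : psi x + delta != 0 by rewrite gt_eqF// pd0.
      have dd : derivable (fun x => psi x + delta) x (delta_mx ord0 i).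
        by case: dpsi.
      have dV := derivableV (f := fun x => psi x + delta) pn0 dd.
      have dE := deriveV (f := fun x => psi x + delta) pn0 dd.
      have [_ dpE] := dpsi; rewrite dpE in dE.
      apply: (DeriveDef dV); apply: (etrans dE).
      by rewrite /GRing.scale/= mulNr /w exprVn.
    have [_] := is_deriveB (is_deriveM dp (is_deriveM dp (is_deriveM dw dpp)))
      (is_deriveZ A (is_deriveM dp (is_deriveM dp (is_deriveM dz dc)))).
    rewrite {1}/partial => dE; apply: (etrans dE).
    rewrite /GRing.scale/= !fctE/= -/(w x) -/(zeta x) -!/(partial _ _ _) /t.
    ring.
  have sqt i : t i <= partial i phi x ^+ 2.
    rewrite -subr_ge0 /t; set a := partial i phi x.
    set b := phi x * w x * partial i psi x.
    rewrite [leRHS](_ : _ = (a - b) ^+ 2) ?sqr_ge0//; ring.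
  clearbody t; rewrite (eq_bigr _ (fun i _ => dV i)).
  rewrite !sumrB !big_split/= -!mulr_sumr -/(cgrad c phi x).
  have := div_c Ox; rewrite /divergence => ->; rewrite mulr0 subr0.
  have sq : \sum_i t i <= sqgrad phi x by apply: ler_sum => i _; exact: sqt.
  move: sq; rewrite /rhs.
  set a := \sum_i partial i (partial i psi) x in eqn *.
  set b := \sum_i c x ord0 i * partial i psi x in eqn *.
  have -> : a = A * b - 1 by move: eqn; lra.
  move: (\sum_i t i) => s sq; rewrite -subr_ge0.
  rewrite [leRHS](_ : _ = sqgrad phi x - s) ?subr_ge0//; ring.
rewrite I0 /rhs in le_rhs; move: le_rhs.
rewrite IntB// IntB//; last exact: bmeasZ.
by rewrite IntZ// subr_ge0.
Qed.

End test_inequality.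

(** Membership in H^1_0 and the first integral property may come with two
    different weak gradients G and G'. Both agree when tested against the smooth
    compactly supported fields h c, and c . G' = 0 almost everywhere. *)
Lemma first_integral_orth Psi G h : first_integral Omega c Psi ->
  H1_gradient Omega Psi G -> csupp Omega h -> (forall k, Ck k Omega h) ->
  Int (fun x => h x * \sum_i c x ord0 i * G x ord0 i) = 0.
Proof.
move=> [G' [LPsi LG' wG'] cG'0] [_ LG wG] sh hk.
pose tau i := (fun x => h x * c x ord0 i) \_ Omega.
have ttau i : test_function Omega (tau i).
  apply: csupp_test => //; first exact: csuppMl.
  by move=> k; apply: CkM => //; exact: Ck_field.
have Ltau i : L2 (tau i) by apply: bmeas_L2 => //; exact: (test_bmeas oO).
have splitI (H : 'rV[R]_n -> 'rV[R]_n) : (forall i, L2 (fun x => H x ord0 i)) ->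
    Int (fun x => h x * \sum_i c x ord0 i * H x ord0 i) =
    \sum_i Int (fun x => H x ord0 i * tau i x).
  move=> LH; rewrite (@Int_eq _ _ _ _ (fun x => \sum_i (H x ord0 i * tau i x))).
    exact: (Int_sum_mul oO bO _ LH Ltau).
  move=> x Ox; rewrite mulr_sumr; apply: eq_bigr => i _.
  by rewrite /tau patchE mem_set//; ring.
rewrite (splitI G LG).
rewrite (eq_bigr (fun i => Int (fun x => G' x ord0 i * tau i x))); last first.
  move=> i _; have := wG i _ (ttau i); rewrite (wG' i _ (ttau i)) => /eqP.
  by rewrite eqr_opp => /eqP.
rewrite -(splitI G' LG') /Rintegral.
rewrite (@ae_eq_integral _ _ _ mu Omega (cst 0%E)) ?integral0//.
- exact: mOmega.
- apply/measurable_EFinP; apply: measurable_funM.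
    exact: (Ck_measurable oO (hk 0%N)).
  apply: measurable_sum => i; apply: measurable_funM; last by case: (LG' i).
  by case: (bmeas_field oO bO c_smooth i).
- by move: cG'0; apply: filterS => x /= cG' Ox; rewrite -/(dotr (c x) (G' x)) cG'// mulr0.
Qed.

(** The test inequality with delta = M, along test functions phi converging to
    Psi in H^1. On the left 1 / (psi + M) >= 1 / (2 M); on the right the
    drift term converges to a multiple of the integral of
    Psi ln (psi + M) c . G, which vanishes as the limit of integrals that are
    zero by [first_integral_orth]. The resulting bound does not depend on A. *)
Lemma obstruction_bound Psi G (A : R) psi (M : R) :
  0 < A -> solves_bvp Omega c A psi -> 0 < M -> (forall x, Omega x -> psi x <= M) ->
  first_integral Omega c Psi -> H1_gradient Omega Psi G ->
  (forall eps : R, 0 < eps -> exists2 phi, test_function Omega phi &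
    (sqnormH1 Omega (fun x => Psi x - phi x)%R
       (fun x => G x - gradient phi x)%R < eps%:E)%E) ->
  Int (fun x => Psi x ^+ 2) <= 2 * M * Int (fun x => \sum_i G x ord0 i ^+ 2).
Proof.
move=> A0 sol M0 pM fi HG approx_; have [LPsi LG _] := HG.
have /choice[phi phiP] (m : nat) : exists phi, test_function Omega phi /\
    (sqnormH1 Omega (fun x => Psi x - phi x)%R
       (fun x => G x - gradient phi x)%R < (m.+1%:R^-1)%:E)%E.
  have e0 : 0 < m.+1%:R^-1 :> R by rewrite invr_gt0.
  by have [f tf fP] := approx_ _ e0; exists f.
have tphi m : test_function Omega (phi m) by have [] := phiP m.
have Lphi m : L2 (phi m) by apply: bmeas_L2 => //; exact: (test_bmeas oO).
have Ldphi i m : L2 (partial i (phi m)) by apply: bmeas_L2 => //; exact: (test_partial_bmeas oO).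
have Ld m : L2 (fun x => Psi x - phi m x) by exact: L2B.
have Ldd i m : L2 (fun x => (G x - gradient (phi m) x) ord0 i).
  rewrite (_ : (fun _ => _) = fun x => G x ord0 i - partial i (phi m) x).
    exact: L2B.
  by apply/funext => x; rewrite !mxE.
have small m : Int (fun x => (Psi x - phi m x) ^+ 2) +
    \sum_i Int (fun x => (G x - gradient (phi m) x) ord0 i ^+ 2) < m.+1%:R^-1.
  have [_] := phiP m; rewrite /sqnormH1 (L2_sqnorm oO (Ld m)).
  under eq_bigr do rewrite (L2_sqnorm oO (Ldd _ m)).
  by rewrite sumEFin -EFinD lte_fin.
have harm : (fun m => m.+1%:R^-1) @ \oo --> (0 : R) by exact: cvg_harmonic.
have phicvg : L2cvg Omega phi Psi.
  apply: (squeeze_cvgr _ (cvg_cst (0 : R)) harm); near=> m.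
  rewrite Int_sqr_ge0/= (le_trans _ (ltW (small m)))//.
  rewrite [leLHS](_ : _ = Int (fun x => (Psi x - phi m x) ^+ 2)).
    by rewrite lerDl; apply: sumr_ge0 => i _; exact: Int_sqr_ge0.
  by apply: Int_eq => x _; ring.
have dphicvg i : L2cvg Omega (fun m => partial i (phi m)) (fun x => G x ord0 i).
  apply: (squeeze_cvgr _ (cvg_cst (0 : R)) harm); near=> m.
  rewrite Int_sqr_ge0/= (le_trans _ (ltW (small m)))//.
  rewrite [leLHS](_ : _ = Int (fun x => (G x - gradient (phi m) x) ord0 i ^+ 2)).
    rewrite (bigD1 i)//= addrCA lerDl addr_ge0 ?Int_sqr_ge0//.
    by apply: sumr_ge0 => j _; exact: Int_sqr_ge0.
  by apply: Int_eq => x _; rewrite !mxE; ring.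
pose zeta x := ln (psi x + M).
have nz : bmeas zeta by exact: (ln_shift_bmeas sol M0).
have nc i := bmeas_field oO bO c_smooth i.
pose cG x := \sum_i c x ord0 i * G x ord0 i.
have LcG : L2 cG by apply: L2_sum => // i; exact: L2_bmeasM.
have Lcphi m : L2 (cgrad c (phi m)).
  apply: bmeas_L2 => //; apply: (cgrad_bmeas oO bO c_smooth) => i.
  exact: (test_partial_bmeas oO).
have cphicvg : L2cvg Omega (fun m => cgrad c (phi m)) cG.
  apply: (@L2cvg_sum R n Omega oO bO _ _ (fun m i x => c x ord0 i * partial i (phi m) x)
      (fun i x => c x ord0 i * G x ord0 i)).
  - by move=> m i; exact: L2_bmeasM.
  - by move=> i; exact: L2_bmeasM.
  - by move=> i; apply: L2cvg_bmeasM => //; exact: Ldphi.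
have drift0 : (fun m => Int (fun x => phi m x * (zeta x * cgrad c (phi m) x))) @ \oo
    --> (0 : R).
  have vcvg := L2cvg_bmeasM oO nz Lcphi LcG cphicvg.
  have Lv m := L2_bmeasM oO nz (Lcphi m); have Lv0 := L2_bmeasM oO nz LcG.
  have c1 := L2cvg_mul oO Lphi Lv LPsi Lv0 phicvg vcvg.
  have c2 := L2cvg_pair oO Lphi LPsi Lv0 phicvg.
  have orth m : Int (fun x => phi m x * (zeta x * cG x)) = 0.
    rewrite (@Int_eq _ _ _ _ (fun x => (phi m x * zeta x) * cG x)).
      apply: (first_integral_orth fi HG).
        by apply: csuppMl; exact: test_csupp.
      move=> k; apply: CkM => //; first exact: test_Ck.
      exact: (ln_shift_Ck sol M0).
    by move=> x _; rewrite mulrA.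
  rewrite (_ : (fun m => _) = fun=> 0) in c2; last by apply/funext => m; exact: orth.
  by have <- := cvg_unique (@Rhausdorff R) c2 (cvg_cst (0 : R)).
have ineq m : (2 * M)^-1 * Int (fun x => phi m x ^+ 2) <=
    Int (sqgrad (phi m)) - 2 * A * Int (fun x => phi m x * (zeta x * cgrad c (phi m) x)).
  apply: le_trans (test_inequality sol M0 (tphi m)).
  have nphi := test_bmeas oO (tphi m).
  rewrite -IntZ//; last exact: bmeasX.
  apply: Int_le => //.
  - by apply: bmeasZ; exact: bmeasX.
  - by apply: bmeasM; [exact: bmeasX|exact: (inv_shift_bmeas sol M0)].
  move=> x Ox; rewrite mulrC ler_wpM2l ?sqr_ge0//.
  have p0 := psi_gt0 oO bO sol Ox.
  rewrite lef_pV2 ?posrE ?addr_gt0 ?mulr_gt0//.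
  have := pM x Ox; lra.
have l1 : (fun m => (2 * M)^-1 * Int (fun x => phi m x ^+ 2)) @ \oo -->
    (2 * M)^-1 * Int (fun x => Psi x ^+ 2).
  apply: cvgM; first exact: cvg_cst.
  rewrite (Int_sqrE Omega Psi); under eq_fun do rewrite Int_sqrE.
  exact: (L2cvg_mul oO Lphi Lphi LPsi LPsi phicvg phicvg).
have l2 : (fun m => Int (sqgrad (phi m))) @ \oo --> Int (fun x => \sum_i G x ord0 i ^+ 2).
  have sumE (F : 'I_n -> 'rV[R]_n -> R) : (forall i, L2 (F i)) ->
      Int (fun x => \sum_i F i x ^+ 2) = \sum_i Int (fun x => F i x * F i x).
    move=> LF; rewrite -(Int_sum_mul oO bO _ LF LF); apply: Int_eq => x _.
    by apply: eq_bigr => i _; rewrite expr2.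
  rewrite sumE// (_ : (fun m => _) =
    fun m => \sum_i Int (fun x => partial i (phi m) x * partial i (phi m) x)).
    apply: cvg_big => [|i _]; first exact: add_continuous.
    exact: (L2cvg_mul oO (Ldphi i) (Ldphi i) (LG i) (LG i) (dphicvg i) (dphicvg i)).
  by apply/funext => m; rewrite /sqgrad sumE.
have l3 : (fun m => Int (sqgrad (phi m)) -
    2 * A * Int (fun x => phi m x * (zeta x * cgrad c (phi m) x))) @ \oo -->
    Int (fun x => \sum_i G x ord0 i ^+ 2).
  rewrite -[X in _ --> X]subr0 -[X in _ --> _ - X](mulr0 (2 * A)).
  by apply: cvgB => //; apply: cvgM => //; exact: cvg_cst.
rewrite -ler_pdivrMl ?mulr_gt0//.
by apply: (ler_cvg_to l1 l3); exact: nearW.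
Unshelve. all: by end_near. Qed.

End obstruction.

(** * The equivalence *)

Section decay.
Context {R : realType} {n : nat}.
Local Notation mu := (@lebesgue_rV R n).
Variable Omega : set 'rV[R]_n.
Hypothesis oO : open Omega.
Hypothesis bO : bounded_set Omega.
Hypothesis n0 : (0 < n)%N.
Local Notation Int f := (\int[mu]_(x in Omega) f x).
Variables (c : 'rV[R]_n -> 'rV[R]_n).
Hypothesis c_smooth : smooth_vector_field Omega c.
Hypothesis div_c : incompressible Omega c.

(** The De Giorgi iteration started at the level e / 2: if the integral of psi
    is small, so is the measure of that superlevel set. *)
Lemma sup_bound_of_integral e : 0 < e -> exists2 eta : R, 0 < eta &
  forall A psi, solves_bvp Omega c A psi -> Int psi <= eta ->
    forall x, Omega x -> psi x <= e.
Proof.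
move=> e0; pose d := e / 2; have d0 : 0 < d by rewrite divr_gt0.
pose T := d ^+ 4 / (16 * 4 ^+ n).
have T0 : 0 < T by rewrite divr_gt0 ?exprn_gt0// mulr_gt0// exprn_gt0.
have C0 := @de_giorgi_cst_gt0 R n.
pose rho := Num.min 1 (T / @de_giorgi_cst R n).
have r0 : 0 < rho by rewrite lt_min ltr01 divr_gt0.
have r1 : rho <= 1 by rewrite ge_min lexx.
have rT : @de_giorgi_cst R n * rho ^+ 8 <= T.
  have : rho ^+ 8 <= rho by rewrite exprS ler_piMr ?(ltW r0)// exprn_ile1// ltW.
  have : rho <= T / @de_giorgi_cst R n by rewrite ge_min lexx orbT.
  rewrite ler_pdivlMr// mulrC => h1 h2; apply: le_trans h1.
  by rewrite ler_pM2l.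
exists (d * rho ^+ n / 4); first by rewrite divr_gt0// mulr_gt0// exprn_gt0.
move=> A psi sol small x Ox; have -> : e = d + d by rewrite /d; field.
apply: (de_giorgi_iteration oO bO c_smooth div_c sol n0 d0 d0 r0 r1 rT) => //.
have : d * mu_suplevel Omega psi d <= Int psi.
  rewrite -(Int_indic_suplevel oO bO sol); apply: Int_le => //.
  - exact: (bmeas_indic_suplevel oO sol).
  - exact: (psi_bmeas oO bO sol).
  - move=> z Oz; have p0 := psi_gt0 oO bO sol Oz.
    rewrite indicE; case: (boolP (z \in suplevel Omega psi d)) => [|_].
      by rewrite inE => -[_ dz]; rewrite mulr1 ltW.
    by rewrite mulr0 ltW.
move=> /le_trans /(_ small); rewrite -mulrA ler_pM2l//; lra.
Qed.

Variable psi : R -> 'rV[R]_n -> R.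
Hypothesis psi_sol : forall A : R, 0 < A -> solves_bvp Omega c A (psi A).

Lemma integral_decay :
  ~ (exists Psi : 'rV[R]_n -> R,
       [/\ H10 Omega Psi, first_integral Omega c Psi & ~ ae_zero Omega Psi]) ->
  forall eta, 0 < eta ->
    exists A0, forall A, A0 <= A -> 0 < A -> Int (psi A) <= eta.
Proof.
move=> noPsi eta eta0; apply: contrapT => H; apply: noPsi.
have eta2 : 0 < eta / 2 by rewrite divr_gt0.
have [|y [ty Iy cy yc]] :=
    persistent_cauchy oO bO c_smooth div_c psi_sol n0 eta2.
  move=> A0; apply: contrapT => HA; apply: H; exists A0 => A A0A A_gt0.
  rewrite leNgt; apply/negP => lt; apply: HA; exists A => //; split=> //.
  by rewrite mulrC divfK// ltW.
exact: (first_integral_of_cauchy oO bO c_smooth div_c eta2 ty Iy cy yc).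
Qed.

Lemma sup_psi_bounds A e : Omega !=set0 -> 0 < A ->
  (forall x, Omega x -> psi A x <= e) -> 0 <= sup [set psi A x | x in Omega] <= e.
Proof.
move=> [z Oz] A0 pe; apply/andP; split.
  apply: (@le_trans _ _ (psi A z)).
    exact/ltW/(psi_gt0 oO bO (psi_sol A0) Oz).
  apply: ub_le_sup; first by exists e => _ [x Ox <-]; exact: pe.
  by exists z.
apply: ge_sup; first by exists (psi A z), z.
by move=> _ [x Ox <-]; exact: pe.
Qed.

Lemma le_sup_psi A x : 0 < A -> Omega x -> psi A x <= sup [set psi A x | x in Omega].
Proof.
move=> A0 Ox; apply: ub_le_sup; last by exists x.
have [_ [B pB]] := psi_bmeas oO bO (psi_sol A0).
by exists B => _ [z Oz <-]; rewrite (le_trans (ler_norm _))// pB.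
Qed.

End decay.

Theorem theorem1p1 (R : realType) (N : nat) (N_ge2 : (2 <= N)%N)
    (Omega : set 'rV[R]_N) (domOmega : smooth_bounded_domain Omega)
    (c : 'rV[R]_N -> 'rV[R]_N) (c_smooth : smooth_vector_field Omega c)
    (div_c : incompressible Omega c)
    (psi : R -> 'rV[R]_N -> R)
    (psi_sol : forall A : R, 0 < A -> solves_bvp Omega c A (psi A)) :
  sup [set psi A x | x in Omega] @[A --> +oo] --> (0 : R) <->
  ~ (exists Psi : 'rV[R]_N -> R,
       [/\ H10 Omega Psi, first_integral Omega c Psi & ~ ae_zero Omega Psi]).
Proof.
have [oO _ O0 bO _] := domOmega.
have n0 : (0 < N)%N by exact: leq_trans N_ge2.
split=> [sup0 [Psi [[G HG approxG] fi Psi_neq0]]|noPsi].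
  apply: Psi_neq0; have [LPsi _ _] := HG.
  apply: (Int_sqr_eq0 oO LPsi); apply/eqP; rewrite eq_le Int_sqr_ge0 andbT.
  set D := \int[lebesgue_rV N]_(x in Omega) (\sum_i G x ord0 i ^+ 2).
  have D0 : 0 <= D by apply: Int_ge0 => x _; apply: sumr_ge0 => i _; exact: sqr_ge0.
  apply/ler_addgt0Pr => e e0; rewrite add0r.
  pose M := e / (2 * (D + 1)).
  have M0 : 0 < M by rewrite divr_gt0// mulr_gt0// ltr_wpDl.
  have /cvgrPdist_lt /(_ _ M0) supM := sup0.
  have [A [AM A0]] : exists A : R, `|0 - sup [set psi A x | x in Omega]| < M /\ 0 < A.
    apply: (@filter_ex _ (pinfty_nbhs R)); near=> A; split; first by near: A.
    by near: A; exact: nbhs_pinfty_gt.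
  rewrite sub0r normrN in AM.
  have pM x : Omega x -> psi A x <= M.
    move=> Ox; rewrite (le_trans (le_sup_psi oO bO psi_sol A0 Ox))//.
    by rewrite (le_trans (ler_norm _))// ltW.
  apply: (le_trans (obstruction_bound oO bO c_smooth div_c A0 (psi_sol _ A0) M0 pM
    fi HG approxG)); rewrite -/D.
  have -> : e = 2 * M * (D + 1) by rewrite /M; field; rewrite gt_eqF// ltr_wpDl.
  by rewrite ler_wpM2l ?lerDl// mulr_ge0// ltW.
apply/cvgrPdist_le => e e0.
have [eta eta0 etaP] := sup_bound_of_integral oO bO n0 c_smooth div_c e0.
have [A0 A0P] := integral_decay oO bO n0 c_smooth div_c psi_sol noPsi eta0.
near=> A; have A_gt0 : 0 < A by near: A; exact: nbhs_pinfty_gt.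
have A0A : A0 <= A by near: A; apply: nbhs_pinfty_ge; exact: num_real.
have pe := etaP _ _ (psi_sol _ A_gt0) (A0P A A0A A_gt0).
have /andP[s0 se] := sup_psi_bounds oO bO psi_sol O0 A_gt0 pe.
by rewrite sub0r normrN ger0_norm.
Unshelve. all: by end_near. Qed.
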